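(* Let $d\ge 2$, let $\varphi:\mathbb{R}^d\times\mathbb{R}^d\to\mathbb{R}$ be a continuous function satisfying, for all $x,y,x'\in\mathbb{R}^d$, $$\varphi(x,x')=-\varphi(x',x)\quad\text{and}\quad |\varphi(x,y)+\varphi(y,x')-\varphi(x,x')|\le |x-y|\,|y-x'|.$$ Let $H\in\mathcal{C}_{1,0}$ be a self-adjoint operator on $L^2(\mathbb{R}^d)$ with integral kernel $H(x,x')$, and for $b\in\mathbb{R}$ let $H_b$ be the operator with integral kernel $e^{ib\varphi(x,x')}H(x,x')$ (so $H_0=H$). (i) If $H\in\mathcal{C}_{\rm unif}$, then the map $\mathbb{R}\ni b\mapsto d_H(\sigma(H_b),\sigma(H))\in[0,\infty)$ is continuous. (ii) If $H\in\mathcal{C}_{1,\alpha}$ for some $\alpha>0$, then this map is H\''older continuous with exponent $\beta:=\min\{1/2,\alpha/2\}$. More precisely, for every $b_0\in\mathbb{R}$ there exists a constant $C>0$ such that for all $\delta\in\mathbb{R}$ $$d_H(\sigma(H_{b_0+\delta}),\sigma(H_{b_0}))\le C\,|\delta|^{\beta}.$$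
   Context: Write $\langle x\rangle:=\sqrt{1+|x|^2}$. For $\alpha\ge 0$, $\mathcal{C}_{1,\alpha}$ is the set of bounded operators $T$ on $L^2(\mathbb{R}^d)$ that are integral operators with a locally integrable kernel $T(x,x')$ which is continuous outside the diagonal $\{x=x'\}$ and satisfies $$\|T\|_{1,\alpha}:=\max\Big\{\sup_{x'\in\mathbb{R}^d}\int_{\mathbb{R}^d}|T(x,x')|\langle x-x'\rangle^\alpha dx,\ \sup_{x\in\mathbb{R}^d}\int_{\mathbb{R}^d}|T(x,x')|\langle x-x'\rangle^\alpha dx'\Big\}<\infty .$$ For $T\in\mathcal{C}_{1,0}$ and $M\ge1$, $T_M$ denotes the operator with integral kernel $\chi(|x-x'|/M)\,T(x,x')$, where $\chi$ is the characteristic function of $[0,1]$. $\mathcal{C}_{\rm unif}$ is the set of $T\in\mathcal{C}_{1,0}$ with $\lim_{M\to\infty}\|T-T_M\|_{1,0}=0$. $\sigma(\cdot)$ denotes the spectrum. The Hausdorff distance between two compact sets $A,B\subset\mathbb{R}$ is $$d_H(A,B):=\max\Big\{\sup_{x\in A}\inf_{y\in B}|x-y|,\ \sup_{y\in B}\inf_{x\in A}|x-y|\Big\}.$$ *)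

(* Defs.v *)
From HB Require Import structures.
From mathcomp Require Import all_boot all_order all_algebra.
From mathcomp Require Import all_classical all_reals all_analysis.
From mathcomp Require Import complex.
Set Implicit Arguments.
Unset Strict Implicit.
Unset Printing Implicit Defensive.
Import Order.TTheory GRing.Theory Num.Theory.
Import numFieldNormedType.Exports.
Local Open Scope classical_set_scope.
Local Open Scope ring_scope.
Local Open Scope complex_scope.

(* The product sigma-algebra on R^n, i.e. the Borel sets, set up as the
   library does for n.-tuple. *)
Definition measure_rV_display : measure_display -> measure_display.
Proof. exact. Qed.

Section measurable_rV.
Context {d : measure_display} {T : sigmaRingType d} (n : nat).

Let coors : 'I_n -> 'rV[T]_n -> T := fun i x => x ord0 i.

Let rV_set0 : g_sigma_preimage coors set0.
Proof. exact: sigma_algebra0. Qed.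

Let rV_setC A : g_sigma_preimage coors A -> g_sigma_preimage coors (~` A).
Proof. exact: sigma_algebraC. Qed.

Let rV_bigcup (F : (set 'rV[T]_n)^nat) :
  (forall i, g_sigma_preimage coors (F i)) ->
  g_sigma_preimage coors (\bigcup_i (F i)).
Proof. exact: sigma_algebra_bigcup. Qed.

HB.instance Definition _ := @isMeasurable.Build (measure_rV_display d)
  'rV[T]_n (g_sigma_preimage coors) rV_set0 rV_setC rV_bigcup.

End measurable_rV.

Section measurable_rV_theory.
Context {d1 d2 : measure_display}.

Lemma measurable_coord (T : sigmaRingType d2) n (i : 'I_n) :
  measurable_fun [set: 'rV[T]_n] (fun x : 'rV[T]_n => x ord0 i).
Proof.
move=> _ Y mY; rewrite setTI; apply: sub_sigma_algebra => /=.
rewrite -bigcup_seq/=; exists i => /=; first by rewrite mem_index_enum.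
by exists Y => //; rewrite setTI.
Qed.

Lemma measurable_fun_coordP (T1 : measurableType d1) (T : measurableType d2) n
    (f : T1 -> 'rV[T]_n) :
  (forall i, measurable_fun [set: T1] (fun t => f t ord0 i)) ->
  measurable_fun [set: T1] f.
Proof.
move=> mf _ A mA; rewrite setTI.
suff : (@measurable _ 'rV[T]_n : set (set _)) `<=` [set A | measurable (f @^-1` A)].
  exact.
apply: smallest_sub.
  split => /=.
  - by rewrite preimage_set0.
  - by move=> B mB; rewrite setTD preimage_setC; exact: measurableC.
  - by move=> F mF; rewrite preimage_bigcup; exact: bigcup_measurable.
rewrite -bigcup_seq => B /= [i _ [C mC <-]].
by rewrite setTI; have := mf i measurableT C mC; rewrite setTI.
Qed.

End measurable_rV_theory.

Section lebesgue_rV.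
Variable R : realType.

Definition rV_cons n (p : measurableTypeR R * 'rV[R]_n) : 'rV[R]_n.+1 :=
  \row_i (if unlift ord0 i is Some j then p.2 ord0 j else p.1).

Definition rV_uncons n (v : 'rV[R]_n.+1) : measurableTypeR R * 'rV[R]_n :=
  (v ord0 ord0, \row_j v ord0 (lift ord0 j)).

Lemma rV_consK n : cancel (@rV_cons n) (@rV_uncons n).
Proof.
move=> [x v]; rewrite /rV_uncons /rV_cons !mxE unlift_none/=; congr pair.
by apply/rowP => j; rewrite !mxE liftK.
Qed.

Lemma measurable_rV_cons n : measurable_fun [set: _] (@rV_cons n).
Proof.
apply: measurable_fun_coordP => i; rewrite /rV_cons.
under eq_fun do rewrite mxE.
case: (unlift ord0 i) => [j|]; last exact: measurable_fst.
apply: (measurableT_comp (measurable_coord j)) => //.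
Qed.

Lemma measurable_rV_uncons n : measurable_fun [set: _] (@rV_uncons n).
Proof.
apply/measurable_fun_pairP; split; first exact: measurable_coord.
apply: measurable_fun_coordP => j /=.
by under eq_fun do rewrite mxE; exact: measurable_coord.
Qed.

Section step.
Variables (n : nat) (mu : {sigma_finite_measure set 'rV[R]_n -> \bar R}).

Definition lebesgue_rV_step : set 'rV[R]_n.+1 -> \bar R :=
  pushforward (lebesgue_measure \x mu)%E (@rV_cons n).

Let step0 : lebesgue_rV_step set0 = 0%E.
Proof. by rewrite /lebesgue_rV_step /pushforward preimage_set0 measure0. Qed.

Let step_ge0 A : (0 <= lebesgue_rV_step A)%E.
Proof. by rewrite /lebesgue_rV_step /pushforward; exact: measure_ge0. Qed.

Let step_sigma_additive : semi_sigma_additive lebesgue_rV_step.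
Proof.
have mf (A : set 'rV[R]_n.+1) : measurable A ->
    measurable (@rV_cons n @^-1` A).
  by move=> mA; rewrite -[X in measurable X]setTI; exact: measurable_rV_cons.
move=> F mF tF mUF; rewrite /lebesgue_rV_step /pushforward preimage_bigcup.
apply: measure_semi_sigma_additive => [k||].
- exact: mf.
- apply/trivIsetP => /= i j _ _ ij; rewrite -preimage_setI.
  by move/trivIsetP : tF => /(_ _ _ _ _ ij) ->//; rewrite preimage_set0.
- by rewrite -preimage_bigcup; exact: mf.
Qed.

HB.instance Definition _ := isMeasure.Build _ _ _ lebesgue_rV_step
  step0 step_ge0 step_sigma_additive.

Let step_sigma_finite : sigma_finite setT lebesgue_rV_step.
Proof.
have /sigma_finiteP[F [FT ndF Foo]] :=
  sigma_finiteT (@lebesgue_measure R : {sigma_finite_measure set _ -> \bar R}).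
have /sigma_finiteP[G [GT ndG Goo]] := sigma_finiteT mu.
exists (fun k => @rV_uncons n @^-1` (F k `*` G k)).
  rewrite -preimage_bigcup; apply/esym; rewrite -subTset => v _ /=.
  have [i _ Fi] : (\bigcup_i F i) (rV_uncons v).1 by rewrite -FT.
  have [j _ Gj] : (\bigcup_i G i) (rV_uncons v).2 by rewrite -GT.
  exists (maxn i j) => //; split.
  - by move: Fi; apply/subsetPset/ndF/leq_maxl.
  - by move: Gj; apply/subsetPset/ndG/leq_maxr.
move=> k; have [mFk Fkoo] := Foo k; have [mGk Gkoo] := Goo k; split.
  rewrite -[X in measurable X]setTI.
  by apply: measurable_rV_uncons => //; exact: measurableX.
rewrite /lebesgue_rV_step /pushforward -comp_preimage.
rewrite (_ : _ \o _ = id); last by apply/funext => p /=; rewrite rV_consK.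
by rewrite preimage_id product_measure1E// lte_mul_pinfty// ge0_fin_numE.
Qed.

HB.instance Definition _ := @Measure_isSigmaFinite.Build _ _ _
  lebesgue_rV_step step_sigma_finite.

End step.

(* Lebesgue measure on R^n, the n-fold product of the one on R. *)
Fixpoint lebesgue_rV n : {sigma_finite_measure set 'rV[R]_n -> \bar R} :=
  if n is m.+1 then lebesgue_rV_step (lebesgue_rV m) else \d_(0 : 'rV[R]_0).

Lemma lebesgue_rV_box n (a b : 'I_n -> R) :
  (forall i, a i <= b i) ->
  lebesgue_rV n [set x | forall i, x ord0 i \in `[a i, b i]] =
  (\prod_(i < n) (b i - a i))%:E.
Proof.
elim: n a b => [|n IH] a b ab.
  by rewrite big_ord0 /= diracE mem_set//= => -[].
rewrite /= /lebesgue_rV_step /pushforward.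
rewrite [X in product_measure1 _ _ X](_ : _ = `[a ord0, b ord0]%classic `*`
    [set v : 'rV[R]_n | forall i : 'I_n,
      v ord0 i \in `[a (lift ord0 i), b (lift ord0 i)]]).
  rewrite product_measure1E//.
  - rewrite IH// big_ord_recl EFinM; congr (_ * _)%E.
    apply: etrans (lebesgue_measure_itv `[a ord0, b ord0]) _.
    rewrite /= lte_fin; case: ltP => [//|ba].
    by rewrite (_ : b ord0 = a ord0) ?subrr//; apply/eqP; rewrite eq_le ba ab.
  - rewrite (_ : [set v | _] = \bigcap_(i in [set: 'I_n])
      (fun x : 'rV[R]_n => x ord0 i) @^-1`
        `[a (lift ord0 i), b (lift ord0 i)]%classic).
      apply: fin_bigcap_measurable => // i _; rewrite -[X in measurable X]setTI.
      exact: measurable_coord.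
    by apply/seteqP; split => x /= h i => [_|]; [exact: h|exact: (h i I)].
apply/seteqP; split => -[x v] /= => [h|[hx hv] i].
  split => [|i]; first by have := h ord0; rewrite mxE unlift_none.
  by have := h (lift ord0 i); rewrite mxE liftK.
by rewrite mxE; case: unliftP => [j|] ->.
Qed.

End lebesgue_rV.

Section complex_L2.
Variable R : realType.

Definition cmeasurable d (T : measurableType d) (f : T -> R[i]) : Prop :=
  measurable_fun setT (fun t => complex.Re (f t)) /\
  measurable_fun setT (fun t => complex.Im (f t)).

Definition cintegral d (T : measurableType d)
    (mu : {measure set T -> \bar R}) (f : T -> R[i]) : R[i] :=
  (\int[mu]_t complex.Re (f t)) +i* (\int[mu]_t complex.Im (f t)).

Variable d : nat.
Local Notation E := 'rV[R]_d.
Local Notation leb := (lebesgue_rV R d).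
Implicit Types (f g : E -> R[i]) (T S : (E -> R[i]) -> E -> R[i]).

(* Elements of L^2(R^d) are represented by functions, and operators on it by
   maps between functions; their values matter only on L2 and only up to
   almost everywhere equality. *)
Definition L2 : set (E -> R[i]) :=
  [set f | cmeasurable f /\
    (\int[leb]_x (Normc.normc (f x) ^+ 2)%:E < +oo)%E].

Definition L2norm f : R := Num.sqrt (\int[leb]_x Normc.normc (f x) ^+ 2).

Definition L2inner f g : R[i] := cintegral leb (fun x => (f x)^* * g x).

Definition eqL2 f g : Prop := {ae leb, forall x, f x = g x}.

Definition bounded_op T : Prop :=
  [/\ forall f, L2 f -> L2 (T f),
      forall f g, L2 f -> L2 g -> eqL2 f g -> eqL2 (T f) (T g),
      forall (a : R[i]) f g, L2 f -> L2 g ->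
        eqL2 (T (fun x => a * f x + g x)) (fun x => a * T f x + T g x) &
      exists C : R, forall f, L2 f -> L2norm (T f) <= C * L2norm f].

Definition self_adjoint T : Prop :=
  forall f g, L2 f -> L2 g -> L2inner (T f) g = L2inner f (T g).

Definition resolvent_set T : set R[i] :=
  [set z | exists S, [/\ bounded_op S,
    forall f, L2 f -> eqL2 (S (fun x => T f x - z * f x)) f &
    forall f, L2 f -> eqL2 (fun x => T (S f) x - z * S f x) f]].

Definition spectrum T : set R[i] := ~` resolvent_set T.

End complex_L2.

Section kernels.
Variables (R : realType) (d : nat).
Local Notation E := 'rV[R]_d.
Local Notation leb := (lebesgue_rV R d).
Implicit Types (K : E -> E -> R[i]) (T : (E -> R[i]) -> E -> R[i]).

(* The norm `|x| provided by the library on 'rV[R]_d is the sup norm. *)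
Definition enorm (x : E) : R := Num.sqrt (\sum_(i < d) x ord0 i ^+ 2).

Definition japanese (x : E) : R := Num.sqrt (1 + enorm x ^+ 2).

Definition integral_op K (f : E -> R[i]) : E -> R[i] :=
  fun x => cintegral leb (fun x' => K x x' * f x').

Definition locally_integrable_kernel K : Prop :=
  cmeasurable (fun p : E * E => K p.1 p.2) /\
  forall A : set (E * E), compact A ->
    (\int[(leb \x leb)%E]_(p in A) (Normc.normc (K p.1 p.2))%:E < +oo)%E.

Definition continuous_off_diagonal K : Prop :=
  forall x x' : E, x != x' ->
    {for (x, x'), continuous (fun p : E * E => K p.1 p.2 : R[i]^o)}.

Definition kernel_norm (alpha : R) K : \bar R :=
  maxe
    (ereal_sup (range (fun x' : E =>
      \int[leb]_x (Normc.normc (K x x') * japanese (x - x') `^ alpha)%:E)%E))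
    (ereal_sup (range (fun x : E =>
      \int[leb]_x' (Normc.normc (K x x') * japanese (x - x') `^ alpha)%:E)%E)).

(* T belongs to C_{1,alpha} and K is its integral kernel. *)
Definition in_C1 (alpha : R) T K : Prop :=
  [/\ bounded_op T,
      forall f, L2 f -> eqL2 (T f) (integral_op K f),
      locally_integrable_kernel K,
      continuous_off_diagonal K &
      (kernel_norm alpha K < +oo)%E].

Definition truncated_kernel (M : R) K : E -> E -> R[i] :=
  fun x x' => (\1_(`[0, 1]%classic : set R) (enorm (x - x') / M))%:C * K x x'.

(* T belongs to C_unif and K is its integral kernel. *)
Definition in_Cunif T K : Prop :=
  in_C1 0 T K /\
  kernel_norm 0 (fun x x' => K x x' - truncated_kernel M K x x')
    @[M --> +oo] --> 0%E.

Definition magnetic_kernel (phi : E -> E -> R) (b : R) K : E -> E -> R[i] :=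
  fun x x' => (cos (b * phi x x') +i* sin (b * phi x x')) * K x x'.

End kernels.

(* Stated for subsets of C: the spectra below are sets of complex numbers
   contained in the real line, where the modulus is the absolute value. *)
Definition hausdorff_dist (R : realType) (A B : set R[i]) : \bar R :=
  maxe
    (ereal_sup [set ereal_inf [set (Normc.normc (x - y))%:E | y in B] | x in A])
    (ereal_sup [set ereal_inf [set (Normc.normc (x - y))%:E | x in A] | y in B]).

(* Main.v *)
(** The spectra of two self-adjoint operators are compared through lower bounds:
    a real [l] belongs to [spectrum T] iff [T - l] is not bounded below, and if
    [|(T - l) g| <= eta |g|] for some [g <> 0] then [spectrum T] meets
    [[l - eta, l + eta]]. So it suffices to turn an approximate eigenfunction [f] of
    [H_b] into one of [H_(b + delta)]. Put [theta = sqrt |delta|] and, for [g] in R^d,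
    [f_g x = e^(i delta phi(x, g)) max(0, 1 - theta |x - g|) f x]. Up to a phase,
    [(H_(b + delta) - l) f_g] is [max(0, 1 - theta |x - g|) (H_b - l) f] plus an
    integral whose kernel is controlled by the flux condition, namely by
    [C |K(x, y)| min(1, theta |x - y|)] with [x] or [y] in a cube of side
    [2 / theta] around [g]. Integrating the squared norms over [g] and using Schur's
    test shows that the spectra are at distance at most
    [C sup_x int |K(x, y)| min(1, theta |x - y|) dy] (and its transpose). *)
Require Import Defs.
From HB Require Import structures.
From mathcomp Require Import all_boot all_order all_algebra.
From mathcomp Require Import all_classical all_reals all_analysis.
From mathcomp Require Import measurable_realfun complex ring lra.
Set Implicit Arguments.
Unset Strict Implicit.
Unset Printing Implicit Defensive.
Import Order.TTheory GRing.Theory Num.Theory.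
Import numFieldNormedType.Exports.
Local Open Scope classical_set_scope.
Local Open Scope ring_scope.

(** * Symmetric operators on complete semi-inner product spaces *)

Section complex_numbers.
Variable R : realType.
Implicit Types z w : R[i].

Lemma conjcD z w : conjc (z + w) = conjc z + conjc w.
Proof. exact: rmorphD. Qed.

Lemma conjcM z w : conjc (z * w) = conjc z * conjc w.
Proof. exact: rmorphM. Qed.

Lemma conjcN z : conjc (- z) = - conjc z.
Proof. exact: rmorphN. Qed.

Lemma ReD z w : complex.Re (z + w) = complex.Re z + complex.Re w.
Proof. by case: z w => [? ?] [? ?]. Qed.

Lemma ReN z : complex.Re (- z) = - complex.Re z.
Proof. by case: z => [? ?]. Qed.

Lemma ReM (a : R) z : complex.Re (a%:C%C * z) = a * complex.Re z.
Proof. by case: z => x y /=; ring. Qed.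

End complex_numbers.

Section symmetric_operators.
Variables (R : realType) (V : lmodType R[i]) (dot : V -> V -> R[i]).
Hypothesis dotDr : forall u v w, dot u (v + w) = dot u v + dot u w.
Hypothesis dotZr : forall a u v, dot u (a *: v) = a * dot u v.
Hypothesis dotC : forall u v, dot v u = conjc (dot u v).
Hypothesis dot_ge0 : forall u, 0 <= complex.Re (dot u u).

Let dotDl u v w : dot (u + v) w = dot u w + dot v w.
Proof. by rewrite dotC dotDr conjcD -!dotC. Qed.

Let dotZl a u v : dot (a *: u) v = conjc a * dot u v.
Proof. by rewrite dotC dotZr conjcM -dotC. Qed.

Let dotNr u v : dot u (- v) = - dot u v.
Proof. by rewrite -scaleN1r dotZr mulN1r. Qed.

Let dotNl u v : dot (- u) v = - dot u v.
Proof. by rewrite dotC dotNr conjcN -dotC. Qed.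

Let dotE := (dotDl, dotDr, dotZl, dotZr, dotNl, dotNr).

Definition sqnorm u : R := complex.Re (dot u u).
Local Notation q := sqnorm.

Let Redot_sym u v : complex.Re (dot v u) = complex.Re (dot u v).
Proof. by rewrite dotC; case: (dot u v). Qed.

Lemma sqnormZ a u : q (a *: u) = (complex.Re a ^+ 2 + complex.Im a ^+ 2) * q u.
Proof.
rewrite /q !dotE; case: a => x y; case: (dot u u) => e f /=; ring.
Qed.

Lemma sqnormD u v : q (u + v) = q u + q v + complex.Re (dot u v) *+ 2.
Proof. rewrite /q !dotE !ReD (Redot_sym u v); ring. Qed.

Lemma sqnormN u : q (- u) = q u.
Proof. by rewrite /q !dotE opprK. Qed.

Lemma sqnormD_le u v : q (u + v) <= (q u + q v) *+ 2.
Proof.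
have := dot_ge0 (u - v); rewrite -/(q _) sqnormD sqnormN dotNr ReN.
by rewrite sqnormD; lra.
Qed.

Lemma discriminant_le (a b c : R) : 0 <= a -> 0 <= c ->
  (forall t, 0 <= a + (t * b) *+ 2 + t ^+ 2 * c) -> b ^+ 2 <= a * c.
Proof.
move=> a0 c0 h; have [c_eq0|cn0] := eqVneq c 0.
  subst c; have [->|bn0] := eqVneq b 0; first by rewrite expr0n mulr0.
  have := h (- (a + 1) / b); rewrite mulr0 addr0.
  have -> : (- (a + 1) / b * b) = - (a + 1) by field.
  by move=> ?; exfalso; lra.
have cp : 0 < c by rewrite lt_neqAle eq_sym cn0.
have := h (- b / c).
have -> : a + (- b / c * b) *+ 2 + (- b / c) ^+ 2 * c = (a * c - b ^+ 2) / c.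
  by field.
by rewrite pmulr_lge0 ?invr_gt0// subr_ge0.
Qed.

Definition dot_equal u v := forall w, dot u w = dot v w.
Local Notation "u === v" := (dot_equal u v) (at level 70).

Lemma dot_equal_sqnorm u v : u === v -> q u = q v.
Proof. by move=> h; rewrite /q h dotC h -dotC. Qed.

Variables (T : V -> V) (M : R).
Hypothesis T_sym : forall u v, dot (T u) v = dot u (T v).
Hypothesis T_bounded : forall u, q (T u) <= M * q u.

(* Locked, so that rewriting with the linearity of [dot] does not unfold it. *)
Let A : R[i] -> V -> V := locked (fun z u => T u - z *: u).

Let AE z u : A z u = T u - z *: u.
Proof. by rewrite /A -lock. Qed.

Let A_adj z u v : dot (A z u) v = dot u (A (conjc z) v).
Proof. by rewrite !AE !dotE T_sym. Qed.

Let A_lin z a u v : A z (a *: u + v) === a *: A z u + A z v.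
Proof. by move=> w; rewrite A_adj !dotE !A_adj. Qed.

Let A_bound z : exists2 N : R, 0 < N & forall u, q (A z u) <= N * q u.
Proof.
pose N := (`|M| + (complex.Re z ^+ 2 + complex.Im z ^+ 2)) *+ 2 + 1.
have [z1 z2] := (sqr_ge0 (complex.Re z), sqr_ge0 (complex.Im z)).
have M0 := normr_ge0 M.
exists N; first by rewrite /N; lra.
move=> u; rewrite AE; apply: le_trans (sqnormD_le _ _) _.
rewrite sqnormN sqnormZ.
have := T_bounded u; have := dot_ge0 u; rewrite -/(q u) => u0 Tu.
have : M * q u <= `|M| * q u by rewrite ler_wpM2r// ler_norm.
by rewrite /N; nra.
Qed.

Lemma sqnorm_sub_conj z u : q (T u - z *: u) = q (T u - conjc z *: u).
Proof.
have r : complex.Im (dot u (T u)) = 0.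
  have : dot u (T u) = conjc (dot u (T u)) by rewrite -[RHS]dotC T_sym.
  by case: (dot u (T u)) => x y [] /=; lra.
rewrite !sqnormD !sqnormN !sqnormZ !dotE T_sym.
by move: r; case: (dot u (T u)) => x y /= ->; case: z => e f /=; ring.
Qed.

Lemma sqnorm_sub_nonreal z u : complex.Im z ^+ 2 * q u <= q (T u - z *: u).
Proof.
have r : complex.Im (dot u (T u)) = 0.
  have : dot u (T u) = conjc (dot u (T u)) by rewrite -[RHS]dotC T_sym.
  by case: (dot u (T u)) => x y [] /=; lra.
have := dot_ge0 (T u - (complex.Re z)%:C%C *: u).
rewrite -!/(q _) !sqnormD !sqnormN !sqnormZ !dotE T_sym.
by move: r; case: (dot u (T u)) => x y /= ->; case: z => e f /=; lra.
Qed.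

Definition bounded_below z :=
  exists2 c : R, 0 < c & forall u, c * q u <= q (T u - z *: u).

Hypothesis dot_complete : forall (u : nat -> V) (C k : R), 0 < k -> k < 1 ->
  (forall n, q (u n.+1 - u n) <= C * k ^+ n) ->
  exists v, forall e : R, 0 < e -> exists n, q (u n - v) <= e /\ q (u n.+1 - v) <= e.

(* Solve A* A u = A* v by the contraction u |-> u - t (A* A u - A* v). *)
Lemma bounded_below_surjective z : bounded_below z ->
  forall v, exists u, q (T u - z *: u - v) = 0.
Proof.
move=> [c c0 Ac] v; have [N N0 AN] := A_bound z.
have AN' u : q (A (conjc z) u) <= N * q u.
  by rewrite AE -sqnorm_sub_conj -AE; exact: AN.
pose B u := A (conjc z) (A z u).
have BN u : q (B u) <= N ^+ 2 * q u.
  by apply: le_trans (AN' _) _; rewrite expr2 -mulrA ler_pM2l.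
have B_dot u w : dot (B u) w = dot (A z u) (A z w).
  by rewrite /B A_adj conjcK.
have B_sub u w : B (u - w) === B u - B w.
  move=> x; rewrite !dotE !B_dot addrC -scaleN1r A_lin !dotE.
  by rewrite conjcN conjc1; ring.
pose t := c / N ^+ 2.
pose k := 1 - c ^+ 2 / N ^+ 2.
have t0 : 0 < t by rewrite divr_gt0// exprn_gt0.
pose k' := Num.max k (1 / 2).
have k'1 : k' < 1.
  by rewrite /k' gt_max ltrBlDr ltrDl divr_gt0 ?exprn_gt0//=; lra.
have k'0 : 0 < k' by rewrite /k' lt_max; apply/orP; right; lra.
have contr u : q (u - t%:C%C *: B u) <= k' * q u.
  apply: (@le_trans _ _ (k * q u)); last first.
    by rewrite ler_wpM2r ?dot_ge0// /k' le_max lexx.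
  rewrite sqnormD sqnormN sqnormZ /= expr0n /= addr0 dotNr dotZr.
  have -> : complex.Re (- (t%:C%C * dot u (B u))) = - (t * q (A z u)).
    by rewrite ReN ReM Redot_sym B_dot.
  have h1 : t ^+ 2 * q (B u) <= t * c * q u.
    have -> : t * c * q u = t ^+ 2 * (N ^+ 2 * q u).
      by rewrite /t; field; exact: lt0r_neq0.
    by rewrite ler_pM2l ?exprn_gt0.
  have h2 : t * (c * q u) <= t * q (A z u) by rewrite ler_pM2l// AE; exact: Ac.
  have -> : k = 1 - t * c by rewrite /k /t; ring.
  by lra.
pose w := A (conjc z) v.
pose F u := u - t%:C%C *: (B u - w).
have F_sub u u' : F u - F u' === (u - u') - t%:C%C *: B (u - u').
  by move=> x; rewrite /F !dotE B_sub !dotE; ring.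
have F_contr u u' : q (F u - F u') <= k' * q (u - u').
  by rewrite (dot_equal_sqnorm (F_sub u u')); exact: contr.
pose s n := iter n F 0.
have [|u ulim] := @dot_complete s (q (s 1%N - s 0%N)) k' k'0 k'1.
  elim => [|n IH]; first by rewrite expr0 mulr1.
  rewrite /s !iterS -/(s _); apply: le_trans (F_contr _ _) _.
  by rewrite exprS mulrCA ler_pM2l.
have Fu : q (F u - u) = 0.
  apply/eqP; rewrite eq_le dot_ge0 andbT; apply/ler_addgt0Pl => e e0.
  have [n [un un1]] := ulim (e / 4) ltac:(lra).
  rewrite addr0 -(subrKA (s n.+1)); apply: le_trans (sqnormD_le _ _) _.
  have : q (F u - s n.+1) <= e / 4.
    rewrite -sqnormN opprB; apply: le_trans (F_contr _ _) _.
    by apply: le_trans un; rewrite ler_piMl ?dot_ge0// ltW.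
  by lra.
have Bw : q (B u - w) = 0.
  move: Fu; rewrite /F addrAC subrr add0r sqnormN sqnormZ /= expr0n addr0.
  by move=> /eqP; rewrite mulf_eq0 sqrf_eq0 gt_eqF//= => /eqP.
exists u; apply/eqP; rewrite eq_le dot_ge0 andbT.
rewrite -(pmulr_rle0 _ c0); apply: le_trans (Ac _) _.
rewrite sqnorm_sub_conj -!AE le_eqVlt -[X in _ == X]Bw.
rewrite (@dot_equal_sqnorm _ (B u - w)) ?eqxx// => x.
rewrite addrC -scaleN1r A_lin !dotE conjcN conjc1 /B /w; ring.
Qed.

(* With A = T - l and m = inf |Au|^2/|u|^2, the form |Au|^2 - m |u|^2 is positive
   semidefinite, and Cauchy-Schwarz for it makes (A^2 - m) u small along a minimizing
   sequence; hence A - sqrt m or A + sqrt m is not bounded below. *)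
Lemma not_bounded_below_near (l eta : R) u0 : 0 <= eta -> 0 < q u0 ->
  q (T u0 - l%:C%C *: u0) <= eta ^+ 2 * q u0 ->
  exists2 mu : R, `|mu - l| <= eta & ~ bounded_below mu%:C%C.
Proof.
move=> eta0 q0; rewrite -AE => hu0.
pose A1 := A l%:C%C.
have A1_adj u v : dot (A1 u) v = dot u (A1 v) by rewrite A_adj conjc_real.
pose S := [set m : R | forall u, m * q u <= q (A1 u)].
have S0 : S 0 by move=> u; rewrite mul0r dot_ge0.
have S_ub m : S m -> m <= eta ^+ 2.
  by move=> /(_ u0) /le_trans /(_ hu0); rewrite ler_pM2r.
have hS : has_sup S by split; [exists 0|exists (eta ^+ 2) => m /S_ub].
pose m := sup S.
have m0 : 0 <= m by apply: ub_le_sup => //; case: hS.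
have m_le : m <= eta ^+ 2 by apply: ge_sup; [exists 0|move=> x /S_ub].
have Sm : S m.
  move=> u; have [/eqP|un0] := boolP (q u == 0).
    by move=> ->; rewrite mulr0 dot_ge0.
  have up : 0 < q u by rewrite lt_neqAle eq_sym un0 dot_ge0.
  rewrite -ler_pdivlMr//; apply: ge_sup; first by exists 0.
  by move=> x Sx; rewrite ler_pdivlMr//; exact: Sx.
have approx e : 0 < e -> exists2 u, 0 < q u & q (A1 u) < (m + e) * q u.
  move=> e0; apply: contrapT => h.
  suff : S (m + e) by move=> /(ub_le_sup (proj2 hS)); rewrite -/m; lra.
  move=> u; rewrite leNgt; apply/negP => hu; apply: h; exists u => //.
  rewrite lt_neqAle dot_ge0 andbT; apply/eqP => /esym u_0.
  by move: hu; rewrite u_0 mulr0 ltNge dot_ge0.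
pose r := Num.sqrt m.
have rr : r ^+ 2 = m by rewrite sqr_sqrtr.
have r_le : r <= eta by rewrite -(ler_sqr)// ?nnegrE ?sqrtr_ge0// rr.
suff h : ~ (bounded_below (l + r)%:C%C /\ bounded_below (l - r)%:C%C).
  have [hb|hb] := pselect (bounded_below (l + r)%:C%C).
    exists (l - r); last by move=> hb'; exact: h.
    by rewrite addrAC subrr add0r normrN ger0_norm ?sqrtr_ge0.
  by exists (l + r) => //; rewrite addrAC subrr add0r ger0_norm ?sqrtr_ge0.
move=> [[c1 c10 b1] [c2 c20 b2]].
have [N N0 AN] := A_bound l%:C%C.
pose B u := A1 (A1 u) - m%:C%C *: u.
have Bq u : c1 * c2 * q u <= q (B u).
  pose x := T u - (l - r)%:C%C *: u.
  have -> : q (B u) = q (T x - (l + r)%:C%C *: x).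
    apply: dot_equal_sqnorm => w; rewrite -AE A_adj /x -AE A_adj.
    rewrite /B !dotE A1_adj A1_adj !conjc_real /A1 !AE !dotE -!T_sym.
    rewrite -rr !dotE.
    have -> : (r ^+ 2)%:C%C = r%:C%C ^+ 2 :> R[i] by rewrite rmorphXn.
    have -> : (l + r)%:C%C = l%:C%C + r%:C%C :> R[i] by rewrite rmorphD.
    have -> : (l - r)%:C%C = l%:C%C - r%:C%C :> R[i] by rewrite rmorphB.
    by ring.
  rewrite -mulrA; apply: le_trans (b1 _).
  by rewrite ler_pM2l//; exact: b2.
pose e := c1 * c2 / (N *+ 2).
have e0 : 0 < e by rewrite divr_gt0 ?mulr_gt0// mulrn_wgt0.
have [u up hu] := approx e e0.
pose b x y := complex.Re (dot (A1 x) (A1 y)) - m * complex.Re (dot x y).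
have CS x y : b x y ^+ 2 <= b x x * b y y.
  have b_ge0 z : 0 <= b z z by rewrite subr_ge0; exact: Sm.
  have bC x' y' : b x' y' = b y' x'.
    by rewrite /b Redot_sym [complex.Re (dot x' y')]Redot_sym.
  have bl t x' y' z : b (t%:C%C *: y' + x') z = t * b y' z + b x' z.
    rewrite /b (A_lin _ _ _ _ _) !dotE conjc_real !ReD !ReM; ring.
  apply: discriminant_le => // t.
  rewrite (_ : _ + _ = b (t%:C%C *: y + x) (t%:C%C *: y + x)) ?b_ge0//.
  by rewrite bl (bC y (_ + _)) (bC x (_ + _)) !bl (bC y x); ring.
have bB : b u (B u) = q (B u).
  by rewrite /b /q [B u in RHS]/B dotDl dotNl dotZl conjc_real A1_adj ReD ReN ReM -!A1_adj.
have := CS u (B u); rewrite bB => h1.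
have h2 : b u u <= e * q u by rewrite /b -/(q (A1 u)) -/(q u); lra.
have h3 : b (B u) (B u) <= N * q (B u).
  rewrite /b -/(q (A1 _)) -/(q (B u)); have := AN (B u).
  by have := mulr_ge0 m0 (dot_ge0 (B u)); rewrite -/(q (B u)) -/(A1 _); lra.
have Bp : 0 < q (B u) by apply: lt_le_trans (Bq u); rewrite !mulr_gt0.
have h4 : q (B u) ^+ 2 <= (e * q u) * (N * q (B u)).
  apply: le_trans h1 _; apply: ler_pM => //; last by rewrite subr_ge0; exact: Sm.
  by rewrite subr_ge0; exact: Sm.
have : q (B u) <= e * N * q u.
  by move: h4; rewrite expr2 [leRHS](_ : _ = e * N * q u * q (B u)); [rewrite ler_pM2r|ring].
have -> : e * N = c1 * c2 / 2 by rewrite /e; field; exact: lt0r_neq0.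
have := Bq u; have : 0 < c1 * c2 * q u by rewrite !mulr_gt0.
by lra.
Qed.

End symmetric_operators.

(** * Measurability and nonnegative integrals *)

Section continuous_measurable.
Variables (R : realType) (d : nat).
Local Notation E := 'rV[R]_d.

Lemma measurable_fun_count_factor disp (X : measurableType disp) (C : countType)
    (g : X -> C) (h : C -> R) :
  (forall c, measurable (g @^-1` [set c])) ->
  measurable_fun setT (h \o g).
Proof.
move=> mg _ B mB; rewrite setTI.
rewrite (_ : _ @^-1` _ = \bigcup_n
    (if @choice.unpickle C n is Some c then
       if h c \in B then g @^-1` [set c] else set0 else set0)).
  apply: bigcup_measurable => n _.
  by case: choice.unpickle => // c; case: ifPn.
apply/seteqP; split=> x /=.
  move=> Bx; exists (choice.pickle (g x)) => //.
  by rewrite choice.pickleK mem_set.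
move=> [n _]; case: choice.unpickle => // c; case: ifPn => //.
by rewrite inE => ? /= ->.
Qed.

Definition grid n (x : E) : 'rV[int]_d := \row_i Num.floor (x ord0 i * n.+1%:R).

Definition of_grid n (c : 'rV[int]_d) : E := \row_i ((c ord0 i)%:~R / n.+1%:R).

Lemma measurable_grid n c : measurable (@grid n @^-1` [set c]).
Proof.
rewrite (_ : _ @^-1` _ = \bigcap_(i in [set: 'I_d])
    ((fun x : E => x ord0 i * n.+1%:R) @^-1`
      `[(c ord0 i)%:~R, (c ord0 i + 1)%:~R[%classic)).
  apply: fin_bigcap_measurable => // i _; rewrite -[X in measurable X]setTI.
  have m : measurable_fun setT (fun x : E => x ord0 i * n.+1%:R).
    apply: measurable_funM => //; exact: measurable_coord.
  by apply: m.
apply/seteqP; split=> x /=.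
  by move=> <- i _ /=; rewrite in_itv/= mxE floor_itv.
move=> h; apply/rowP => i; rewrite mxE; apply: floor_def.
by have := h i I; rewrite /= in_itv.
Qed.

Lemma grid_dist n (x : E) : `|x - of_grid n (grid n x)| <= n.+1%:R^-1.
Proof.
rewrite /Num.norm/= mx_normrE; apply: bigmax_le => // -[i j] _ /=.
rewrite !mxE (ord1 i) -{1}(@mulfK _ n.+1%:R _ (x 0 j)) ?pnatr_eq0//.
rewrite -mulrBl normrM [X in _ * X]ger0_norm// ler_piMl//.
have /andP[h1 h2] := floor_itv (x 0 j * n.+1%:R).
rewrite ger0_norm ?subr_ge0// lerBlDl; apply: ltW.
by rewrite intrD in h2.
Qed.

Lemma cvg_grid (x : E) : of_grid n (grid n x) @[n --> \oo] --> x.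
Proof.
apply/cvgrPdist_le => e e0; near=> n.
apply: le_trans (grid_dist _ _) _.
rewrite -[leRHS]invrK lef_pV2 ?posrE ?invr_gt0//.
rewrite -natr1; apply: ler_wpDr => //.
by near: n; exact: nbhs_infty_ger.
Unshelve. all: by end_near. Qed.

Lemma continuous_measurable_fun2 (f : E * E -> R) :
  continuous f -> measurable_fun setT f.
Proof.
move=> cf.
pose g n (p : E * E) := (grid n p.1, grid n p.2).
pose h n (c : 'rV[int]_d * 'rV[int]_d) := f (of_grid n c.1, of_grid n c.2).
apply: (@measurable_fun_cvg _ _ _ _ (fun n => h n \o g n)).
  move=> n; apply: measurable_fun_count_factor => -[c1 c2].
  rewrite (_ : _ @^-1` _ = (grid n @^-1` [set c1]) `*` (grid n @^-1` [set c2])).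
    by apply: measurableX; exact: measurable_grid.
  by apply/seteqP; split=> -[x y] /= [<- <-].
move=> [x y] _; rewrite /h /g /=.
apply: (@continuous2_cvg _ _ _ _ _ _ _ _ (fun a b => f (a, b))).
- under eq_fun do rewrite -surjective_pairing; exact: (cf (x, y)).
- exact: cvg_grid.
- exact: cvg_grid.
Qed.

End continuous_measurable.

Section nonnegative_integrals.
Local Open Scope ereal_scope.
Context disp (T : measurableType disp) (R : realType).
Variable mu : {measure set T -> \bar R}.
Implicit Types f g : T -> \bar R.

(* Unlike [ge0_le_integral], no measurability is required. *)
Lemma ge0_le_integralT f g : (forall x, 0 <= f x) -> (forall x, f x <= g x) ->
  \int[mu]_x f x <= \int[mu]_x g x.
Proof.
move=> f0 fg; rewrite !ge0_integralTE//; last first.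
  by move=> x; exact: le_trans (fg x).
apply: le_ereal_sup => _ [h hf <-]; exists h => // x.
exact: le_trans (fg x).
Qed.

Lemma weighted_sqr_integral_le (w u : T -> R) (A : R) : (0 < A)%R ->
  measurable_fun setT w -> measurable_fun setT u ->
  (forall x, 0 <= w x)%R -> (forall x, 0 <= u x)%R ->
  \int[mu]_x (w x)%:E <= A%:E ->
  (\int[mu]_x (w x * u x)%:E) ^+ 2 <= A%:E * \int[mu]_x (w x * u x ^+ 2)%:E.
Proof.
move=> A0 mw muu w0 u0 wA.
set X := \int[mu]_x _; set Y := \int[mu]_x _.
have X0 : 0 <= X by apply: integral_ge0 => x _; rewrite lee_fin mulr_ge0.
have Y0 : 0 <= Y.
  by apply: integral_ge0 => x _; rewrite lee_fin mulr_ge0// exprn_ge0.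
have key (s : R) : (0 < s)%R -> X + X <= (s * A)%:E + s^-1%:E * Y.
  move=> s0; rewrite -ge0_integralD//; last 4 first.
  - by move=> x _; rewrite lee_fin mulr_ge0.
  - by apply/measurable_EFinP; exact: measurable_funM.
  - by move=> x _; rewrite lee_fin mulr_ge0.
  - by apply/measurable_EFinP; exact: measurable_funM.
  apply: (@le_trans _ _ (\int[mu]_x ((s * w x)%:E + (s^-1 * (w x * u x ^+ 2))%:E))).
    apply: ge0_le_integralT => x; first by rewrite -EFinD lee_fin addr_ge0// mulr_ge0.
    rewrite -!EFinD lee_fin -subr_ge0.
    have -> : (s * w x + s^-1 * (w x * u x ^+ 2) - (w x * u x + w x * u x) =
      w x * s^-1 * (s - u x) ^+ 2)%R by field; exact: lt0r_neq0.
    by rewrite mulr_ge0 ?sqr_ge0// mulr_ge0// invr_ge0 ltW.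
  rewrite ge0_integralD//; last 4 first.
  - by move=> x _; rewrite lee_fin mulr_ge0// ltW.
  - by apply/measurable_EFinP; exact: measurable_funM.
  - by move=> x _; rewrite lee_fin mulr_ge0// ?mulr_ge0 ?exprn_ge0// invr_ge0 ltW.
  - apply/measurable_EFinP; apply: measurable_funM => //.
    by apply: measurable_funM => //; exact: measurable_funX.
  apply: leeD.
    under eq_integral do rewrite EFinM.
    rewrite ge0_integralZl_EFin//; last 3 first.
    - by move=> x _; rewrite lee_fin.
    - exact/measurable_EFinP.
    - exact: ltW.
    by rewrite EFinM lee_wpmul2l// lee_fin ltW.
  under eq_integral do rewrite EFinM.
  rewrite ge0_integralZl_EFin//.
  - by move=> x _; rewrite lee_fin mulr_ge0// exprn_ge0.
  - apply/measurable_EFinP; apply: measurable_funM => //.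
    exact: measurable_funX.
  - by rewrite invr_ge0 ltW.
have [Yoo|Yoo] := eqVneq Y +oo.
  by rewrite Yoo gt0_muley ?lte_fin// leey.
have Yfin : Y \is a fin_num by rewrite ge0_fin_numE// ltey.
have Xfin : X \is a fin_num.
  rewrite ge0_fin_numE//; apply: (@le_lt_trans _ _ (X + X)); first by rewrite leeDl.
  apply: le_lt_trans (key 1%R ltr01) _.
  by rewrite invr1 mul1e -(fineK Yfin) -EFinD ltry.
move: X0 Y0 key; rewrite -(fineK Yfin) -(fineK Xfin).
move: (fine X) (fine Y) => x y; rewrite !lee_fin => x0 y0 key.
have [->|xn0] := eqVneq x 0%R; first by rewrite mul0r mulr_ge0// ltW.
have xp : (0 < x)%R by rewrite lt_neqAle eq_sym xn0.
have := key (x / A)%R (divr_gt0 xp A0).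
rewrite -EFinM -!EFinD lee_fin divfK ?lt0r_neq0// invf_div lerD2l.
by rewrite mulrAC ler_pdivlMr.
Qed.

End nonnegative_integrals.

Section schur_test.
Local Open Scope ereal_scope.
Context d1 d2 (T : measurableType d1) (G : measurableType d2) (R : realType).
Variables (mu : {sigma_finite_measure set T -> \bar R}).
Variables (nu : {sigma_finite_measure set G -> \bar R}).
Variables (k : T * T -> R) (A : R).
Hypothesis mk : measurable_fun setT k.
Hypothesis k0 : forall p, (0 <= k p)%R.
Hypothesis A0 : (0 < A)%R.
Hypothesis kA1 : forall x, \int[mu]_y (k (x, y))%:E <= A%:E.
Hypothesis kA2 : forall y, \int[mu]_x (k (x, y))%:E <= A%:E.

Lemma schur_test_param (w : (T * T) * G -> R) (B : R) (u : T -> R) :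
  measurable_fun setT w -> (forall p, 0 <= w p)%R -> (0 <= B)%R ->
  (forall p, \int[nu]_g (w (p, g) ^+ 2)%:E <= B%:E) ->
  measurable_fun setT u -> (forall x, 0 <= u x)%R ->
  \int[nu]_g \int[mu]_x (\int[mu]_y (k (x, y) * (w (x, y, g) * u y))%:E) ^+ 2 <=
  (A ^+ 2 * B)%:E * \int[mu]_y (u y ^+ 2)%:E.
Proof.
move=> mw w0 B0 wB muu u0.
pose F (q : (T * T) * G) := (k q.1 * (w q * u q.1.2) ^+ 2)%R.
have F0 q : (0 <= F q)%R by rewrite mulr_ge0// sqr_ge0.
have mF : measurable_fun setT F.
  apply: measurable_funM; first exact: measurableT_comp.
  apply: measurable_funX; apply: measurable_funM => //.
  by apply: (measurableT_comp muu); exact: measurableT_comp.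
have mku : measurable_fun setT (fun p : T * T => k p * u p.2 ^+ 2)%R.
  apply: measurable_funM => //; apply: measurable_funX.
  exact: (measurableT_comp muu).
have mFg g : measurable_fun setT (fun p => F (p, g)).
  by apply: (measurableT_comp mF); exact: pair2_measurable.
apply: (@le_trans _ _ (\int[nu]_g \int[mu]_x (A%:E * \int[mu]_y (F (x, y, g))%:E))).
  apply: ge0_le_integralT => g.
    by apply: integral_ge0 => x _; exact: sqre_ge0.
  apply: ge0_le_integralT => x.
    exact: sqre_ge0.
  apply: weighted_sqr_integral_le => //.
  - by apply: (measurableT_comp mk); exact: pair1_measurable.
  - apply: measurable_funM => //.
    apply: (measurableT_comp mw); exact: measurable_fun_pair.
  - by move=> y; rewrite mulr_ge0.
have mh : measurable_fun setT (fun p : G * T => \int[mu]_y (F (p.2, y, p.1))%:E).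
  apply: (@measurable_fun_fubini_tonelli_F _ _ _ _ _ mu
    (fun q : (G * T) * T => (F (q.1.2, q.2, q.1.1))%:E)) => [|q]; last first.
    by rewrite lee_fin.
  apply/measurable_EFinP; apply: (measurableT_comp mF).
  apply: measurable_fun_pair; last exact: measurableT_comp.
  apply: measurable_fun_pair; last exact: measurable_snd.
  exact: measurableT_comp.
have h0 (p : G * T) : 0 <= \int[mu]_y (F (p.2, y, p.1))%:E.
  by apply: integral_ge0 => y _; rewrite lee_fin.
under eq_integral => g _.
  rewrite ge0_integralZl//; last 3 first.
  - exact: (measurableT_comp mh (pair1_measurable g)).
  - by move=> x _; exact: (h0 (g, x)).
  - by rewrite lee_fin ltW.
  over.
rewrite ge0_integralZl//; last 3 first.
- exact: (@measurable_fun_fubini_tonelli_F _ _ _ _ _ mu _ mh h0).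
- by move=> g _; apply: integral_ge0 => x _; exact: (h0 (g, x)).
- by rewrite lee_fin ltW.
rewrite (@fubini_tonelli _ _ _ _ _ nu mu _ mh h0)/=.
under eq_integral => x _.
  rewrite (@fubini_tonelli _ _ _ _ _ nu mu (fun q => (F (x, q.2, q.1))%:E))/=; last 2 first.
  - apply/measurable_EFinP; apply: (measurableT_comp mF).
    apply: measurable_fun_pair => //.
    by apply: measurable_fun_pair => //.
  - by move=> q; rewrite lee_fin.
  over.
rewrite expr2 -mulrA EFinM -muleA lee_wpmul2l//; first by rewrite lee_fin ltW.
apply: (@le_trans _ _ (\int[mu]_x \int[mu]_y (B%:E * (k (x, y) * u y ^+ 2)%:E))).
  apply: ge0_le_integralT => x.
    by apply: integral_ge0 => y _; apply: integral_ge0 => g _; rewrite lee_fin.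
  apply: ge0_le_integralT => y.
    by apply: integral_ge0 => g _; rewrite lee_fin.
  under eq_integral => g _.
    rewrite /F/= exprMn [(_ * u _ ^+ 2)%R]mulrC mulrA EFinM.
    over.
  rewrite ge0_integralZl_EFin//; last 3 first.
  - by move=> g _; rewrite lee_fin sqr_ge0.
  - apply/measurable_EFinP; apply: measurable_funX.
    by apply: (measurableT_comp mw); exact: pair1_measurable.
  - by rewrite mulr_ge0// sqr_ge0.
  by rewrite muleC lee_wpmul2r// lee_fin mulr_ge0// sqr_ge0.
under eq_integral => x _.
  rewrite ge0_integralZl_EFin//; last 2 first.
  - by move=> p _; rewrite lee_fin mulr_ge0// sqr_ge0.
  - apply/measurable_EFinP.
    by apply: (measurableT_comp mku); exact: pair1_measurable.
  over.
rewrite ge0_integralZl_EFin//; last 2 first.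
- by move=> x _; apply: integral_ge0 => y _; rewrite lee_fin mulr_ge0// sqr_ge0.
- apply: (@measurable_fun_fubini_tonelli_F _ _ _ _ _ mu
    (fun p => (k p * u p.2 ^+ 2)%:E)) => [|p]; last first.
    by rewrite lee_fin mulr_ge0// sqr_ge0.
  exact/measurable_EFinP.
rewrite [(A * B)%R]mulrC EFinM -muleA lee_wpmul2l ?lee_fin//.
rewrite (@fubini_tonelli _ _ _ _ _ mu mu (fun p => (k p * u p.2 ^+ 2)%:E))//=; last 2 first.
- exact/measurable_EFinP.
- by move=> p; rewrite lee_fin mulr_ge0// sqr_ge0.
rewrite -ge0_integralZl_EFin//; last 3 first.
- by move=> p _; rewrite lee_fin sqr_ge0.
- by apply/measurable_EFinP; exact: measurable_funX.
- exact: ltW.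
apply: ge0_le_integralT => y.
  by apply: integral_ge0 => x _; rewrite lee_fin mulr_ge0// sqr_ge0.
under eq_integral do rewrite mulrC EFinM.
rewrite ge0_integralZl_EFin ?sqr_ge0//; last 2 first.
- by move=> p _; rewrite lee_fin.
- by apply/measurable_EFinP; apply: (measurableT_comp mk); exact: pair2_measurable.
by rewrite muleC lee_wpmul2r// lee_fin sqr_ge0.
Qed.

End schur_test.

Lemma schur_test disp (T : measurableType disp) (R : realType)
    (mu : {sigma_finite_measure set T -> \bar R}) (k : T * T -> R) (A : R)
    (u : T -> R) :
  measurable_fun setT k -> (forall p, 0 <= k p) -> 0 < A ->
  (forall x, \int[mu]_y (k (x, y))%:E <= A%:E)%E ->
  (forall y, \int[mu]_x (k (x, y))%:E <= A%:E)%E ->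
  measurable_fun setT u -> (forall x, 0 <= u x) ->
  (\int[mu]_x (\int[mu]_y (k (x, y) * u y)%:E) ^+ 2 <=
  (A ^+ 2)%:E * \int[mu]_y (u y ^+ 2)%:E)%E.
Proof.
move=> mk k0 A0 kA1 kA2 muu u0.
have h (p : T * T) :
    (\int[\d_tt]_g ((cst 1 : (T * T) * unit -> R) (p, g) ^+ 2)%:E <= 1%:E)%E.
  by rewrite integral_dirac// diracT mul1e expr1n.
have := @schur_test_param _ _ _ _ R mu (\d_tt) k A mk k0 A0 kA1 kA2
  (cst 1) 1 u (measurable_cst _) (fun=> ler01) ler01 h muu u0.
rewrite mulr1 integral_dirac// diracT mul1e.
congr (_ <= _)%E; apply: eq_integral => x _; congr (_ ^+ 2)%E.
by apply: eq_integral => y _; rewrite mul1r.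
Qed.

(** * Complex integrals and the space L2 *)

Section complex_modulus.
Variable R : realType.
Implicit Types z w : R[i].
Local Notation normc := Normc.normc.

Lemma sqr_normc z : normc z ^+ 2 = complex.Re z ^+ 2 + complex.Im z ^+ 2.
Proof. by case: z => a b; rewrite /Normc.normc sqr_sqrtr// addr_ge0 ?sqr_ge0. Qed.

Lemma normc_ge0 z : 0 <= normc z.
Proof. by case: z => a b; exact: sqrtr_ge0. Qed.

Lemma normr_Re_le z : `|complex.Re z| <= normc z.
Proof.
by case: z => a b; rewrite /Normc.normc/= -sqrtr_sqr ler_wsqrtr// lerDl sqr_ge0.
Qed.

Lemma normr_Im_le z : `|complex.Im z| <= normc z.
Proof.
by case: z => a b; rewrite /Normc.normc/= -sqrtr_sqr ler_wsqrtr// lerDr sqr_ge0.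
Qed.

Lemma normc_conjc z : normc (conjc z) = normc z.
Proof. by case: z => a b; rewrite /Normc.normc/= sqrrN. Qed.

Lemma normc_real (a : R) : normc a%:C%C = `|a|.
Proof. by rewrite /Normc.normc/= expr0n addr0 sqrtr_sqr. Qed.

Lemma mul_conjc z : conjc z * z = (normc z ^+ 2)%:C%C.
Proof.
by rewrite sqr_normc; case: z => a b; apply/eqP; rewrite eq_complex/=; apply/andP;
  split; apply/eqP; ring.
Qed.

Lemma normcB z w : normc (z - w) <= normc z + normc w.
Proof. by apply: le_trans (le_normcD _ _) _; rewrite normcN. Qed.

Lemma sqr_normcD_le z w : normc (z + w) ^+ 2 <= (normc z ^+ 2 + normc w ^+ 2) *+ 2.
Proof.
have h := le_normcD z w.
have : normc (z + w) ^+ 2 <= (normc z + normc w) ^+ 2.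
  by rewrite ler_pXn2r ?nnegrE ?addr_ge0 ?normc_ge0.
by have := sqr_ge0 (normc z - normc w); rewrite !expr2; lra.
Qed.

Lemma normc_le_ReIm z : normc z <= `|complex.Re z| + `|complex.Im z|.
Proof.
rewrite -ler_sqr ?nnegrE ?normc_ge0 ?addr_ge0// sqr_normc sqrrD !real_normK ?num_real//.
by rewrite lerD2r lerDl mulrn_wge0// mulr_ge0.
Qed.

End complex_modulus.

Section complex_measurable.
Context disp (T : measurableType disp) (R : realType).
Implicit Types f g : T -> R[i].
Local Notation normc := Normc.normc.

Lemma cmeasurable_cst (a : R[i]) : cmeasurable (fun _ : T => a).
Proof. by split. Qed.

Lemma cmeasurableD f g : cmeasurable f -> cmeasurable g ->
  cmeasurable (fun x => f x + g x).
Proof.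
move=> [f1 f2] [g1 g2]; split.
  by under eq_fun do rewrite ReD; exact: measurable_funD.
rewrite (_ : (fun _ => _) = (fun x => complex.Im (f x) + complex.Im (g x))).
  exact: measurable_funD.
by apply/funext => x; case: (f x) (g x) => [? ?] [? ?].
Qed.

Lemma cmeasurableM f g : cmeasurable f -> cmeasurable g ->
  cmeasurable (fun x => f x * g x).
Proof.
move=> [f1 f2] [g1 g2]; split.
  rewrite (_ : (fun _ => _) = (fun x => complex.Re (f x) * complex.Re (g x) -
      complex.Im (f x) * complex.Im (g x))).
    by apply: measurable_funB; exact: measurable_funM.
  by apply/funext => x; case: (f x) (g x) => [? ?] [? ?].
rewrite (_ : (fun _ => _) = (fun x => complex.Re (f x) * complex.Im (g x) +
    complex.Im (f x) * complex.Re (g x))).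
  by apply: measurable_funD; exact: measurable_funM.
by apply/funext => x; case: (f x) (g x) => [? ?] [? ?].
Qed.

Lemma cmeasurableB f g : cmeasurable f -> cmeasurable g ->
  cmeasurable (fun x => f x - g x).
Proof.
move=> mf mg; have -> : (fun x => f x - g x) = (fun x => f x + (-1) * g x).
  by apply/funext => x; rewrite mulN1r.
by apply: cmeasurableD => //; apply: cmeasurableM => //; exact: cmeasurable_cst.
Qed.

Lemma cmeasurable_conj f : cmeasurable f -> cmeasurable (fun x => conjc (f x)).
Proof.
move=> [f1 f2]; split.
  rewrite (_ : (fun _ => _) = (fun x => complex.Re (f x)))//.
  by apply/funext => x; case: (f x).
rewrite (_ : (fun _ => _) = (fun x => - complex.Im (f x))).
  exact: measurable_funN.
by apply/funext => x; case: (f x).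
Qed.

Lemma cmeasurable_real (f : T -> R) : measurable_fun setT f ->
  cmeasurable (fun x => (f x)%:C%C).
Proof. by move=> mf; split. Qed.

Lemma measurable_normc f : cmeasurable f -> measurable_fun setT (fun x => normc (f x)).
Proof.
move=> [f1 f2].
rewrite (_ : (fun _ => _) =
    (fun x => Num.sqrt (complex.Re (f x) ^+ 2 + complex.Im (f x) ^+ 2))).
  apply: (@measurableT_comp _ _ _ _ _ _ (@Num.sqrt R)).
    apply: continuous_measurable_fun; exact: sqrt_continuous.
  by apply: measurable_funD; exact: measurable_funX.
by apply/funext => x; case: (f x).
Qed.

Lemma cmeasurable_comp disp' (T' : measurableType disp') (h : T' -> T) f :
  measurable_fun setT h -> cmeasurable f -> cmeasurable (fun x => f (h x)).
Proof.
move=> mh [f1 f2].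
by split; [exact: (measurableT_comp f1 mh)|exact: (measurableT_comp f2 mh)].
Qed.

End complex_measurable.

Section complex_integral.
Context disp (T : measurableType disp) (R : realType).
Variable mu : {measure set T -> \bar R}.
Implicit Types f g : T -> R[i].
Local Notation normc := Normc.normc.

Definition cintegrable f :=
  cmeasurable f /\ (\int[mu]_x (normc (f x))%:E < +oo)%E.

Lemma cintegrable_le f (h : T -> R) : cmeasurable f ->
  (forall x, normc (f x) <= h x) -> (\int[mu]_x (h x)%:E < +oo)%E ->
  cintegrable f.
Proof.
move=> mf fh hoo; split => //; apply: le_lt_trans hoo.
by apply: ge0_le_integralT => x; rewrite lee_fin ?normc_ge0.
Qed.

Lemma cintegrable_Re f : cintegrable f -> mu.-integrable setT (EFin \o (fun x => complex.Re (f x))).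
Proof.
move=> [[m1 m2] foo]; apply/integrableP; split; first exact/measurable_EFinP.
apply: le_lt_trans foo; apply: ge0_le_integralT => x //=.
by rewrite lee_fin normr_Re_le.
Qed.

Lemma cintegrable_Im f : cintegrable f -> mu.-integrable setT (EFin \o (fun x => complex.Im (f x))).
Proof.
move=> [[m1 m2] foo]; apply/integrableP; split; first exact/measurable_EFinP.
apply: le_lt_trans foo; apply: ge0_le_integralT => x //=.
by rewrite lee_fin normr_Im_le.
Qed.

Lemma cintegrable_comb (a : R[i]) f g : cintegrable f -> cintegrable g ->
  cintegrable (fun x => a * f x + g x).
Proof.
move=> [mf foo] [mg goo].
apply: (@cintegrable_le _ (fun x => normc a * normc (f x) + normc (g x))).
- by apply: cmeasurableD => //; apply: cmeasurableM => //; exact: cmeasurable_cst.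
- by move=> x; apply: le_trans (le_normcD _ _) _; rewrite Normc.normcM.
under eq_integral do rewrite EFinD EFinM.
rewrite ge0_integralD//; last 4 first.
- by move=> x _; rewrite lee_fin mulr_ge0 ?normc_ge0.
- apply/measurable_EFinP; apply: measurable_funM => //; exact: measurable_normc.
- by move=> x _; rewrite lee_fin normc_ge0.
- by apply/measurable_EFinP; exact: measurable_normc.
rewrite ge0_integralZl_EFin ?normc_ge0//; last 2 first.
- by move=> x _; rewrite lee_fin normc_ge0.
- by apply/measurable_EFinP; exact: measurable_normc.
apply: lte_add_pinfty => //; apply: lte_mul_pinfty => //.
by rewrite lee_fin normc_ge0.
Qed.

Lemma cintegral_comb (a : R[i]) f g : cintegrable f -> cintegrable g ->
  cintegral mu (fun x => a * f x + g x) = a * cintegral mu f + cintegral mu g.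
Proof.
move=> fi gi.
have [fr fm] := (cintegrable_Re fi, cintegrable_Im fi).
have [gr gm] := (cintegrable_Re gi, cintegrable_Im gi).
have zi (c : R) h : mu.-integrable setT (EFin \o h) ->
    mu.-integrable setT (EFin \o (fun x => c * h x)).
  by move=> hi; have := integrableZl measurableT c hi; apply: eq_integrable.
rewrite /cintegral.
under eq_Rintegral => x _.
  rewrite (_ : complex.Re _ = (complex.Re a * complex.Re (f x) +
    (- complex.Im a) * complex.Im (f x)) + complex.Re (g x)); last first.
    by case: a (f x) (g x) => [? ?] [? ?] [? ?] /=; ring.
  over.
under [X in (_ +i* X)%C]eq_Rintegral => x _.
  rewrite (_ : complex.Im _ = (complex.Re a * complex.Im (f x) +
    complex.Im a * complex.Re (f x)) + complex.Im (g x)); last first.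
    by case: a (f x) (g x) => [? ?] [? ?] [? ?] /=; ring.
  over.
rewrite !RintegralD//; last 6 first.
- exact: (zi (complex.Re a) _ fm).
- exact: (zi (complex.Im a) _ fr).
- by apply: (integrableD measurableT (zi (complex.Re a) _ fm) (zi (complex.Im a) _ fr)).
- exact: (zi (complex.Re a) _ fr).
- exact: (zi (- complex.Im a) _ fm).
- by apply: (integrableD measurableT (zi (complex.Re a) _ fr) (zi (- complex.Im a) _ fm)).
rewrite !RintegralZl//.
by apply/eqP; rewrite eq_complex; case: a => a b /=; apply/andP; split; apply/eqP; ring.
Qed.

Lemma cintegral0 : cintegral mu (fun _ => 0) = 0.
Proof.
rewrite /cintegral; under eq_Rintegral do rewrite /=.
by rewrite /Rintegral integral0.
Qed.

Lemma cintegrable0 : cintegrable (fun _ => 0).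
Proof.
split; first exact: cmeasurable_cst.
by under eq_integral do rewrite Normc.normc0; rewrite integral0.
Qed.

Lemma cintegralZ (a : R[i]) f : cintegrable f ->
  cintegral mu (fun x => a * f x) = a * cintegral mu f.
Proof.
move=> fi; have := cintegral_comb a fi cintegrable0.
by rewrite cintegral0 addr0 => <-; congr cintegral; apply/funext => x; rewrite addr0.
Qed.

Lemma cintegral_conj f : cintegrable f ->
  cintegral mu (fun x => conjc (f x)) = conjc (cintegral mu f).
Proof.
move=> fi; rewrite /cintegral /=; congr (_ +i* _)%C.
  by apply: eq_Rintegral => x _; case: (f x).
rewrite -mulN1r -RintegralZl//; last exact: cintegrable_Im.
by apply: eq_Rintegral => x _; rewrite mulN1r; case: (f x).
Qed.

Lemma ae_eq_cintegral f g : cmeasurable f -> cmeasurable g ->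
  {ae mu, forall x, f x = g x} -> cintegral mu f = cintegral mu g.
Proof.
move=> [f1 f2] [g1 g2] fg; rewrite /cintegral /Rintegral; congr (_ +i* _)%C;
  congr fine; apply: ae_eq_integral => //; try exact/measurable_EFinP.
  by apply: filterS fg => x ->.
by apply: filterS fg => x ->.
Qed.

Lemma le_normc_cintegral f : cmeasurable f ->
  ((normc (cintegral mu f))%:E <= \int[mu]_x (normc (f x))%:E)%E.
Proof.
move=> mf; set J := (\int[mu]_x _)%E.
have J0 : (0 <= J)%E by apply: integral_ge0 => x _; rewrite lee_fin normc_ge0.
have [->|Jn] := eqVneq J +oo%E; first exact: leey.
have Joo : (J < +oo)%E by rewrite ltey.
have fi : cintegrable f by split.
have Jfin : J \is a fin_num by rewrite ge0_fin_numE.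
pose I := cintegral mu f.
have [I0|Ip] := eqVneq (normc I) 0; first by rewrite -/I I0.
have IE : conjc I * I = cintegral mu (fun x => conjc I * f x) by rewrite cintegralZ.
rewrite -/I; clearbody I.
have {}Ip : 0 < normc I by rewrite lt_neqAle eq_sym Ip normc_ge0.
have gi : cintegrable (fun x => conjc I * f x).
  have := cintegrable_comb (conjc I) fi cintegrable0.
  by congr cintegrable; apply/funext => x; rewrite addr0.
have : ((normc I ^+ 2)%:E <= (normc I)%:E * J)%E.
  have -> : normc I ^+ 2 = complex.Re (cintegral mu (fun x => conjc I * f x)).
    by rewrite -IE mul_conjc.
  rewrite /cintegral/= fineK; last first.
    exact: (integrable_fin_num measurableT (cintegrable_Re gi)).
  rewrite /J -ge0_integralZl_EFin ?normc_ge0//; last 2 first.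
  - by move=> x _; rewrite lee_fin normc_ge0.
  - by apply/measurable_EFinP; exact: measurable_normc.
  apply: le_integral => //.
  - exact: (cintegrable_Re gi).
  - apply/integrableP; split.
      apply: measurable_funeM; apply/measurable_EFinP; exact: measurable_normc.
    under eq_integral do rewrite -EFinM gee0_abs ?lee_fin ?mulr_ge0 ?normc_ge0// EFinM.
    rewrite ge0_integralZl_EFin ?normc_ge0//; last 2 first.
    - by move=> x _; rewrite lee_fin normc_ge0.
    - by apply/measurable_EFinP; exact: measurable_normc.
    by apply: lte_mul_pinfty => //; rewrite lee_fin normc_ge0.
  - move=> x _; rewrite -EFinM lee_fin; apply: le_trans (ler_norm _) _.
    by apply: le_trans (normr_Re_le _) _; rewrite Normc.normcM normc_conjc.
rewrite -(fineK Jfin) -EFinM !lee_fin expr2 ler_pM2l//.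
Qed.

End complex_integral.

Section parametric_integrals.
Context d1 d2 (T1 : measurableType d1) (T2 : measurableType d2) (R : realType).
Variables (m1 : {sigma_finite_measure set T1 -> \bar R})
          (m2 : {sigma_finite_measure set T2 -> \bar R}).
Local Notation normc := Normc.normc.

Lemma measurable_Rintegral_param (f : T1 * T2 -> R) : measurable_fun setT f ->
  measurable_fun setT (fun x => \int[m2]_y f (x, y)).
Proof.
move=> mf; apply: (@measurableT_comp _ _ _ _ _ _ (@fine R)); first exact: fine_measurable.
pose g p := (f p)%:E.
have mg : measurable_fun setT g by exact/measurable_EFinP.
rewrite (_ : (fun _ => _) =
  (fun x => \int[m2]_y (g^\+ (x, y)) - \int[m2]_y (g^\- (x, y)))%E); last first.
  apply/funext => x; rewrite [LHS]integralE.
  by congr (_ - _)%E; apply: eq_integral => y _; rewrite ?funeposE ?funenegE.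
apply: emeasurable_funB.
  apply: (@measurable_fun_fubini_tonelli_F _ _ _ _ _ m2 (g^\+)%E) => //.
  exact: measurable_funepos.
apply: (@measurable_fun_fubini_tonelli_F _ _ _ _ _ m2 (g^\-)%E) => //.
exact: measurable_funeneg.
Qed.

Lemma cmeasurable_cintegral_param (f : T1 * T2 -> R[i]) : cmeasurable f ->
  cmeasurable (fun x => cintegral m2 (fun y => f (x, y))).
Proof.
move=> [f1 f2]; split => /=.
  exact: (measurable_Rintegral_param f1).
exact: (measurable_Rintegral_param f2).
Qed.

Lemma Rintegral_Fubini (f : T1 * T2 -> R) : measurable_fun setT f ->
  (\int[m1]_x \int[m2]_y `|f (x, y)|%:E < +oo)%E ->
  \int[m1]_x \int[m2]_y f (x, y) = \int[m2]_y \int[m1]_x f (x, y).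
Proof.
move=> mf foo.
have fi : (m1 \x m2)%E.-integrable setT (EFin \o f).
  by apply/integrable12ltyP => //; exact/measurable_EFinP.
rewrite /Rintegral; congr fine.
transitivity (\int[m1]_x \int[m2]_y (f (x, y))%:E)%E.
  apply: ae_eq_integral => //.
  - apply/measurable_EFinP; exact: measurable_Rintegral_param.
  - exact: (measurable_fubini_F fi).
  - apply: filterS (ae_integrable1 fi) => x /= xi _.
    by rewrite fineK//; exact: (integrable_fin_num _ xi).
rewrite (Fubini fi); apply: ae_eq_integral => //.
- exact: (measurable_fubini_G fi).
- apply/measurable_EFinP.
  apply: (@measurableT_comp _ _ _ _ _ _ (@fine R)); first exact: fine_measurable.
  exact: (measurable_fubini_G fi).
- apply: filterS (ae_integrable2 fi) => x /= xi _.
  by rewrite fineK//; exact: (integrable_fin_num _ xi).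
Qed.

Lemma cintegral_Fubini (f : T1 * T2 -> R[i]) : cmeasurable f ->
  (\int[m1]_x \int[m2]_y (normc (f (x, y)))%:E < +oo)%E ->
  cintegral m1 (fun x => cintegral m2 (fun y => f (x, y))) =
  cintegral m2 (fun y => cintegral m1 (fun x => f (x, y))).
Proof.
move=> [f1 f2] foo; rewrite /cintegral/=; congr (_ +i* _)%C.
  apply: (Rintegral_Fubini f1); apply: le_lt_trans foo.
  apply: ge0_le_integralT => x; first by apply: integral_ge0 => y _; rewrite lee_fin.
  by apply: ge0_le_integralT => y; rewrite lee_fin ?normr_Re_le.
apply: (Rintegral_Fubini f2); apply: le_lt_trans foo.
apply: ge0_le_integralT => x; first by apply: integral_ge0 => y _; rewrite lee_fin.
by apply: ge0_le_integralT => y; rewrite lee_fin ?normr_Im_le.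
Qed.

End parametric_integrals.

Section L2_space.
Variables (R : realType) (d : nat).
Local Notation E := 'rV[R]_d.
Local Notation leb := (lebesgue_rV R d).
Local Notation normc := Normc.normc.
Implicit Types f g h : E -> R[i].

Lemma measurable_sqr_normc f : cmeasurable f ->
  measurable_fun setT (fun x => (normc (f x) ^+ 2)%:E).
Proof.
by move=> mf; apply/measurable_EFinP; apply: measurable_funX; exact: measurable_normc.
Qed.

Definition L2sq f : R := \int[leb]_x normc (f x) ^+ 2.

Lemma L2sq_ge0 f : 0 <= L2sq f.
Proof. by apply: Rintegral_ge0 => x _; exact: sqr_ge0. Qed.

Lemma sqr_L2norm f : L2norm f ^+ 2 = L2sq f.
Proof. by rewrite sqr_sqrtr// L2sq_ge0. Qed.

Lemma L2sqE f : L2 f -> (L2sq f)%:E = (\int[leb]_x (normc (f x) ^+ 2)%:E)%E.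
Proof.
move=> [mf foo]; rewrite fineK// ge0_fin_numE//.
by apply: integral_ge0 => x _; rewrite lee_fin sqr_ge0.
Qed.

Lemma L2_le f (B : R) : cmeasurable f ->
  (\int[leb]_x (normc (f x) ^+ 2)%:E <= B%:E)%E -> L2 f /\ L2sq f <= B.
Proof.
move=> mf fB; have Lf : L2 f by split => //; apply: le_lt_trans fB _; exact: ltry.
by split => //; rewrite -lee_fin L2sqE.
Qed.

Lemma L2_cst0 : L2 (fun _ : E => 0 : R[i]).
Proof.
split; first exact: cmeasurable_cst.
by under eq_integral do rewrite Normc.normc0 expr0n; rewrite integral0.
Qed.

Lemma L2_dominated f g (c : R) : cmeasurable f -> L2 g -> 0 <= c ->
  (forall x, normc (f x) <= c * normc (g x)) ->
  L2 f /\ L2sq f <= c ^+ 2 * L2sq g.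
Proof.
move=> mf gL c0 fg; apply: L2_le => //.
rewrite EFinM (L2sqE gL) -ge0_integralZl_EFin ?sqr_ge0//; last 2 first.
- by move=> x _; rewrite lee_fin sqr_ge0.
- by apply: measurable_sqr_normc; case: gL.
apply: ge0_le_integralT => x; first by rewrite lee_fin sqr_ge0.
rewrite -EFinM lee_fin -exprMn ler_pXn2r ?nnegrE ?normc_ge0//.
by rewrite mulr_ge0 ?normc_ge0.
Qed.

Lemma L2Z (a : R[i]) f : L2 f -> L2 (fun x => a * f x).
Proof.
move=> fL; have [] // := @L2_dominated (fun x => a * f x) f (normc a).
- by apply: cmeasurableM; [exact: cmeasurable_cst|case: fL].
- exact: normc_ge0.
- by move=> x; rewrite Normc.normcM.
Qed.

Lemma integral_sqr_sum_lty f g : L2 f -> L2 g ->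
  (\int[leb]_x ((normc (f x) ^+ 2 + normc (g x) ^+ 2) *+ 2)%:E < +oo)%E.
Proof.
move=> [mf foo] [mg goo].
under eq_integral => x _ do rewrite -mulr_natl EFinM.
rewrite ge0_integralZl_EFin//; last 2 first.
- by move=> x _; rewrite lee_fin addr_ge0 ?sqr_ge0.
- apply/measurable_EFinP; apply: measurable_funD; apply: measurable_funX;
    exact: measurable_normc.
under eq_integral => x _ do rewrite EFinD.
rewrite ge0_integralD//; last 4 first.
- by move=> x _; rewrite lee_fin sqr_ge0.
- exact: measurable_sqr_normc.
- by move=> x _; rewrite lee_fin sqr_ge0.
- exact: measurable_sqr_normc.
by apply: lte_mul_pinfty => //; exact: lte_add_pinfty.
Qed.

Lemma L2D f g : L2 f -> L2 g -> L2 (fun x => f x + g x).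
Proof.
move=> fL gL; split; first by apply: cmeasurableD; [case: fL|case: gL].
apply: le_lt_trans (integral_sqr_sum_lty fL gL).
by apply: ge0_le_integralT => x; rewrite lee_fin ?sqr_ge0// sqr_normcD_le.
Qed.

Lemma L2B f g : L2 f -> L2 g -> L2 (fun x => f x - g x).
Proof.
move=> fL gL; have := L2D fL (L2Z (-1) gL).
by under eq_fun do rewrite mulN1r.
Qed.

Lemma L2_cintegrable f g : L2 f -> L2 g ->
  cintegrable leb (fun x => conjc (f x) * g x).
Proof.
move=> fL gL; apply: cintegrable_le (integral_sqr_sum_lty fL gL).
  by apply: cmeasurableM; [apply: cmeasurable_conj; case: fL|case: gL].
move=> x; rewrite Normc.normcM normc_conjc.
have := sqr_ge0 (normc (f x) - normc (g x)).
by have [? ?] := (sqr_ge0 (normc (f x)), sqr_ge0 (normc (g x))); lra.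
Qed.

Lemma L2inner_self f : L2 f -> L2inner f f = (L2sq f)%:C%C.
Proof.
move=> fL; rewrite /L2inner /cintegral; congr (_ +i* _)%C.
  by apply: eq_Rintegral => x _; rewrite mul_conjc.
rewrite /Rintegral (eq_integral (cst 0%E)) ?integral0// => x _.
by rewrite mul_conjc.
Qed.

Lemma L2inner_comb (a : R[i]) f g h : L2 f -> L2 g -> L2 h ->
  L2inner h (fun x => a * f x + g x) = a * L2inner h f + L2inner h g.
Proof.
move=> fL gL hL; rewrite /L2inner.
rewrite -cintegral_comb; [|exact: L2_cintegrable|exact: L2_cintegrable].
by congr cintegral; apply/funext => x; ring.
Qed.

Lemma L2inner_conj f g : L2 f -> L2 g -> L2inner g f = conjc (L2inner f g).
Proof.
move=> fL gL; rewrite /L2inner -cintegral_conj; last exact: L2_cintegrable.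
by congr cintegral; apply/funext => x; rewrite conjcM conjcK mulrC.
Qed.

Lemma eqL2P f g : L2 f -> L2 g -> eqL2 f g <-> L2sq (fun x => f x - g x) = 0.
Proof.
move=> fL gL; have hL := L2B fL gL.
have mh : cmeasurable (fun x => f x - g x) by case: hL.
split=> [fg|h0].
  apply: EFin_inj; rewrite L2sqE//.
  rewrite -[RHS](integral0 leb setT); apply: ae_eq_integral => //.
    exact: measurable_sqr_normc.
  by apply: filterS fg => x -> _; rewrite subrr Normc.normc0 expr0n.
have := L2sqE hL; rewrite h0 => /esym H.
have := (@ae_eq_integral_abs _ _ _ leb _ measurableT _ (measurable_sqr_normc mh)).1.
under eq_integral do rewrite gee0_abs ?lee_fin ?sqr_ge0//.
move=> /(_ H); apply: filterS => x /(_ I) /= [] /eqP.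
by rewrite sqrf_eq0 => /eqP /Normc.eq0_normc /eqP; rewrite subr_eq0 => /eqP.
Qed.

Lemma eqL2_refl f : eqL2 f f.
Proof. exact: aeW. Qed.

Lemma eqL2_sym f g : eqL2 f g -> eqL2 g f.
Proof. by apply: filterS => x ->. Qed.

Lemma eqL2_trans f g h : eqL2 f g -> eqL2 g h -> eqL2 f h.
Proof. by apply: filterS2 => x -> ->. Qed.

Lemma L2sq_eqL2 f g : L2 f -> L2 g -> eqL2 f g -> L2sq f = L2sq g.
Proof.
move=> fL gL fg; apply: EFin_inj; rewrite !L2sqE//; apply: ae_eq_integral => //.
- by apply: measurable_sqr_normc; case: fL.
- by apply: measurable_sqr_normc; case: gL.
- by apply: filterS fg => x ->.
Qed.

Lemma L2inner_eqL2 f f' g g' : L2 f -> L2 f' -> L2 g -> L2 g' ->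
  eqL2 f f' -> eqL2 g g' -> L2inner f g = L2inner f' g'.
Proof.
move=> fL fL' gL gL' ff gg; apply: ae_eq_cintegral.
- by case: (L2_cintegrable fL gL).
- by case: (L2_cintegrable fL' gL').
- by apply: filterS2 ff gg => x -> ->.
Qed.

End L2_space.

Section completeness.
Variable R : realType.

Lemma geometric_increments_limit (a : nat -> R) (c r : R) :
  0 < r -> r < 1 -> (forall n, `|a n.+1 - a n| <= c * r ^+ n) ->
  exists l, forall n, `|a n - l| <= c / (1 - r) * r ^+ n.
Proof.
move=> r0 r1 ha; pose C := c / (1 - r).
have c0 : 0 <= c by have := ha 0%N; rewrite expr0 mulr1; apply: le_trans.
have C0 : 0 <= C by rewrite divr_ge0// subr_ge0 ltW.
pose lo n := a n - C * r ^+ n; pose hi n := a n + C * r ^+ n.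
have Cr n : C * r ^+ n - C * r ^+ n.+1 = c * r ^+ n.
  by rewrite /C exprS; field; lra.
have lo_S n : lo n <= lo n.+1.
  by rewrite /lo; have := ha n; have := Cr n; rewrite ler_norml => ? /andP[]; lra.
have hi_S n : hi n.+1 <= hi n.
  by rewrite /hi; have := ha n; have := Cr n; rewrite ler_norml => ? /andP[]; lra.
have lo_hi n m : lo n <= hi m.
  apply: (@le_trans _ _ (lo (maxn n m))).
    by have /nondecreasing_seqP h := lo_S; apply: h; exact: leq_maxl.
  apply: (@le_trans _ _ (hi (maxn n m))).
    by have := mulr_ge0 C0 (exprn_ge0 (maxn n m) (ltW r0)); rewrite /lo /hi; lra.
  by have /nonincreasing_seqP h := hi_S; apply: h; exact: leq_maxr.
exists (sup (range lo)) => n.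
have h1 : lo n <= sup (range lo).
  by apply: ub_le_sup; [exists (hi 0%N) => _ [m _ <-]; exact: lo_hi|exists n].
have h2 : sup (range lo) <= hi n.
  by apply: ge_sup; [exists (lo 0%N), 0%N|move=> _ [m _ <-]; exact: lo_hi].
by move: h1 h2; rewrite /lo /hi ler_norml -/C => h1 h2; apply/andP; split; lra.
Qed.

Lemma nneseries_geometric_le (f : nat -> \bar R) (C q : R) : 0 <= C -> 0 < q -> q < 1 ->
  (forall n, 0 <= f n)%E -> (forall n, f n <= (C * q ^+ n)%:E)%E ->
  (\sum_(n <oo) f n <= (C / (1 - q))%:E)%E.
Proof.
move=> C0 q0 q1 f0 fC.
apply: lime_le; first by apply: is_cvg_nneseries.
apply: nearW => n.
apply: (@le_trans _ _ (C * (1 - q ^+ n) / (1 - q))%:E).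
  elim: n => [|n IH]; first by rewrite big_geq// expr0 subrr mulr0 mul0r.
  rewrite big_nat_recr//=; apply: le_trans (leeD IH (fC n)) _.
  by rewrite -EFinD lee_fin exprS le_eqVlt; apply/orP; left; apply/eqP; field; lra.
rewrite lee_fin ler_wpM2r//; first by rewrite invr_ge0 subr_ge0 ltW.
by rewrite ler_piMr// gerBl exprn_ge0// ltW.
Qed.

Variable d : nat.
Local Notation E := 'rV[R]_d.
Local Notation leb := (lebesgue_rV R d).
Local Notation normc := Normc.normc.

(* [G = sum_n q^-n |u_(n+1) - u_n|^2] is integrable, and where it is finite the
   increments decay geometrically. *)
Lemma L2_complete (u : nat -> E -> R[i]) (C r : R) : 0 < r -> r < 1 ->
  (forall n, L2 (u n)) ->
  (forall n, L2sq (fun x => u n.+1 x - u n x) <= C * (r ^+ 4) ^+ n) ->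
  exists v C', L2 v /\ forall n, L2sq (fun x => u n x - v x) <= C' * (r ^+ 2) ^+ n.
Proof.
move=> r0 r1 uL uC.
have C0 : 0 <= C by have := uC 0%N; rewrite expr0 mulr1; apply: le_trans; exact: L2sq_ge0.
have mu n : cmeasurable (u n) by case: (uL n).
pose q := r ^+ 2.
have q0 : 0 < q by rewrite exprn_gt0.
have q1 : q < 1 by rewrite exprn_ilt1// ltW.
pose Dn n x := u n.+1 x - u n x.
have DL n : L2 (Dn n) by exact: L2B.
pose F n x := ((q ^- n) * normc (Dn n x) ^+ 2)%:E.
have F0 n x : (0 <= F n x)%E by rewrite lee_fin mulr_ge0 ?sqr_ge0// invr_ge0 exprn_ge0 ?ltW.
have mF n : measurable_fun setT (F n).
  apply/measurable_EFinP; apply: measurable_funM => //.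
  by apply: measurable_funX; apply: measurable_normc; case: (DL n).
pose G x := (\sum_(n <oo) F n x)%E.
have G0 x : (0 <= G x)%E by exact: nneseries_ge0.
have mG : measurable_fun setT G.
  by apply: ge0_emeasurable_sum => //; move=> n x _ _; exact: F0.
have GC : (\int[leb]_x G x <= (C / (1 - q))%:E)%E.
  rewrite /G integral_nneseries//; apply: nneseries_geometric_le => // n.
    by apply: integral_ge0.
  rewrite /F; under eq_integral do rewrite EFinM.
  rewrite ge0_integralZl_EFin//; last 3 first.
  - by move=> x _; rewrite lee_fin sqr_ge0.
  - by apply: measurable_sqr_normc; case: (DL n).
  - by rewrite invr_ge0 exprn_ge0 ?ltW.
  rewrite -L2sqE// -EFinM lee_fin ler_pdivrMl ?exprn_gt0//.
  by apply: le_trans (uC n) _; rewrite mulrCA -exprMn /q -exprD lexx.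
pose g x := Num.sqrt (fine (G x)).
have Dg n x : G x \is a fin_num -> normc (Dn n x) <= g x * r ^+ n.
  have rn0 : 0 <= r ^+ n by rewrite exprn_ge0// ltW.
  move=> xfin; rewrite -ler_sqr ?nnegrE ?normc_ge0 ?mulr_ge0 ?sqrtr_ge0//.
  rewrite exprMn sqr_sqrtr ?fine_ge0// -exprM mulnC exprM -/q.
  rewrite -ler_pdivrMr ?exprn_gt0// mulrC -lee_fin fineK//.
  apply: (@le_trans _ _ (\sum_(0 <= k < n.+1) F k x)%E).
    by rewrite big_nat_recr//= leeDr// sume_ge0.
  by apply: nneseries_lim_ge => k _ _; exact: F0.
have Dlim x : exists l : R[i], if G x \is a fin_num then
    forall n, normc (u n x - l) <= 2 * (g x / (1 - r)) * r ^+ n else l = 0.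
  have [xfin|xfin] := boolP (G x \is a fin_num); last by exists 0.
  have [|l1 h1] := @geometric_increments_limit (fun n => complex.Re (u n x)) (g x) r r0 r1.
    move=> n; apply: le_trans (Dg n x xfin); apply: le_trans (normr_Re_le _).
    by rewrite /Dn ReD ReN.
  have [|l2 h2] := @geometric_increments_limit (fun n => complex.Im (u n x)) (g x) r r0 r1.
    move=> n; apply: le_trans (Dg n x xfin); apply: le_trans (normr_Im_le _).
    by rewrite /Dn; case: (u n.+1 x) (u n x) => [? ?] [? ?].
  exists (l1 +i* l2)%C => n; apply: le_trans (normc_le_ReIm _) _.
  have := h1 n; have := h2 n; case: (u n x) => a b /=; lra.
have [v hv] := choice Dlim.
have hvD n x : G x \is a fin_num ->
    normc (u n x - v x) <= 2 * (g x / (1 - r)) * r ^+ n.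
  by move=> xfin; have := hv x; rewrite xfin; apply.
pose D := [set x | G x \is a fin_num].
have mD : measurable D.
  by rewrite -[D]setTI; exact: emeasurable_fin_num.
have r_cvg : r ^+ n @[n --> \oo] --> (0 : R) by apply: cvg_expr; rewrite ger0_norm// ltW.
have mlim (P : R[i] -> R) : (forall z, `|P z| <= normc z) -> P 0 = 0 ->
    (forall z w, P (z - w) = P z - P w) ->
    (forall n, measurable_fun setT (fun x => P (u n x))) ->
    measurable_fun setT (fun x => P (v x)).
  move=> Ple P0 PB mP.
  apply: (@measurable_fun_cvg _ _ _ _ (fun n x => \1_D x * P (u n x))).
    by move=> n; apply: measurable_funM => //; exact: measurable_indic.
  move=> x _; rewrite indicE; case: ifPn (hv x) => xfin.
    move=> hx; rewrite mem_set//; under eq_fun do rewrite mul1r.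
    pose K := 2 * (g x / (1 - r)).
    apply: (@squeeze_cvgr _ _ _ _ (fun n => P (v x) - K * r ^+ n)
      (fun n => P (v x) + K * r ^+ n)).
    - apply: nearW => n; have := le_trans (Ple _) (hx n); rewrite PB ler_norml -/K.
      by move=> /andP[? ?]; apply/andP; split; lra.
    - rewrite -[X in _ --> X]subr0 -(mulr0 K).
      by apply: cvgB; [exact: cvg_cst|apply: cvgMr].
    - rewrite -[X in _ --> X]addr0 -(mulr0 K).
      by apply: cvgD; [exact: cvg_cst|apply: cvgMr].
  by move=> ->; rewrite P0 memNset//; [under eq_fun do rewrite mul0r; exact: cvg_cst|exact/negP].
have mv : cmeasurable v.
  split; apply: mlim => //.
  - exact: normr_Re_le.
  - by move=> z w; rewrite ReD ReN.
  - by move=> n; case: (mu n).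
  - exact: normr_Im_le.
  - by move=> [? ?] [? ?].
  - by move=> n; case: (mu n).
pose c := (2 / (1 - r)) ^+ 2.
have c0 : 0 < c by rewrite exprn_gt0// divr_gt0// subr_gt0.
have bound n x : ((normc (u n x - v x) ^+ 2)%:E <= (c * q ^+ n)%:E * G x)%E.
  have [xfin|xoo] := boolP (G x \is a fin_num); last first.
    have -> : G x = +oo%E.
      by apply/eqP; move: xoo; rewrite ge0_fin_numE// -leNgt leye_eq.
    by rewrite gt0_muley ?leey// lte_fin mulr_gt0// exprn_gt0.
  rewrite -(fineK xfin) -EFinM lee_fin.
  have hx := hvD n x xfin.
  have : normc (u n x - v x) ^+ 2 <= (2 * (g x / (1 - r)) * r ^+ n) ^+ 2.
    by rewrite ler_pXn2r ?nnegrE ?normc_ge0//; exact: le_trans (normc_ge0 _) hx.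
  move/le_trans; apply; rewrite !exprMn /g sqr_sqrtr ?fine_ge0// le_eqVlt; apply/orP; left.
  by apply/eqP; rewrite /c; move: (r ^+ n) (fine (G x)) => Q y; field; lra.
have Lb n : L2 (fun x => u n x - v x) /\
    L2sq (fun x => u n x - v x) <= c * q ^+ n * (C / (1 - q)).
  have cq0 : 0 <= c * q ^+ n by rewrite (mulr_ge0 (ltW c0))// exprn_ge0// ltW.
  apply: L2_le.
    exact: cmeasurableB.
  apply: (@le_trans _ _ (\int[leb]_x ((c * q ^+ n)%:E * G x))%E).
    by apply: ge0_le_integralT => // x; rewrite lee_fin sqr_ge0.
  by rewrite ge0_integralZl_EFin// [leRHS]EFinM lee_wpmul2l.
exists v, (c * (C / (1 - q))); split; last first.
  by move=> n; have [_] := Lb n; rewrite mulrAC.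
have := L2B (uL 0%N) (proj1 (Lb 0%N)); congr L2; apply/funext => x.
by rewrite opprB addrC subrK.
Qed.

End completeness.

Section L2_operators.
Variables (R : realType) (d : nat).
Local Notation E := 'rV[R]_d.
Local Notation normc := Normc.normc.

Definition L2pred : {pred E -> R[i]^o} := [pred f | f \in @L2 R d].

Lemma L2pred_submod_closed : submod_closed L2pred.
Proof.
split; first by apply: mem_set; exact: L2_cst0.
move=> a f g /set_mem fL /set_mem gL; apply: mem_set.
exact: L2D (L2Z a fL) gL.
Qed.

HB.instance Definition _ := GRing.isSubmodClosed.Build R[i] (E -> R[i]^o) L2pred
  L2pred_submod_closed.

Record L2fun := MkL2fun { L2val :> E -> R[i]^o ; L2valP : L2val \in L2pred }.

HB.instance Definition _ := [isSub for L2val].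
HB.instance Definition _ := [Choice of L2fun by <:].
HB.instance Definition _ := [SubChoice_isSubLmodule of L2fun by <:].

Implicit Types u v w : L2fun.

Lemma L2funP u : L2 u.
Proof. exact: set_mem (L2valP u). Qed.

Definition mkL2 (f : E -> R[i]) (fL : L2 f) : L2fun.
Proof. by exists f; exact: mem_set. Defined.

Definition L2dot u v : R[i] := L2inner u v.

Lemma L2dotDr u v w : L2dot u (v + w) = L2dot u v + L2dot u w.
Proof.
have := L2inner_comb 1 (L2funP v) (L2funP w) (L2funP u).
by rewrite mul1r => <-; congr L2inner; apply/funext => x; rewrite mul1r.
Qed.

Lemma L2dotZr a u v : L2dot u (a *: v) = a * L2dot u v.
Proof.
have := L2inner_comb a (L2funP v) (L2_cst0 R d) (L2funP u).
have -> : L2inner u (fun _ : E => 0 : R[i]) = 0.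
  rewrite /L2inner -[RHS](cintegral0 (lebesgue_rV R d)).
  by congr cintegral; apply/funext => x; rewrite mulr0.
by rewrite addr0 => <-; congr L2inner; apply/funext => x; rewrite addr0.
Qed.

Lemma L2dotC u v : L2dot v u = conjc (L2dot u v).
Proof. exact: L2inner_conj (L2funP u) (L2funP v). Qed.

Lemma sqnorm_L2 u : sqnorm L2dot u = L2sq u.
Proof. by rewrite /sqnorm /L2dot L2inner_self//; exact: L2funP. Qed.

Lemma L2dot_ge0 u : 0 <= complex.Re (L2dot u u).
Proof. by rewrite -/(sqnorm _ _) sqnorm_L2 L2sq_ge0. Qed.

Lemma L2dot_complete (u : nat -> L2fun) (C k : R) : 0 < k -> k < 1 ->
  (forall n, sqnorm L2dot (u n.+1 - u n) <= C * k ^+ n) ->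
  exists v, forall e : R, 0 < e ->
    exists n, sqnorm L2dot (u n - v) <= e /\ sqnorm L2dot (u n.+1 - v) <= e.
Proof.
move=> k0 k1 uC.
pose r := Num.sqrt (Num.sqrt k).
have r0 : 0 < r by rewrite !sqrtr_gt0.
have r4 : r ^+ 4 = k by rewrite (exprM r 2 2) !sqr_sqrtr ?sqrtr_ge0// ltW.
have r1 : r < 1 by rewrite -(@expr_lt1 _ 4)// ?r4// ltW.
have [|v [C' [vL vC]]] := @L2_complete _ _ (fun n => u n) C r r0 r1 (fun n => L2funP (u n)).
  by move=> n; rewrite r4; have := uC n; rewrite sqnorm_L2.
exists (mkL2 vL) => e e0.
have q1 : r ^+ 2 < 1 by rewrite exprn_ilt1// ltW.
have cv : C' * (r ^+ 2) ^+ n @[n --> \oo] --> (0 : R).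
  rewrite -(mulr0 C'); apply: cvgMr; apply: cvg_expr.
  by rewrite ger0_norm// sqr_ge0.
have [n _ hn] : \forall n \near \oo, C' * (r ^+ 2) ^+ n <= e.
  move/cvgrPdist_le : cv => /(_ e e0); apply: filterS => n.
  by rewrite sub0r normrN; apply: le_trans; exact: ler_norm.
exists n; rewrite !sqnorm_L2; split.
  by apply: le_trans (vC n) _; apply: hn => /=.
by apply: le_trans (vC n.+1) _; apply: hn => /=.
Qed.

Variable T : (E -> R[i]) -> E -> R[i].
Hypothesis T_bounded : bounded_op T.
Hypothesis T_sa : self_adjoint T.

Let T_L2 u : L2 (T u).
Proof. by case: T_bounded => h _ _ _; apply: h; exact: L2funP. Qed.

Definition L2lift u : L2fun := mkL2 (T_L2 u).

Lemma L2lift_sym u v : L2dot (L2lift u) v = L2dot u (L2lift v).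
Proof. by apply: T_sa; exact: L2funP. Qed.

Lemma bounded_op_L2sq : exists M, forall f, L2 f -> L2sq (T f) <= M * L2sq f.
Proof.
case: T_bounded => _ _ _ [C hC]; exists (C ^+ 2) => f fL.
rewrite -!sqr_L2norm -exprMn ler_pXn2r ?nnegrE ?sqrtr_ge0//; first exact: hC.
by apply: le_trans (hC f fL); exact: sqrtr_ge0.
Qed.

Lemma L2lift_bounded : exists M, forall u, sqnorm L2dot (L2lift u) <= M * sqnorm L2dot u.
Proof.
have [M hM] := bounded_op_L2sq; exists M => u.
by rewrite !sqnorm_L2; apply: hM; exact: L2funP.
Qed.

Definition L2_bounded_below (z : R[i]) := exists2 c : R, 0 < c &
  forall f, L2 f -> c * L2sq f <= L2sq (fun x => T f x - z * f x).

Let bounded_belowE z : L2_bounded_below z <-> bounded_below L2dot L2lift z.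
Proof.
split=> -[c c0 h]; exists c => // u; first by rewrite !sqnorm_L2; apply: h; exact: L2funP.
by move=> uL; have := h (mkL2 uL); rewrite !sqnorm_L2.
Qed.

Lemma resolvent_bounded_below z : resolvent_set T z -> L2_bounded_below z.
Proof.
move=> [S [[SL Se SD [C SC]] ST _]].
exists ((C ^+ 2 + 1)^-1); first by rewrite invr_gt0 ltr_wpDl ?sqr_ge0.
move=> f fL; rewrite ler_pdivrMl; last by rewrite ltr_wpDl ?sqr_ge0.
case: T_bounded => TL _ _ _.
have gL : L2 (fun x => T f x - z * f x) by apply: L2B; [exact: TL|exact: L2Z].
rewrite -(L2sq_eqL2 (SL _ gL) fL (ST f fL)).
have : L2sq (S (fun x => T f x - z * f x)) <= C ^+ 2 * L2sq (fun x => T f x - z * f x).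
  rewrite -!sqr_L2norm -exprMn ler_pXn2r ?nnegrE ?sqrtr_ge0//; first exact: SC.
  by apply: le_trans (SC _ gL); exact: sqrtr_ge0.
move/le_trans; apply; rewrite ler_wpM2r ?L2sq_ge0//; lra.
Qed.

Lemma bounded_below_resolvent z : L2_bounded_below z -> resolvent_set T z.
Proof.
move=> bb; have [M hM] := L2lift_bounded.
have surj := bounded_below_surjective L2dotDr L2dotZr L2dotC L2dot_ge0 L2lift_sym
  hM L2dot_complete ((bounded_belowE z).1 bb).
have [c c0 hc] := bb.
case: (T_bounded) => TL Te TD _.
have AL f : L2 f -> L2 (fun x => T f x - z * f x).
  by move=> fL; apply: L2B; [exact: TL|exact: L2Z].
have inv f : exists g, L2 f -> L2 g /\ eqL2 (fun x => T g x - z * g x) f.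
  have [fL|nfL] := pselect (L2 f); last by exists (fun _ => 0).
  have [u hu] := surj (mkL2 fL); exists u => _; have uL := L2funP u; split => //.
  by apply/eqL2P => //; [exact: AL|rewrite -[RHS]hu sqnorm_L2].
have [S hS] := choice inv.
have inj f g : L2 f -> L2 g ->
    eqL2 (fun x => T f x - z * f x) (fun x => T g x - z * g x) -> eqL2 f g.
  move=> fL gL fg; apply/eqL2P => //.
  have hL : L2 (fun x => f x - g x) by exact: L2B.
  apply/eqP; rewrite eq_le L2sq_ge0 andbT -(pmulr_rle0 _ c0).
  apply: le_trans (hc _ hL) _.
  have := TD (-1) g f gL fL.
  have -> : (fun x => -1 * g x + f x) = (fun x => f x - g x).
    by apply/funext => x; ring.
  move=> Tfg; rewrite (@L2sq_eqL2 _ _ _ (fun _ => 0) (AL _ hL) (L2_cst0 R d)).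
    rewrite -lee_fin L2sqE; last exact: L2_cst0.
    by under eq_integral do rewrite Normc.normc0 expr0n; rewrite integral0.
  apply: filterS2 Tfg fg => x -> /eqP; rewrite -subr_eq0 => /eqP h.
  by rewrite -[RHS]h; ring.
exists S; split.
- split.
  + by move=> f /hS[].
  + move=> f g fL gL fg; have [Sf hf] := hS f fL; have [Sg hg] := hS g gL.
    apply: inj => //; apply: eqL2_trans hf _; apply: eqL2_trans fg _.
    exact: eqL2_sym.
  + move=> a f g fL gL; have [Sf hf] := hS f fL; have [Sg hg] := hS g gL.
    have cL := L2D (L2Z a fL) gL; have [Sc hc'] := hS _ cL.
    have SaL := L2D (L2Z a Sf) Sg.
    apply: inj => //; apply: eqL2_trans hc' _.
    have := TD a (S f) (S g) Sf Sg.
    apply: filterS3 hf hg => x hf hg ->.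
    by rewrite -hf -hg; ring.
  + exists (Num.sqrt c^-1) => f fL; have [Sf hf] := hS f fL.
    rewrite -ler_sqr ?nnegrE ?mulr_ge0 ?sqrtr_ge0// exprMn !sqr_L2norm.
    rewrite sqr_sqrtr ?invr_ge0 ?(ltW c0)// ler_pdivlMl//.
    apply: le_trans (hc _ Sf) _; rewrite (L2sq_eqL2 _ fL hf)//.
    exact: AL.
- move=> f fL; have gL := AL f fL; have [Sg hg] := hS _ gL.
  exact: inj.
- by move=> f fL; have [] := hS f fL.
Qed.

Lemma spectrumP z : spectrum T z <-> ~ L2_bounded_below z.
Proof.
split=> h h'; apply: h; [exact: bounded_below_resolvent|exact: resolvent_bounded_below].
Qed.

Lemma spectrum_real z : spectrum T z -> z = (complex.Re z)%:C%C.
Proof.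
move=> /spectrumP h; have [M hM] := L2lift_bounded.
have [z0|zn0] := eqVneq (complex.Im z) 0; first by case: z z0 {h} => a b /= ->.
exfalso; apply: h; apply/bounded_belowE.
exists (complex.Im z ^+ 2); first by rewrite exprn_even_gt0.
exact: (sqnorm_sub_nonreal L2dotDr L2dotZr L2dotC L2dot_ge0 L2lift_sym).
Qed.

Lemma spectrum_near (l eta : R) f : 0 <= eta -> L2 f -> 0 < L2sq f ->
  L2sq (fun x => T f x - l%:C%C * f x) <= eta ^+ 2 * L2sq f ->
  exists2 mu : R, `|mu - l| <= eta & spectrum T mu%:C%C.
Proof.
move=> eta0 fL f0 fT; have [M hM] := L2lift_bounded.
have [||mu mul hmu] := not_bounded_below_near L2dotDr L2dotZr L2dotC L2dot_ge0
  L2lift_sym hM (l := l) (u0 := mkL2 fL) eta0.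
- by rewrite sqnorm_L2.
- by rewrite !sqnorm_L2.
by exists mu => //; apply/spectrumP => /bounded_belowE.
Qed.

End L2_operators.

(** * Integral operators *)

Section kernel_operators.
Variables (R : realType) (d : nat).
Local Notation E := 'rV[R]_d.
Local Notation leb := (lebesgue_rV R d).
Local Notation normc := Normc.normc.
Implicit Types (K : E -> E -> R[i]) (f g : E -> R[i]).

Definition kernel_bound K (A : R) := [/\ cmeasurable (fun p : E * E => K p.1 p.2),
  forall x, (\int[leb]_y (normc (K x y))%:E <= A%:E)%E &
  forall y, (\int[leb]_x (normc (K x y))%:E <= A%:E)%E].

Definition adjoint_kernel K : E -> E -> R[i] := fun x y => conjc (K y x).

Lemma adjoint_kernel_bound K (A : R) : kernel_bound K A -> kernel_bound (adjoint_kernel K) A.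
Proof.
move=> [mK K1 K2]; split.
- apply: cmeasurable_conj.
  exact: (cmeasurable_comp (@measurable_swap _ _ _ _) mK).
- by move=> x; under eq_integral do rewrite normc_conjc; exact: K2.
- by move=> x; under eq_integral do rewrite normc_conjc; exact: K1.
Qed.

Lemma lebesgue_rV_set1 (x : E) : (0 < d)%N -> leb [set x] = 0%E.
Proof.
move=> d0.
have -> : [set x] = [set y | forall i, y ord0 i \in `[x ord0 i, x ord0 i]].
  apply/seteqP; split=> y /=; first by move=> -> i; rewrite in_itv/= lexx.
  by move=> h; apply/rowP => i; have := h i; rewrite in_itv/= -eq_le => /eqP.
rewrite (@lebesgue_rV_box R d (fun i => x ord0 i) (fun i => x ord0 i)) => [|i]; last exact: lexx.
by rewrite (bigD1 (Ordinal d0))//= subrr mul0r.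
Qed.

Lemma measurable_rV_set1 (x : E) : measurable [set x].
Proof.
rewrite (_ : [set x] = \bigcap_(i in [set: 'I_d])
    ((fun y : E => y ord0 i) @^-1` [set x ord0 i])).
  apply: fin_bigcap_measurable => // i _; rewrite -[X in measurable X]setTI.
  exact: measurable_coord.
apply/seteqP; split=> y /=; first by move=> -> i.
by move=> h; apply/rowP => i; exact: (h i I).
Qed.

Lemma ae_neq (x : E) : (0 < d)%N -> {ae leb, forall y, y != x}.
Proof.
move=> d0; exists [set x]; split.
- exact: measurable_rV_set1.
- exact: lebesgue_rV_set1.
- by move=> y /= /negP; rewrite negbK => /eqP.
Qed.

Lemma ge0_sqr_lee (a b : \bar R) : (0 <= a)%E -> (a <= b)%E -> (a ^+ 2 <= b ^+ 2)%E.
Proof. by move=> a0 ab; exact: lee_pmul. Qed.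

Section fixed_kernel.
Variables (K : E -> E -> R[i]) (A : R).
Hypotheses (A0 : 0 < A) (KA : kernel_bound K A).

Let mK : cmeasurable (fun p : E * E => K p.1 p.2).
Proof. by case: KA. Qed.

Let mKx x : cmeasurable (K x).
Proof. exact: (cmeasurable_comp (pair1_measurable x) mK). Qed.

Let mKf f : cmeasurable f -> cmeasurable (fun p : E * E => K p.1 p.2 * f p.2).
Proof.
by move=> mf; apply: cmeasurableM => //; exact: (cmeasurable_comp measurable_snd mf).
Qed.

Let mKfx x f : cmeasurable f -> cmeasurable (fun y => K x y * f y).
Proof. by move=> mf; exact: cmeasurableM. Qed.

Lemma cmeasurable_integral_op f : cmeasurable f -> cmeasurable (integral_op K f).
Proof. by move=> mf; exact: (cmeasurable_cintegral_param leb (mKf mf)). Qed.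

Definition abs_integral f x := (\int[leb]_y (normc (K x y) * normc (f y))%:E)%E.

Lemma measurable_abs_kernel f : cmeasurable f ->
  measurable_fun setT (fun p : E * E => (normc (K p.1 p.2) * normc (f p.2))%:E).
Proof.
move=> mf; apply/measurable_EFinP.
have := measurable_normc (mKf mf).
by under eq_fun do rewrite Normc.normcM.
Qed.

Lemma measurable_abs_integral f : cmeasurable f -> measurable_fun setT (abs_integral f).
Proof.
move=> mf;
apply: (@measurable_fun_fubini_tonelli_F _ _ _ _ _ leb _ (measurable_abs_kernel mf)) => p.
by rewrite lee_fin mulr_ge0 ?normc_ge0.
Qed.

Lemma abs_integral_ge0 f x : (0 <= abs_integral f x)%E.
Proof. by apply: integral_ge0 => y _; rewrite lee_fin mulr_ge0 ?normc_ge0. Qed.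

Lemma integral_abs_integral_le f : L2 f ->
  (\int[leb]_x (abs_integral f x) ^+ 2 <= (A ^+ 2 * L2sq f)%:E)%E.
Proof.
move=> fL; have [mf _] := fL; case: KA => _ K1 K2.
rewrite EFinM L2sqE//.
apply: (schur_test (mu := leb) (k := fun p : E * E => normc (K p.1 p.2))
  (u := fun y => normc (f y))) => //.
- exact: measurable_normc.
- by move=> p; exact: normc_ge0.
- exact: measurable_normc.
- by move=> x; exact: normc_ge0.
Qed.

Lemma ae_abs_integral_lty f : L2 f -> {ae leb, forall x, (abs_integral f x < +oo)%E}.
Proof.
move=> fL; have [mf _] := fL.
have : leb.-integrable setT (fun x => (abs_integral f x) ^+ 2)%E.
  apply/integrableP; split.
    by apply: emeasurable_funM; exact: measurable_abs_integral.
  under eq_integral do rewrite gee0_abs ?sqre_ge0//.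
  by apply: le_lt_trans (integral_abs_integral_le fL) _; exact: ltry.
move=> /(integrable_ae measurableT); apply: filterS => x /(_ I).
rewrite fin_numElt => /andP[_]; apply: contraTT.
by rewrite -!leNgt !leye_eq => /eqP ->.
Qed.

Lemma cintegrable_section f x : cmeasurable f -> (abs_integral f x < +oo)%E ->
  cintegrable leb (fun y => K x y * f y).
Proof.
move=> mf foo; split; first exact: mKfx.
by under eq_integral do rewrite Normc.normcM.
Qed.

Lemma normc_integral_op_le f x : cmeasurable f ->
  ((normc (integral_op K f x))%:E <= abs_integral f x)%E.
Proof.
move=> mf; apply: le_trans (le_normc_cintegral leb (mKfx x mf)) _.
by rewrite le_eqVlt; apply/orP; left; apply/eqP; apply: eq_integral => y _;
  rewrite Normc.normcM.
Qed.

Lemma L2_integral_op f : L2 f ->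
  L2 (integral_op K f) /\ L2sq (integral_op K f) <= A ^+ 2 * L2sq f.
Proof.
move=> fL; have [mf _] := fL.
apply: L2_le; first exact: cmeasurable_integral_op.
apply: le_trans (integral_abs_integral_le fL).
apply: ge0_le_integralT => x; first by rewrite lee_fin sqr_ge0.
rewrite EFin_expe; apply: ge0_sqr_lee; first by rewrite lee_fin normc_ge0.
exact: normc_integral_op_le.
Qed.

Lemma bounded_integral_op : bounded_op (integral_op K).
Proof.
split.
- by move=> f /L2_integral_op[].
- move=> f g [mf _] [mg _] fg; apply: aeW => x; apply: ae_eq_cintegral.
  + exact: mKfx.
  + exact: mKfx.
  + by apply: filterS fg => y ->.
- move=> a f g fL gL; have [[mf _] [mg _]] := (fL, gL).
  apply: filterS2 (ae_abs_integral_lty fL) (ae_abs_integral_lty gL) => x fx gx.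
  rewrite /integral_op -cintegral_comb; last 2 first.
  + exact: cintegrable_section.
  + exact: cintegrable_section.
  by congr cintegral; apply/funext => y; ring.
- exists A => f fL; have [_ h] := L2_integral_op fL.
  rewrite -ler_sqr ?nnegrE ?mulr_ge0 ?sqrtr_ge0 ?(ltW A0)//.
  by rewrite exprMn !sqr_L2norm.
Qed.

End fixed_kernel.

Lemma integral_op_adjoint K (A : R) f g : 0 < A -> kernel_bound K A -> L2 f -> L2 g ->
  L2inner (integral_op K f) g = L2inner f (integral_op (adjoint_kernel K) g).
Proof.
move=> A0 KA fL gL; have [[mf _] [mg _]] := (fL, gL).
have KA' := adjoint_kernel_bound KA.
have [mK _ _] := KA; have [mK' _ _] := KA'.
pose F (p : E * E) := conjc (K p.1 p.2 * f p.2) * g p.1.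
have mF : cmeasurable F.
  apply: cmeasurableM; last exact: (cmeasurable_comp measurable_fst mg).
  apply: cmeasurable_conj; apply: cmeasurableM => //.
  exact: (cmeasurable_comp measurable_snd mf).
have FE x : (\int[leb]_y (normc (F (x, y)))%:E = (normc (g x))%:E * abs_integral K f x)%E.
  rewrite /abs_integral -ge0_integralZl_EFin ?normc_ge0//; last 2 first.
  - by move=> y _; rewrite lee_fin mulr_ge0 ?normc_ge0.
  - exact: (measurableT_comp (measurable_abs_kernel KA mf) (pair1_measurable x)).
  by apply: eq_integral => y _; rewrite /F !Normc.normcM normc_conjc Normc.normcM -EFinM mulrC.
have Foo : (\int[leb]_x \int[leb]_y (normc (F (x, y)))%:E < +oo)%E.
  apply: (@le_lt_trans _ _
      (\int[leb]_x ((normc (g x) ^+ 2)%:E + (abs_integral K f x) ^+ 2))%E).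
    apply: ge0_le_integralT => x.
      by apply: integral_ge0 => y _; rewrite lee_fin normc_ge0.
    rewrite FE; have := abs_integral_ge0 K f x; have := normc_ge0 (g x).
    move: (normc _) (abs_integral K f x) => a [b| |] a0 b0 //.
      rewrite -EFinM -EFin_expe -EFinD lee_fin.
      by have := sqr_ge0 (a - b); rewrite lee_fin in b0; have := mulr_ge0 a0 b0; nra.
    by rewrite expe2 mulyy addey// leey.
  rewrite ge0_integralD//; last 4 first.
  - by move=> x _; rewrite lee_fin sqr_ge0.
  - exact: measurable_sqr_normc.
  - by move=> x _; exact: sqre_ge0.
  - by apply: emeasurable_funM; exact: (measurable_abs_integral KA).
  apply: lte_add_pinfty; first by case: gL.
  by apply: le_lt_trans (integral_abs_integral_le A0 KA fL) _; exact: ltry.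
transitivity (cintegral leb (fun x => cintegral leb (fun y => F (x, y)))).
  apply: ae_eq_cintegral.
  - apply: cmeasurableM => //; apply: cmeasurable_conj.
    exact: (cmeasurable_integral_op KA).
  - exact: cmeasurable_cintegral_param.
  apply: filterS (ae_abs_integral_lty A0 KA fL) => x fx.
  have si := cintegrable_section KA mf fx.
  change (conjc (cintegral leb (fun y => K x y * f y)) * g x =
    cintegral leb (fun y => F (x, y))).
  rewrite -cintegral_conj// mulrC -cintegralZ.
    by congr cintegral; apply/funext => y; rewrite /F/= mulrC.
  case: si => ms soo; split; first exact: cmeasurable_conj.
  by under eq_integral do rewrite normc_conjc.
rewrite (cintegral_Fubini mF Foo); apply: ae_eq_cintegral.
- apply: (@cmeasurable_cintegral_param _ _ _ _ _ leb (fun p => F (p.2, p.1))).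
  exact: (cmeasurable_comp (@measurable_swap _ _ _ _) mF).
- apply: cmeasurableM; first exact: cmeasurable_conj.
  exact: (cmeasurable_integral_op KA').
apply: filterS (ae_abs_integral_lty A0 KA' gL) => y gy.
have si := cintegrable_section KA' mg gy.
change (cintegral leb (fun x => F (x, y)) =
  conjc (f y) * cintegral leb (fun x => adjoint_kernel K y x * g x)).
rewrite -cintegralZ//; congr cintegral; apply/funext => x.
by rewrite /F/= /adjoint_kernel conjcM; ring.
Qed.

Lemma self_adjoint_integral_op K (A : R) : 0 < A -> kernel_bound K A -> (0 < d)%N ->
  (forall x y, x != y -> K y x = conjc (K x y)) -> self_adjoint (integral_op K).
Proof.
move=> A0 KA d0 K_herm f g fL gL; rewrite (integral_op_adjoint A0 KA fL gL).
have [mg _] := gL; have [mK _ _] := KA.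
congr L2inner; apply/funext => x; apply: ae_eq_cintegral.
- apply: cmeasurableM => //; apply: cmeasurable_conj.
  exact: (cmeasurable_comp (pair2_measurable x) mK).
- by apply: cmeasurableM => //; exact: (cmeasurable_comp (pair1_measurable x) mK).
have : {ae leb, forall y, y != x} by exact: ae_neq.
by apply: filterS => y yx; rewrite /adjoint_kernel (K_herm _ _ yx).
Qed.

End kernel_operators.

Section cubes.
Variables (R : realType) (d : nat).
Local Notation E := 'rV[R]_d.
Local Notation leb := (lebesgue_rV R d).

Definition cube (x : E) (l : R) : set E := [set y | `|x - y| <= l].

Lemma rV_norm_leP (x : E) (l : R) : 0 <= l ->
  `|x| <= l <-> forall i, `|x ord0 i| <= l.
Proof.
move=> l0; rewrite /Num.norm/= mx_normrE; split=> [/bigmax_leP[_ h] i|h].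
  exact: (h (ord0, i)).
by apply/bigmax_leP; split => // -[j i] _ /=; rewrite (ord1 j); exact: h.
Qed.

Lemma cubeE (x : E) (l : R) : 0 <= l ->
  cube x l = [set y | forall i, y ord0 i \in `[x ord0 i - l, x ord0 i + l]].
Proof.
move=> l0; apply/seteqP; split=> y; rewrite /cube /=.
  move=> /(rV_norm_leP _ l0) h i; have := h i.
  by rewrite !mxE in_itv/= ler_distlC.
move=> h; apply/(rV_norm_leP _ l0) => i; have := h i.
by rewrite !mxE in_itv/= ler_distlC.
Qed.

Lemma lebesgue_cube (x : E) (l : R) : 0 <= l -> leb (cube x l) = ((l *+ 2) ^+ d)%:E.
Proof.
move=> l0; rewrite cubeE//.
rewrite (@lebesgue_rV_box R d (fun i => x ord0 i - l) (fun i => x ord0 i + l)).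
  congr EFin; under eq_bigr do rewrite opprD opprK addrACA subrr add0r -mulr2n.
  by rewrite prodr_const card_ord.
by move=> i; lra.
Qed.

Lemma continuous_sup_norm_dist : continuous (fun p : E * E => `|p.1 - p.2|).
Proof.
move=> p; apply: continuous_comp; last exact: norm_continuous.
by apply: cvgB; [exact: cvg_fst|exact: cvg_snd].
Qed.

Lemma measurable_sup_norm_dist : measurable_fun setT (fun p : E * E => `|p.1 - p.2|).
Proof. exact: continuous_measurable_fun2 continuous_sup_norm_dist. Qed.

Lemma measurable_cube (x : E) (l : R) : measurable (cube x l).
Proof.
have m : measurable_fun setT (fun y : E => `|x - y|).
  exact: (measurableT_comp measurable_sup_norm_dist (pair1_measurable x)).
have := m measurableT `]-oo, l]%classic (measurable_itv _).
rewrite setTI; congr measurable; apply/seteqP; split=> y /=; by rewrite in_itv.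
Qed.

Lemma L2_cube (x : E) (l : R) : 0 <= l -> L2 (fun y : E => (\1_(cube x l) y)%:C%C).
Proof.
move=> l0; split.
  by apply: cmeasurable_real; apply: measurable_indic; exact: measurable_cube.
rewrite (eq_integral (EFin \o \1_(cube x l))); last first.
  by move=> y _; rewrite normc_real/= indicE; case: (_ \in _);
    rewrite ?normr1 ?normr0 ?expr1n ?expr0n.
rewrite integral_indic//; last exact: measurable_cube.
by rewrite setIT [X in (X < _)%E]lebesgue_cube// ltry.
Qed.

End cubes.

Section hermitian_kernel.
Variables (R : realType) (d : nat).
Local Notation E := 'rV[R]_d.
Local Notation leb := (lebesgue_rV R d).
Local Notation normc := Normc.normc.
Implicit Types (K : E -> E -> R[i]).

Lemma kernel_norm_le alpha K (N : R) : (kernel_norm alpha K <= N%:E)%E ->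
  (forall x, \int[leb]_y (normc (K x y) * japanese (x - y) `^ alpha)%:E <= N%:E)%E /\
  (forall y, \int[leb]_x (normc (K x y) * japanese (x - y) `^ alpha)%:E <= N%:E)%E.
Proof.
rewrite /kernel_norm ge_max => /andP[h1 h2].
split=> x; [apply: le_trans h2|apply: le_trans h1]; apply: ereal_sup_ubound;
  by exists x.
Qed.

Lemma in_C1_kernel_norm alpha T K : in_C1 alpha T K ->
  exists2 N : R, 0 < N & (kernel_norm alpha K <= N%:E)%E.
Proof.
move=> [_ _ _ _]; case: (kernel_norm alpha K) => [r _|//|_].
- by exists (`|r| + 1); [rewrite ltr_wpDl|rewrite lee_fin; have := ler_norm r; lra].
- by exists 1 => //; exact: leNye.
Qed.

Lemma in_C1_kernel_bound alpha T K : 0 <= alpha -> in_C1 alpha T K ->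
  exists2 A : R, 0 < A & kernel_bound K A.
Proof.
move=> a0 KC; have [N N0 /kernel_norm_le[h1 h2]] := in_C1_kernel_norm KC.
exists N => //; have [_ _ [mK _] _ _] := KC.
have le_weight x y : normc (K x y) <= normc (K x y) * japanese (x - y) `^ alpha.
  rewrite ler_peMr ?normc_ge0//.
  have j1 : 1 <= japanese (x - y).
    by rewrite /japanese -[leLHS]sqrtr1 ler_wsqrtr// lerDl sqr_ge0.
  by rewrite -(powRr0 (japanese (x - y))) ler_powR.
split => // x; [apply: le_trans (h1 x)|apply: le_trans (h2 x)];
  by apply: ge0_le_integralT => y; rewrite lee_fin ?normc_ge0.
Qed.

Lemma continuous_off_diagonal_near K x y (e : R) : continuous_off_diagonal K ->
  x != y -> 0 < e -> exists2 l : R, 0 < l & forall x' y', `|x - x'| <= l ->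
    `|y - y'| <= l -> normc (K x' y' - K x y) < e.
Proof.
move=> cK xy e0; have := cK x y xy.
move=> /cvgr_dist_lt /(_ e%:C%C); rewrite ltcR => /(_ e0).
move=> /nbhs_ballP[l /= l0 hl]; exists (l / 2); first by rewrite divr_gt0.
move=> x' y' xx' yy'; have := hl (x', y').
rewrite -normcN opprB.
rewrite /ball/= /prod_ball/= -!ball_normE/=.
have ll : l / 2 < l by rewrite ltr_pdivrMr//; lra.
move=> /(_ (conj (le_lt_trans xx' ll) (le_lt_trans yy' ll))).
by rewrite normc_def ltcR; case: (_ - _).
Qed.

(* The operator with kernel [D = adjoint_kernel K - K] annihilates indicators of cubes,
   so a nonzero value of [D] at a point of continuity would contradict
   [int_cube D(x, y) dy = 0]. *)
Lemma kernel_hermitian H K : in_C1 0 H K -> self_adjoint H ->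
  forall x y, x != y -> K y x = conjc (K x y).
Proof.
move=> KC Hsa; have [A A0 KA] := in_C1_kernel_bound (lexx 0) KC.
have KA' := adjoint_kernel_bound KA.
have [[HL _ _ _] HK _ cK _] := KC.
have [mK _ _] := KA; have [mK' _ _] := KA'.
have opL f : L2 f -> L2 (integral_op K f) by move=> /(L2_integral_op A0 KA)[].
have opL' f : L2 f -> L2 (integral_op (adjoint_kernel K) f).
  by move=> /(L2_integral_op A0 KA')[].
have op_eq g : L2 g -> eqL2 (integral_op (adjoint_kernel K) g) (integral_op K g).
  move=> gL; apply/eqL2P; [exact: opL'|exact: opL|].
  set h := (fun x => _); have hL : L2 h by apply: L2B; [exact: opL'|exact: opL].
  suff : L2inner h h = 0 by rewrite L2inner_self// => -[].
  have e : L2inner h (integral_op (adjoint_kernel K) g) = L2inner h (integral_op K g).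
    rewrite -(integral_op_adjoint A0 KA)//.
    have <- : L2inner (H h) g = L2inner (integral_op K h) g.
      by apply: L2inner_eqL2 => //; [exact: HL|exact: opL|exact: HK|exact: eqL2_refl].
    rewrite Hsa//.
    by apply: L2inner_eqL2 => //; [exact: HL|exact: opL|exact: eqL2_refl|exact: HK].
  have := L2inner_comb (-1) (opL g gL) (opL' g gL) hL.
  have -> : (fun x => -1 * integral_op K g x + integral_op (adjoint_kernel K) g x) = h.
    by apply/funext => x; rewrite /h; ring.
  by move=> ->; rewrite e; ring.
move=> x0 y0 xy.
pose D x y := adjoint_kernel K x y - K x y.
suff : D x0 y0 = 0.
  by move=> /eqP; rewrite subr_eq0 => /eqP <-; rewrite /adjoint_kernel conjcK.
apply: contrapT => /eqP D0.
pose w := D x0 y0.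
have w0 : 0 < normc w.
  rewrite lt_neqAle normc_ge0 andbT eq_sym; apply: contra D0 => /eqP.
  by move=> /Normc.eq0_normc; rewrite /w => ->.
have [l1 l10 h1] := continuous_off_diagonal_near (e := normc w / 4) cK xy ltac:(lra).
have yx : y0 != x0 by rewrite eq_sym.
have [l2 l20 h2] := continuous_off_diagonal_near (e := normc w / 4) cK yx ltac:(lra).
pose l := Num.min l1 l2.
have l0 : 0 < l by rewrite lt_min l10.
have hl x y : cube x0 l x -> cube y0 l y ->
    normc w ^+ 2 / 2 <= complex.Re (conjc w * D x y).
  rewrite /cube /= !le_min => /andP[x1 x2] /andP[y1 y2].
  have k1 := h1 _ _ x1 y1; have k2 := h2 _ _ y2 x2.
  have k : normc (D x y - w) <= normc w / 2.
    have -> : D x y - w = conjc (K y x - K y0 x0) - (K x y - K x0 y0).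
      by rewrite /w /D /adjoint_kernel conjcD conjcN; ring.
    by apply: le_trans (normcB _ _) _; rewrite normc_conjc; lra.
  have -> : conjc w * D x y = conjc w * w + conjc w * (D x y - w) by ring.
  rewrite ReD mul_conjc /=.
  have := normr_Re_le (conjc w * (D x y - w)).
  rewrite Normc.normcM normc_conjc ler_norml => /andP[k3 _].
  have : normc w * normc (D x y - w) <= normc w * (normc w / 2) by rewrite ler_pM2l.
  by rewrite expr2; lra.
pose g (y : E) : R[i] := (\1_(cube y0 l) y)%:C%C.
have gL : L2 g by exact: L2_cube (ltW l0).
have [mg _] := gL.
have [x [[x0x Dx] [Kx K'x]]] : exists x, (cube x0 l x /\
    integral_op (adjoint_kernel K) g x = integral_op K g x) /\
    (abs_integral K g x < +oo)%E /\ (abs_integral (adjoint_kernel K) g x < +oo)%E.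
  apply: contrapT => hn.
  have : {ae leb, forall x, ~ cube x0 l x}.
    apply: filterS3 (op_eq g gL) (ae_abs_integral_lty A0 KA gL)
      (ae_abs_integral_lty A0 KA' gL) => x e1 e2 e3 e4.
    by apply: hn; exists x.
  move=> [N [mN N0 hN]].
  have : (leb (cube x0 l) <= leb N)%E.
    apply: le_measure; rewrite ?inE//; first exact: measurable_cube.
    by move=> x hx; apply: hN => /=; apply.
  rewrite N0 lebesgue_cube ?(ltW l0)// lee_fin leNgt exprn_gt0//.
  by rewrite pmulrn_lgt0.
have i1 := cintegrable_section KA mg Kx.
have i2 := cintegrable_section KA' mg K'x.
have mD : cmeasurable (fun y => conjc w * (D x y * g y)).
  apply: cmeasurableM; first exact: cmeasurable_cst.
  apply: cmeasurableM => //; apply: cmeasurableB.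
    exact: (cmeasurable_comp (pair1_measurable x) mK').
  exact: (cmeasurable_comp (pair1_measurable x) mK).
have iD : cintegrable leb (fun y => D x y * g y).
  have := cintegrable_comb (-1) i1 i2; congr cintegrable.
  by apply/funext => y; rewrite /D; ring.
have zero : cintegral leb (fun y => conjc w * (D x y * g y)) = 0.
  rewrite cintegralZ//.
  have -> : (fun y => D x y * g y) =
      (fun y => -1 * (K x y * g y) + adjoint_kernel K x y * g y).
    by apply/funext => y; rewrite /D; ring.
  rewrite cintegral_comb//.
  change (conjc w * (-1 * integral_op K g x + integral_op (adjoint_kernel K) g x) = 0).
  by rewrite Dx; ring.
have iwD : cintegrable leb (fun y => conjc w * (D x y * g y)).
  have := cintegrable_comb (conjc w) iD (cintegrable0 leb); congr cintegrable.
  by apply/funext => y; ring.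
have : (\int[leb]_y ((normc w ^+ 2 / 2) * \1_(cube y0 l) y)%:E <=
    \int[leb]_y (complex.Re (conjc w * (D x y * g y)))%:E)%E.
  apply: ge0_le_integralT => y.
    by rewrite lee_fin mulr_ge0// divr_ge0// sqr_ge0.
  rewrite lee_fin /g indicE; case: (boolP (y \in _)) => [|_]; last first.
    by rewrite !mulr0.
  by rewrite inE => hy; rewrite !mulr1; exact: hl.
under eq_integral do rewrite EFinM.
rewrite ge0_integralZl_EFin//; last 2 first.
- by apply/measurable_EFinP; apply: measurable_indic; exact: measurable_cube.
- by rewrite divr_ge0// sqr_ge0.
rewrite integral_indic//; last exact: measurable_cube.
rewrite setIT [X in (_ * X)%E]lebesgue_cube ?(ltW l0)//.
have <- := fineK (integrable_fin_num measurableT (cintegrable_Re iwD)).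
have : complex.Re (cintegral leb (fun y => conjc w * (D x y * g y))) = 0 by rewrite zero.
rewrite /cintegral/= /Rintegral => ->; rewrite -EFinM lee_fin leNgt => /negP; apply.
apply: mulr_gt0; first by rewrite divr_gt0// exprn_gt0.
by rewrite exprn_gt0// pmulrn_lgt0.
Qed.

End hermitian_kernel.

(** * Magnetic phases and localization *)

Section phases.
Variable R : realType.
Local Notation normc := Normc.normc.

Definition phase (t : R) : R[i] := (cos t +i* sin t)%C.

Lemma phaseD s t : phase (s + t) = phase s * phase t.
Proof.
rewrite /phase sinD cosD; apply/eqP; rewrite eq_complex/=; apply/andP.
by split; apply/eqP; ring.
Qed.

Lemma conjc_phase t : conjc (phase t) = phase (- t).
Proof. by rewrite /phase cosN sinN. Qed.

Lemma phase0 : phase 0 = 1.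
Proof. by rewrite /phase cos0 sin0. Qed.

Lemma normc_phase t : normc (phase t) = 1.
Proof. by rewrite /phase /= cos2Dsin2 sqrtr1. Qed.

Lemma derivable_1_lipschitz (f df : R -> R) : (forall x : R, is_derive x (1 : R) f (df x)) ->
  continuous f -> (forall x, `|df x| <= 1) -> forall t, `|f t - f 0| <= `|t|.
Proof.
move=> fdf cf df1 t.
have aux a b : a <= b -> `|f b - f a| <= b - a.
  move=> ab; have [|c _ ->] := MVT_segment ab (fun x _ => fdf x).
    exact: continuous_subspaceT.
  by rewrite normrM (ger0_norm (_ : 0 <= b - a)) ?subr_ge0// ler_piMl// subr_ge0.
have [t0|t0] := leP 0 t; first by rewrite (le_trans (aux _ _ t0))// subr0 ger0_norm.
by rewrite distrC (le_trans (aux _ _ (ltW t0)))// sub0r ltr0_norm.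
Qed.

Lemma normc_phaseB1_le t : normc (phase t - 1) <= `|t| *+ 2.
Proof.
have c1 : `|cos t - 1| <= `|t|.
  rewrite -cos0; apply: (@derivable_1_lipschitz _ (fun x => - sin x)) => [x|]; last first.
    by move=> x; rewrite normrN ler_norml sin_geN1 sin_le1.
  exact: continuous_cos.
have s1 : `|sin t| <= `|t|.
  have := @derivable_1_lipschitz (@sin R) (@cos R) _ (@continuous_sin R) _ t.
  by rewrite sin0 subr0; apply => x; rewrite ler_norml cos_geN1 cos_le1.
apply: le_trans (normc_le_ReIm _) _.
by rewrite /phase ReD ReN /= subr0 mulr2n; exact: lerD.
Qed.

Lemma normc_phaseB1_le2 t : normc (phase t - 1) <= 2.
Proof. by apply: le_trans (normcB _ _) _; rewrite normc_phase Normc.normc1. Qed.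

End phases.

Section euclidean_norm.
Variables (R : realType) (d : nat).
Local Notation E := 'rV[R]_d.
Implicit Types x : E.

Lemma enorm_ge0 x : 0 <= enorm x.
Proof. exact: sqrtr_ge0. Qed.

Lemma sup_norm_le_enorm x : `|x| <= enorm x.
Proof.
apply/(rV_norm_leP _ (enorm_ge0 _)) => i.
rewrite -sqrtr_sqr ler_wsqrtr// (bigD1 i)//= lerDl.
by apply: sumr_ge0 => j _; exact: sqr_ge0.
Qed.

Lemma enorm_le_sup_norm x : enorm x <= d%:R * `|x|.
Proof.
rewrite -(ger0_norm (_ : 0 <= d%:R * `|x|)) ?mulr_ge0// -sqrtr_sqr ler_wsqrtr//.
apply: (@le_trans _ _ (\sum_(i < d) `|x| ^+ 2)).
  apply: ler_sum => i _; rewrite -[leLHS]real_normK ?num_real// ler_pXn2r ?nnegrE//.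
  by have /(rV_norm_leP _ (normr_ge0 x)) := lexx `|x|.
rewrite sumr_const card_ord -[leLHS]mulr_natl exprMn ler_wpM2r ?sqr_ge0//.
by rewrite -natrX ler_nat; case: (d) => // n; rewrite expnS leq_pmulr.
Qed.

Lemma japanese_ge1 x : 1 <= japanese x.
Proof. by rewrite /japanese -[leLHS]sqrtr1 ler_wsqrtr// lerDl sqr_ge0. Qed.

Lemma enorm_le_japanese x : enorm x <= japanese x.
Proof. by rewrite /japanese -[leLHS](ger0_norm (enorm_ge0 x)) -sqrtr_sqr ler_wsqrtr// lerDr. Qed.

Lemma measurable_enorm : measurable_fun setT (@enorm R d).
Proof.
apply: (@measurableT_comp _ _ _ _ _ _ (@Num.sqrt R)).
  by apply: continuous_measurable_fun; exact: sqrt_continuous.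
apply: measurable_sum => i; apply: measurable_funX; exact: measurable_coord.
Qed.

Lemma measurable_enormB : measurable_fun setT (fun p : E * E => enorm (p.1 - p.2)).
Proof.
apply: (measurableT_comp measurable_enorm); apply: measurable_fun_coordP => i.
rewrite (_ : (fun _ => _) = (fun p : E * E => p.1 ord0 i - p.2 ord0 i)).
  by apply: measurable_funB; apply: (measurableT_comp (measurable_coord i)).
by apply/funext => p; rewrite !mxE.
Qed.

Lemma measurable_japaneseB : measurable_fun setT (fun p : E * E => japanese (p.1 - p.2)).
Proof.
apply: (@measurableT_comp _ _ _ _ _ _ (@Num.sqrt R)).
  by apply: continuous_measurable_fun; exact: sqrt_continuous.
apply: measurable_funD => //; apply: measurable_funX; exact: measurable_enormB.
Qed.

End euclidean_norm.

Section magnetic_kernels.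
Variables (R : realType) (d : nat).
Local Notation E := 'rV[R]_d.
Local Notation normc := Normc.normc.
Variables (phi : E -> E -> R) (K : E -> E -> R[i]).
Hypothesis phi_continuous : continuous (fun p : E * E => phi p.1 p.2).

Lemma magnetic_kernelE b x y : magnetic_kernel phi b K x y = phase (b * phi x y) * K x y.
Proof. by []. Qed.

Lemma normc_magnetic_kernel b x y : normc (magnetic_kernel phi b K x y) = normc (K x y).
Proof. by rewrite magnetic_kernelE Normc.normcM normc_phase mul1r. Qed.

Lemma magnetic_kernel0 : magnetic_kernel phi 0 K = K.
Proof.
by apply/funext => x; apply/funext => y; rewrite magnetic_kernelE mul0r phase0 mul1r.
Qed.

Lemma cmeasurable_phase disp (T : measurableType disp) (f : T -> R) :
  measurable_fun setT f -> cmeasurable (fun t => phase (f t)).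
Proof.
move=> mf; split => /=.
  apply: (@measurableT_comp _ _ _ _ _ _ (@cos R)) => //.
  by apply: continuous_measurable_fun; exact: continuous_cos.
apply: (@measurableT_comp _ _ _ _ _ _ (@sin R)) => //.
by apply: continuous_measurable_fun; exact: continuous_sin.
Qed.

Lemma magnetic_kernel_bound b A : kernel_bound K A ->
  kernel_bound (magnetic_kernel phi b K) A.
Proof.
move=> [mK K1 K2]; split.
- apply: cmeasurableM => //.
  apply: (@cmeasurable_phase _ _ (fun p : E * E => b * phi p.1 p.2)).
  by apply: measurable_funM => //; exact: continuous_measurable_fun2.
- by move=> x; under eq_integral do rewrite normc_magnetic_kernel.
- by move=> y; under eq_integral do rewrite normc_magnetic_kernel.
Qed.

Lemma magnetic_kernel_hermitian b : (forall x y, phi x y = - phi y x) ->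
  (forall x y, x != y -> K y x = conjc (K x y)) ->
  forall x y, x != y -> magnetic_kernel phi b K y x = conjc (magnetic_kernel phi b K x y).
Proof.
move=> phiN K_herm x y xy.
by rewrite !magnetic_kernelE conjcM conjc_phase (K_herm x y xy) phiN mulrN.
Qed.

End magnetic_kernels.

Section localization.
Variables (R : realType) (d : nat).
Local Notation E := 'rV[R]_d.
Local Notation leb := (lebesgue_rV R d).
Local Notation normc := Normc.normc.
Variable theta : R.
Hypothesis theta0 : 0 < theta.

Definition tent (x g : E) : R := Num.max 0 (1 - theta * `|x - g|).

Definition near_ind (x g : E) : R := \1_(`]-oo, 1]%classic : set R) (theta * `|x - g|).

Definition truncated_dist (x y : E) : R := Num.min 1 (theta * enorm (x - y)).

Lemma tent_ge0 x g : 0 <= tent x g.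
Proof. by rewrite /tent le_max lexx. Qed.

Lemma tent_le1 x g : tent x g <= 1.
Proof. by rewrite /tent ge_max ler01 /= gerBl mulr_ge0// ltW. Qed.

Lemma near_ind_ge0 x g : 0 <= near_ind x g.
Proof. by []. Qed.

Lemma near_indE x g : near_ind x g = \1_(cube x theta^-1) g.
Proof.
rewrite /near_ind !indicE; congr (nat_of_bool _)%:R; apply/idP/idP; rewrite !inE /cube /= in_itv/=;
  by rewrite mulrC -ler_pdivlMr// div1r.
Qed.

Lemma tent_far x g : near_ind x g = 0 -> tent x g = 0.
Proof.
rewrite /near_ind indicE; case: (boolP (_ \in _)) => [_ /eqP|]; first by rewrite oner_eq0.
rewrite notin_setE /= in_itv/= => /negP; rewrite -ltNge => h _.
by rewrite /tent max_l// subr_le0 ltW.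
Qed.

Lemma near_ind01 x g : near_ind x g = 0 \/ near_ind x g = 1.
Proof. by rewrite /near_ind indicE; case: (_ \in _); [right|left]. Qed.

Lemma tent_lipschitz x y g : `|tent y g - tent x g| <= truncated_dist x y.
Proof.
rewrite /truncated_dist le_min; apply/andP; split.
  have := tent_ge0 x g; have := tent_ge0 y g; have := tent_le1 x g; have := tent_le1 y g.
  by move=> ? ? ? ?; rewrite ler_norml; apply/andP; split; lra.
apply: (@le_trans _ _ (theta * `|x - y|)); last first.
  by rewrite ler_pM2l//; exact: sup_norm_le_enorm.
have h1 : `|x - g| <= `|x - y| + `|y - g| by rewrite -{1}(subrKA y) ler_normD.
have h2 : `|y - g| <= `|x - y| + `|x - g|.
  by rewrite (distrC x y) -{1}(subrKA x) ler_normD.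
have h3 : theta * `|x - g| <= theta * `|x - y| + theta * `|y - g|.
  by rewrite -mulrDr ler_pM2l.
have h4 : theta * `|y - g| <= theta * `|x - y| + theta * `|x - g|.
  by rewrite -mulrDr ler_pM2l.
rewrite /tent ler_norml; have h5 : 0 <= theta * `|x - y| by rewrite mulr_ge0// ltW.
by rewrite !maxEle; case: ifPn => c1; case: ifPn => c2;
  rewrite -?ltNge in c1 c2; apply/andP; split; lra.
Qed.

Lemma measurable_tent : measurable_fun setT (fun p : E * E => tent p.1 p.2).
Proof.
apply: measurable_maxr => //; apply: measurable_funB => //.
by apply: measurable_funM => //; exact: measurable_sup_norm_dist.
Qed.

Lemma measurable_near_ind : measurable_fun setT (fun p : E * E => near_ind p.1 p.2).
Proof.
apply: (@measurableT_comp _ _ _ _ _ _ (\1_(`]-oo, 1]%classic : set R) : R -> R)).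
  exact: measurable_indic.
by apply: measurable_funM => //; exact: measurable_sup_norm_dist.
Qed.

Lemma measurable_truncated_dist :
  measurable_fun setT (fun p : E * E => truncated_dist p.1 p.2).
Proof.
apply: measurable_minr => //; apply: measurable_funM => //; exact: measurable_enormB.
Qed.

Lemma truncated_dist_ge0 x y : 0 <= truncated_dist x y.
Proof. by rewrite /truncated_dist le_min ler01 mulr_ge0 ?enorm_ge0// ltW. Qed.

Lemma integral_near_ind x :
  (\int[leb]_g (near_ind x g)%:E = ((theta^-1 *+ 2) ^+ d)%:E)%E.
Proof.
under eq_integral do rewrite near_indE.
rewrite integral_indic//; last exact: measurable_cube.
by rewrite setIT [LHS]lebesgue_cube// invr_ge0 ltW.
Qed.

Lemma integral_sqr_tent_le x :
  (\int[leb]_g (tent x g ^+ 2)%:E <= ((theta^-1 *+ 2) ^+ d)%:E)%E.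
Proof.
rewrite -(integral_near_ind x); apply: ge0_le_integralT => g; rewrite lee_fin ?sqr_ge0//.
have [/tent_far ->|->] := near_ind01 x g; first by rewrite expr0n near_ind_ge0.
by rewrite expr_le1// ?tent_le1// tent_ge0.
Qed.

Lemma integral_sqr_tent_ge x :
  ((theta^-1 ^+ d / 4)%:E <= \int[leb]_g (tent x g ^+ 2)%:E)%E.
Proof.
have t2 : 0 <= theta^-1 / 2 by rewrite divr_ge0// invr_ge0 ltW.
apply: (@le_trans _ _ (\int[leb]_g ((1 / 4) * \1_(cube x (theta^-1 / 2)) g)%:E)%E).
  under eq_integral do rewrite EFinM.
  rewrite ge0_integralZl_EFin//; last first.
    by apply/measurable_EFinP; apply: measurable_indic; exact: measurable_cube.
  rewrite integral_indic//; last exact: measurable_cube.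
  rewrite setIT [X in (_ <= _ * X)%E]lebesgue_cube// -EFinM lee_fin.
  have -> : theta^-1 / 2 *+ 2 = theta^-1 by field; exact: lt0r_neq0.
  by rewrite mulrC div1r.
apply: ge0_le_integralT => g; first by rewrite lee_fin mulr_ge0.
rewrite lee_fin indicE; case: (boolP (_ \in _)) => [|_]; last by rewrite mulr0 sqr_ge0.
rewrite inE /cube /= => h.
have h1 : theta * `|x - g| <= 1 / 2.
  rewrite -ler_pdivlMl//; apply: le_trans h _; rewrite le_eqVlt; apply/orP; left.
  by apply/eqP; field; exact: lt0r_neq0.
have h2 : 1 / 2 <= tent x g by rewrite /tent le_max; apply/orP; right; lra.
have : (1 / 2) ^+ 2 <= tent x g ^+ 2 by rewrite ler_pXn2r ?nnegrE ?tent_ge0.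
by rewrite mulr1 expr2; lra.
Qed.

Variable phi : E -> E -> R.
Hypothesis phi_flux : forall x y x', `|phi x y + phi y x' - phi x x'|
  <= enorm (x - y) * enorm (y - x').

(* On the support of the tent function at [g] the flux phase is at most
   [theta ^ 2 |x - y| |y - g| = O(theta |x - y|)]. *)
Lemma localization_error (delta : R) (x y g : E) : `|delta| = theta ^+ 2 ->
  normc (phase (delta * (phi x y + phi y g - phi x g)) * (tent y g)%:C%C
         - (tent x g)%:C%C) <=
  (3 + d%:R *+ 2) * (truncated_dist x y * (near_ind x g + near_ind y g)).
Proof.
move=> delta2; set F := phi x y + _ - _.
have q0 := truncated_dist_ge0 x y; have := near_ind_ge0 x g; have := near_ind_ge0 y g.
have dge0 : 0 <= d%:R :> R by [].
have c0 : 0 <= 3 + d%:R *+ 2 :> R by lra.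
have [y0|y1] := near_ind01 y g.
  rewrite y0 (tent_far y0) mulr0 sub0r normcN normc_real.
  have [x0|x1] := near_ind01 x g.
    by rewrite x0 (tent_far x0) normr0 addr0 !mulr0.
  have := tent_lipschitz x y g; rewrite (tent_far y0) sub0r normrN x1 addr0 mulr1 => h _ _.
  by apply: le_trans h _; rewrite ler_peMl//; lra.
move=> _ x0; rewrite y1.
have -> : phase (delta * F) * (tent y g)%:C%C - (tent x g)%:C%C =
    (tent y g)%:C%C * (phase (delta * F) - 1) + (tent y g - tent x g)%:C%C.
  by rewrite (rmorphB (real_complex R)); ring.
apply: le_trans (le_normcD _ _) _.
rewrite Normc.normcM !normc_real (ger0_norm (tent_ge0 _ _)).
have h1 := tent_lipschitz x y g.
have h2 : normc (phase (delta * F) - 1) <= (2 + d%:R *+ 2) * truncated_dist x y.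
  rewrite /truncated_dist; case: (lerP 1 (theta * enorm (x - y))) => h.
    rewrite mulr1; apply: le_trans (normc_phaseB1_le2 _) _; lra.
  apply: (@le_trans _ _ ((d%:R * (theta * enorm (x - y))) *+ 2)); last first.
    have : 0 <= theta * enorm (x - y) by rewrite mulr_ge0 ?enorm_ge0// ltW.
    by rewrite -mulr_natl; lra.
  apply: le_trans (normc_phaseB1_le _) _; rewrite ler_pMn2r//.
  rewrite normrM delta2; apply: (@le_trans _ _ (theta ^+ 2 * (enorm (x - y) * enorm (y - g)))).
    by rewrite ler_wpM2l ?sqr_ge0//; exact: phi_flux.
  have yg : theta * `|y - g| <= 1.
    move: y1; rewrite /near_ind indicE; case: (boolP (_ \in _)) => [|_ /eqP].
      by rewrite inE /= in_itv.
    by rewrite eq_sym oner_eq0.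
  have e1 : theta * enorm (y - g) <= d%:R.
    apply: (@le_trans _ _ (theta * (d%:R * `|y - g|))).
      by rewrite ler_pM2l// enorm_le_sup_norm.
    by rewrite mulrCA ler_piMr.
  have : (theta * enorm (x - y)) * (theta * enorm (y - g)) <= (theta * enorm (x - y)) * d%:R.
    by rewrite ler_wpM2l// mulr_ge0 ?enorm_ge0// ltW.
  by rewrite expr2; lra.
have h3 : tent y g * normc (phase (delta * F) - 1) <= (2 + d%:R *+ 2) * truncated_dist x y.
  by apply: le_trans h2; rewrite ler_piMl ?normc_ge0 ?tent_le1.
have h4 : (3 + d%:R *+ 2) * truncated_dist x y <=
    (3 + d%:R *+ 2) * (truncated_dist x y * (near_ind x g + 1)).
  by rewrite ler_wpM2l// ler_peMr//; lra.
by apply: le_trans h4; lra.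
Qed.

End localization.

Section localized_quasimodes.
Variables (R : realType) (d : nat).
Local Notation E := 'rV[R]_d.
Local Notation leb := (lebesgue_rV R d).
Local Notation normc := Normc.normc.
Variables (theta : R) (phi : E -> E -> R) (K : E -> E -> R[i]) (A A1 delta : R).
Hypothesis theta0 : 0 < theta.
Hypothesis phi_continuous : continuous (fun p : E * E => phi p.1 p.2).
Hypothesis phi_flux : forall x y x', `|phi x y + phi y x' - phi x x'|
  <= enorm (x - y) * enorm (y - x').
Hypotheses (A0 : 0 < A) (KA : kernel_bound K A) (A10 : 0 < A1).
Local Notation q := (truncated_dist theta).
Hypothesis KA1 : forall x, (\int[leb]_y (normc (K x y) * q x y)%:E <= A1%:E)%E.
Hypothesis KA1' : forall y, (\int[leb]_x (normc (K x y) * q x y)%:E <= A1%:E)%E.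
Hypothesis delta_theta : `|delta| = theta ^+ 2.
Local Notation tent := (tent theta).
Local Notation near_ind := (near_ind theta).

Lemma tent_average_le (u : E -> R) : measurable_fun setT u -> (forall x, 0 <= u x) ->
  (\int[leb]_g \int[leb]_x (tent x g ^+ 2 * u x)%:E <=
   ((theta^-1 *+ 2) ^+ d)%:E * \int[leb]_x (u x)%:E)%E.
Proof.
move=> mu_ u0.
have mF : measurable_fun setT (fun p : E * E => (tent p.2 p.1 ^+ 2 * u p.2)%:E).
  apply/measurable_EFinP; apply: measurable_funM; last exact: measurableT_comp.
  apply: measurable_funX.
  exact: (measurableT_comp (measurable_tent theta) (@measurable_swap _ _ _ _)).
rewrite (@fubini_tonelli _ _ _ _ _ leb leb _ mF) => [|p]; last first.
  by rewrite lee_fin mulr_ge0// sqr_ge0.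
rewrite -ge0_integralZl_EFin//; last 3 first.
- by move=> x _; rewrite lee_fin.
- exact/measurable_EFinP.
- by rewrite exprn_ge0// mulrn_wge0// invr_ge0 ltW.
apply: ge0_le_integralT => x.
  by apply: integral_ge0 => g _; rewrite lee_fin mulr_ge0// sqr_ge0.
under eq_integral do rewrite /= mulrC EFinM.
rewrite ge0_integralZl_EFin//; last 2 first.
- by move=> g _; rewrite lee_fin sqr_ge0.
- apply/measurable_EFinP; apply: measurable_funX.
  exact: (measurableT_comp (measurable_tent theta) (pair1_measurable x)).
by rewrite muleC lee_wpmul2r ?lee_fin//; exact: integral_sqr_tent_le.
Qed.

Lemma tent_average_ge (u : E -> R) : measurable_fun setT u -> (forall x, 0 <= u x) ->
  ((theta^-1 ^+ d / 4)%:E * \int[leb]_x (u x)%:E <=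
   \int[leb]_g \int[leb]_x (tent x g ^+ 2 * u x)%:E)%E.
Proof.
move=> mu_ u0.
have mF : measurable_fun setT (fun p : E * E => (tent p.2 p.1 ^+ 2 * u p.2)%:E).
  apply/measurable_EFinP; apply: measurable_funM; last exact: measurableT_comp.
  apply: measurable_funX.
  exact: (measurableT_comp (measurable_tent theta) (@measurable_swap _ _ _ _)).
rewrite (@fubini_tonelli _ _ _ _ _ leb leb _ mF) => [|p]; last first.
  by rewrite lee_fin mulr_ge0// sqr_ge0.
have t0 : 0 <= theta^-1 ^+ d / 4 by rewrite divr_ge0// exprn_ge0// invr_ge0 ltW.
rewrite -ge0_integralZl_EFin//; last 2 first.
- by move=> x _; rewrite lee_fin.
- exact/measurable_EFinP.
apply: ge0_le_integralT => x; first by rewrite -EFinM lee_fin mulr_ge0.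
under eq_integral do rewrite /= mulrC EFinM.
rewrite ge0_integralZl_EFin//; last 2 first.
- by move=> g _; rewrite lee_fin sqr_ge0.
- apply/measurable_EFinP; apply: measurable_funX.
  exact: (measurableT_comp (measurable_tent theta) (pair1_measurable x)).
by rewrite [leRHS]muleC lee_wpmul2r ?lee_fin//; exact: integral_sqr_tent_ge.
Qed.

Definition near_weight (p : (E * E) * E) : R := near_ind p.1.1 p.2 + near_ind p.1.2 p.2.

Lemma near_weight_ge0 p : 0 <= near_weight p.
Proof. by rewrite addr_ge0// near_ind_ge0. Qed.

Lemma measurable_near_weight : measurable_fun setT near_weight.
Proof.
apply: measurable_funD.
  apply: (measurableT_comp (measurable_near_ind theta)
    (g := fun p : (E * E) * E => (p.1.1, p.2))).
  by apply: measurable_fun_pair => //; exact: measurableT_comp.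
apply: (measurableT_comp (measurable_near_ind theta)
  (g := fun p : (E * E) * E => (p.1.2, p.2))).
by apply: measurable_fun_pair => //; exact: measurableT_comp.
Qed.

Lemma integral_sqr_near_weight p :
  (\int[leb]_g (near_weight (p, g) ^+ 2)%:E <= (4 * (theta^-1 *+ 2) ^+ d)%:E)%E.
Proof.
have m x : measurable_fun setT (fun g => (near_ind x g)%:E).
  apply/measurable_EFinP.
  exact: (measurableT_comp (measurable_near_ind theta) (pair1_measurable x)).
apply: (@le_trans _ _ (\int[leb]_g (2%:E * ((near_ind p.1 g)%:E + (near_ind p.2 g)%:E)))%E).
  apply: ge0_le_integralT => g; first by rewrite lee_fin sqr_ge0.
  rewrite -EFinD -EFinM lee_fin /near_weight /=.
  by have [->|->] := near_ind01 theta p.1 g; have [->|->] := near_ind01 theta p.2 g;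
    rewrite expr2; lra.
rewrite ge0_integralZl_EFin//; last 2 first.
- by move=> g _; rewrite -EFinD lee_fin addr_ge0// near_ind_ge0.
- by apply: emeasurable_funD; exact: m.
rewrite ge0_integralD//; last 4 first.
- by move=> g _; rewrite lee_fin near_ind_ge0.
- exact: m.
- by move=> g _; rewrite lee_fin near_ind_ge0.
- exact: m.
by rewrite !integral_near_ind// -EFinD -EFinM lee_fin; lra.
Qed.

Variables (b : R) (z : R[i]) (f : E -> R[i]).
Hypothesis fL : L2 f.
Let mf : cmeasurable f. Proof. by case: fL. Qed.

Local Notation Tb := (integral_op (magnetic_kernel phi b K)).
Local Notation Tb' := (integral_op (magnetic_kernel phi (b + delta) K)).

Definition quasimode (g : E) (x : E) : R[i] :=
  phase (delta * phi x g) * (tent x g)%:C%C * f x.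

Definition defect (x : E) : R[i] := Tb f x - z * f x.

Definition error_integral (g x : E) :=
  (\int[leb]_y (normc (K x y) * q x y * (near_weight (x, y, g) * normc (f y)))%:E)%E.

Lemma error_integral_ge0 g x : (0 <= error_integral g x)%E.
Proof.
apply: integral_ge0 => y _; rewrite lee_fin mulr_ge0// mulr_ge0 ?normc_ge0//.
  exact: truncated_dist_ge0.
exact: near_weight_ge0.
Qed.

Lemma normc_quasimode g x : normc (quasimode g x) = tent x g * normc (f x).
Proof.
by rewrite /quasimode !Normc.normcM normc_phase mul1r normc_real ger0_norm// tent_ge0.
Qed.

Lemma cmeasurable_quasimode g : cmeasurable (quasimode g).
Proof.
apply: cmeasurableM => //; apply: cmeasurableM.
  apply: cmeasurable_phase; apply: measurable_funM => //.
  exact: (measurableT_comp (continuous_measurable_fun2 phi_continuous) (pair2_measurable g)).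
apply: cmeasurable_real.
exact: (measurableT_comp (measurable_tent theta) (pair2_measurable g)).
Qed.

Lemma L2_quasimode g : L2 (quasimode g).
Proof.
have [] // := @L2_dominated _ _ (quasimode g) f 1 (cmeasurable_quasimode g) fL ler01.
by move=> x; rewrite mul1r normc_quasimode ler_piMl ?normc_ge0 ?tent_le1.
Qed.

Local Notation c0 := (3 + d%:R *+ 2 : R).

Lemma quasimode_defect_le g x : (abs_integral K f x < +oo)%E ->
  ((normc (Tb' (quasimode g) x - z * quasimode g x))%:E <=
   (tent x g * normc (defect x))%:E + c0%:E * error_integral g x)%E.
Proof.
move=> fx; have mg := cmeasurable_quasimode g.
have c00 : 0 <= c0 by rewrite addr_ge0// mulrn_wge0.
have Kb := magnetic_kernel_bound phi_continuous b KA.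
have Kb' := magnetic_kernel_bound phi_continuous (b + delta) KA.
have abs_fin b1 (u : E -> R[i]) : (forall y, normc (u y) <= normc (f y)) ->
    (abs_integral (magnetic_kernel phi b1 K) u x < +oo)%E.
  move=> uf; apply: le_lt_trans fx; apply: ge0_le_integralT => y.
    by rewrite lee_fin mulr_ge0 ?normc_ge0.
  by rewrite lee_fin normc_magnetic_kernel ler_wpM2l ?normc_ge0.
have i1 := cintegrable_section Kb mf (abs_fin b f (fun=> lexx _)).
have i2 : cintegrable leb (fun y => magnetic_kernel phi (b + delta) K x y * quasimode g y).
  apply: (cintegrable_section Kb' mg); apply: abs_fin => y.
  by rewrite normc_quasimode ler_piMl ?normc_ge0 ?tent_le1.
pose c := phase (delta * phi x g) * (tent x g)%:C%C.
pose D y := - c * (magnetic_kernel phi b K x y * f y) +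
  magnetic_kernel phi (b + delta) K x y * quasimode g y.
have DE : Tb' (quasimode g) x - z * quasimode g x = c * defect x + cintegral leb D.
  rewrite /D cintegral_comb// -/(Tb f x) -/(Tb' (quasimode g) x) /defect.
  by rewrite /quasimode -/c; ring.
have D_le y : normc (D y) <=
    c0 * (normc (K x y) * q x y * (near_weight (x, y, g) * normc (f y))).
  have -> : D y = phase (delta * phi x g) * (magnetic_kernel phi b K x y * f y) *
      (phase (delta * (phi x y + phi y g - phi x g)) * (tent y g)%:C%C - (tent x g)%:C%C).
    rewrite /D /c /quasimode !magnetic_kernelE mulrDl phaseD.
    have -> : phase (delta * (phi x y + phi y g - phi x g)) =
        phase (delta * phi x y) * phase (delta * phi y g) * phase (- (delta * phi x g)).
      by rewrite -!phaseD; congr phase; ring.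
    have e : phase (delta * phi x g) * phase (- (delta * phi x g)) = 1.
      by rewrite -phaseD subrr phase0.
    set P := phase (delta * phi x g) in e *; set N := phase (- _) in e *.
    have -> : forall u v w s t r : R[i], P * (u * v * w) * (s * t * N * r - (tent x g)%:C%C) =
      - (P * (tent x g)%:C%C) * (u * v * w) + (P * N) * (u * s * v * (t * r * w)) by move=> *; ring.
    by rewrite e; ring.
  rewrite Normc.normcM (Normc.normcM (phase _)) (Normc.normcM (magnetic_kernel _ _ _ _ _)).
  rewrite normc_phase mul1r normc_magnetic_kernel.
  have := localization_error theta0 phi_flux x y g delta_theta.
  move=> /(ler_wpM2l (mulr_ge0 (normc_ge0 (K x y)) (normc_ge0 (f y)))).
  by move/le_trans; apply; rewrite /near_weight /= le_eqVlt; apply/orP; left; apply/eqP; ring.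
have mD : cmeasurable D.
  have [m1 _] := i1; have [m2 _] := i2.
  by apply: cmeasurableD => //; apply: cmeasurableM => //; exact: cmeasurable_cst.
rewrite DE; apply: (@le_trans _ _ ((normc (c * defect x))%:E + (normc (cintegral leb D))%:E)%E).
  by rewrite -EFinD lee_fin le_normcD.
apply: leeD.
  by rewrite /c !Normc.normcM normc_phase mul1r normc_real ger0_norm ?tent_ge0.
apply: le_trans (le_normc_cintegral leb mD) _.
rewrite /error_integral -ge0_integralZl_EFin//; last 2 first.
- move=> y _; rewrite lee_fin mulr_ge0// mulr_ge0 ?normc_ge0//.
    exact: truncated_dist_ge0.
  exact: near_weight_ge0.
- apply/measurable_EFinP; apply: measurable_funM.
    apply: measurable_funM.
      have [mK _ _] := KA; apply: measurable_normc.
      exact: (cmeasurable_comp (pair1_measurable x) mK).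
    exact: (measurableT_comp (measurable_truncated_dist theta) (pair1_measurable x)).
  apply: measurable_funM; last exact: measurable_normc.
  apply: (measurableT_comp measurable_near_weight (g := fun y => (x, y, g))).
  by apply: measurable_fun_pair => //; exact: pair1_measurable.
by apply: ge0_le_integralT => y; rewrite ?lee_fin ?normc_ge0// -EFinM lee_fin.
Qed.

Lemma sqr_quasimode_defect_le g x : (abs_integral K f x < +oo)%E ->
  ((normc (Tb' (quasimode g) x - z * quasimode g x) ^+ 2)%:E <=
   (2 * (tent x g ^+ 2 * normc (defect x) ^+ 2))%:E +
   (2 * c0 ^+ 2)%:E * error_integral g x ^+ 2)%E.
Proof.
move=> /quasimode_defect_le => /(_ g); have := error_integral_ge0 g x.
have c00 : 0 < c0 by rewrite ltr_wpDr// mulrn_wge0.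
case: (error_integral g x) => [i| |] //; last first.
  by move=> _ _; rewrite expe2 mulyy gt0_muley ?addey ?leey// lte_fin mulr_gt0// exprn_gt0.
rewrite lee_fin => i0; rewrite -EFin_expe -!EFinM -!EFinD !lee_fin => h.
set a := normc _ in h *; set t := tent x g * _ in h; set s := c0 * i in h.
have a2 : a ^+ 2 <= (t + s) ^+ 2.
  rewrite ler_pXn2r// nnegrE ?normc_ge0//; exact: le_trans (normc_ge0 _) h.
apply: le_trans a2 _; rewrite -exprMn -/t -mulrA -exprMn -/s.
by have := sqr_ge0 (t - s); rewrite !expr2; lra.
Qed.

Lemma measurable_error_integrand : measurable_fun setT (fun p : (E * E) * E =>
  (normc (K p.1.1 p.1.2) * q p.1.1 p.1.2 * (near_weight p * normc (f p.1.2)))%:E).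
Proof.
apply/measurable_EFinP; apply: measurable_funM.
  apply: measurable_funM.
    have [mK _ _] := KA.
    exact: (measurableT_comp (measurable_normc mK) measurable_fst).
  exact: (measurableT_comp (measurable_truncated_dist theta) measurable_fst).
apply: measurable_funM; first exact: measurable_near_weight.
by apply: (measurableT_comp (measurable_normc mf)); exact: measurableT_comp.
Qed.

Lemma measurable_error_integral :
  measurable_fun setT (fun p : E * E => error_integral p.1 p.2).
Proof.
apply: (@measurable_fun_fubini_tonelli_F _ _ _ _ _ leb
  (fun r : (E * E) * E => (normc (K r.1.2 r.2) * q r.1.2 r.2 *
    (near_weight (r.1.2, r.2, r.1.1) * normc (f r.2)))%:E)) => [|r]; last first.
  rewrite lee_fin mulr_ge0// mulr_ge0 ?normc_ge0//; first exact: truncated_dist_ge0.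
  exact: near_weight_ge0.
apply: (measurableT_comp measurable_error_integrand
  (g := fun r : (E * E) * E => (r.1.2, r.2, r.1.1))).
apply: measurable_fun_pair; last exact: measurableT_comp.
by apply: measurable_fun_pair => //; exact: measurableT_comp.
Qed.

Lemma quasimode_estimate (eta : R) : 0 <= eta ->
  (forall g, L2 g -> eta * L2sq g <= L2sq (fun x => Tb' g x - z * g x)) ->
  eta * L2sq f <= 32 * c0 ^+ 2 * 2 ^+ d * (L2sq defect + A1 ^+ 2 * L2sq f).
Proof.
move=> eta0 h.
have Kb := magnetic_kernel_bound phi_continuous b KA.
have Kb' := magnetic_kernel_bound phi_continuous (b + delta) KA.
have c00 : 0 < c0 by rewrite ltr_wpDr// mulrn_wge0.
have hL : L2 defect.
  by apply: L2B; [case: (L2_integral_op A0 Kb fL)|exact: L2Z].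
have [mh _] := hL.
have mEg g : measurable_fun setT (error_integral g).
  exact: (measurableT_comp measurable_error_integral (pair1_measurable g)).
have mtd g : measurable_fun setT (fun x => tent x g ^+ 2 * normc (defect x) ^+ 2).
  apply: measurable_funM; last by apply: measurable_funX; exact: measurable_normc.
  apply: measurable_funX.
  exact: (measurableT_comp (measurable_tent theta) (pair2_measurable g)).
have step g : (eta%:E * \int[leb]_x (tent x g ^+ 2 * normc (f x) ^+ 2)%:E <=
    2%:E * \int[leb]_x (tent x g ^+ 2 * normc (defect x) ^+ 2)%:E +
    (2 * c0 ^+ 2)%:E * \int[leb]_x error_integral g x ^+ 2)%E.
  have gL := L2_quasimode g.
  have rL : L2 (fun x => Tb' (quasimode g) x - z * quasimode g x).
    by apply: L2B; [case: (L2_integral_op A0 Kb' gL)|exact: L2Z].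
  have := h _ gL; rewrite -lee_fin EFinM !L2sqE//.
  under eq_integral do rewrite normc_quasimode exprMn.
  move/le_trans; apply.
  rewrite -ge0_integralZl_EFin//; last 2 first.
  - by move=> x _; rewrite lee_fin mulr_ge0// sqr_ge0.
  - exact/measurable_EFinP.
  rewrite -ge0_integralZl_EFin//; last 2 first.
  - by move=> x _; exact: sqre_ge0.
  - exact: emeasurable_funM.
  rewrite -ge0_integralD//; last 4 first.
  - by move=> x _; rewrite -EFinM lee_fin mulr_ge0// mulr_ge0// sqr_ge0.
  - by apply: measurable_funeM; exact/measurable_EFinP.
  - by move=> x _; rewrite mule_ge0 ?sqre_ge0// lee_fin mulr_ge0// sqr_ge0.
  - by apply: measurable_funeM; exact: emeasurable_funM.
  apply: ae_ge0_le_integral => //.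
  - by move=> x _; rewrite lee_fin sqr_ge0.
  - by apply: measurable_sqr_normc; case: rL.
  - move=> x _; apply: adde_ge0.
      by rewrite -EFinM lee_fin mulr_ge0// mulr_ge0// sqr_ge0.
    by rewrite mule_ge0 ?sqre_ge0// lee_fin mulr_ge0// sqr_ge0.
  - apply: emeasurable_funD; apply: measurable_funeM; first exact/measurable_EFinP.
    exact: emeasurable_funM.
  apply: filterS (ae_abs_integral_lty A0 KA fL) => x fx _.
  by rewrite -EFinM; exact: sqr_quasimode_defect_le.
have mI2 : measurable_fun setT (fun g => \int[leb]_x error_integral g x ^+ 2)%E.
  apply: (@measurable_fun_fubini_tonelli_F _ _ _ _ _ leb
    (fun p => error_integral p.1 p.2 ^+ 2)%E) => [|p]; last exact: sqre_ge0.
  by apply: emeasurable_funM; exact: measurable_error_integral.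
have mT (u : E -> R) : measurable_fun setT u -> (forall x, 0 <= u x) ->
    measurable_fun setT (fun g => \int[leb]_x (tent x g ^+ 2 * u x)%:E)%E.
  move=> mu_ u0; apply: (@measurable_fun_fubini_tonelli_F _ _ _ _ _ leb
    (fun p => (tent p.2 p.1 ^+ 2 * u p.2)%:E)) => [|p]; last first.
    by rewrite lee_fin mulr_ge0// sqr_ge0.
  apply/measurable_EFinP; apply: measurable_funM; last exact: measurableT_comp.
  apply: measurable_funX.
  exact: (measurableT_comp (measurable_tent theta) (@measurable_swap _ _ _ _)).
have mnf : measurable_fun setT (fun x => normc (f x) ^+ 2).
  by apply: measurable_funX; exact: measurable_normc.
have mnh : measurable_fun setT (fun x => normc (defect x) ^+ 2).
  by apply: measurable_funX; exact: measurable_normc.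
have sq0 (u : E -> R[i]) x : 0 <= normc (u x) ^+ 2 by exact: sqr_ge0.
have I0 (u : E -> R) g : (forall x, 0 <= u x) -> (0 <= \int[leb]_x (tent x g ^+ 2 * u x)%:E)%E.
  by move=> u0; apply: integral_ge0 => x _; rewrite lee_fin mulr_ge0// sqr_ge0.
have J0 g : (0 <= \int[leb]_x error_integral g x ^+ 2)%E.
  by apply: integral_ge0 => x _; exact: sqre_ge0.
pose V := theta^-1 ^+ d.
have V0 : 0 < V by rewrite exprn_gt0// invr_gt0.
have tot : (eta%:E * ((V / 4)%:E * (L2sq f)%:E) <=
    2%:E * (((theta^-1 *+ 2) ^+ d)%:E * (L2sq defect)%:E) +
    (2 * c0 ^+ 2)%:E * ((A1 ^+ 2 * (4 * (theta^-1 *+ 2) ^+ d))%:E * (L2sq f)%:E))%E.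
  rewrite !L2sqE//.
  apply: (@le_trans _ _ (eta%:E *
      \int[leb]_g \int[leb]_x (tent x g ^+ 2 * normc (f x) ^+ 2)%:E)%E).
    by rewrite lee_wpmul2l ?lee_fin//; exact: tent_average_ge.
  rewrite -ge0_integralZl_EFin//; [|by move=> g _; exact: I0|exact: mT].
  apply: le_trans (ge0_le_integralT leb _ step) _.
    by move=> g; rewrite mule_ge0 ?lee_fin//; exact: I0.
  rewrite ge0_integralD//; last 4 first.
  - by move=> g _; rewrite mule_ge0 ?lee_fin//; exact: I0.
  - by apply: measurable_funeM; exact: mT.
  - by move=> g _; rewrite mule_ge0 ?lee_fin ?mulr_ge0 ?sqr_ge0.
  - exact: measurable_funeM.
  apply: leeD.
    rewrite ge0_integralZl_EFin//; [|by move=> g _; exact: I0|exact: mT].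
    by rewrite lee_wpmul2l ?lee_fin//; exact: tent_average_le.
  rewrite ge0_integralZl_EFin//.
  rewrite lee_wpmul2l ?lee_fin ?mulr_ge0 ?sqr_ge0//.
  apply: (@schur_test_param _ _ _ _ R leb leb (fun p => normc (K p.1 p.2) * q p.1 p.2)
    A1 _ _ A10 KA1 KA1' near_weight _ (fun y => normc (f y))).
  - apply: measurable_funM; first by case: KA => mK _ _; exact: measurable_normc.
    exact: measurable_truncated_dist.
  - by move=> p; rewrite mulr_ge0 ?normc_ge0//; exact: truncated_dist_ge0.
  - exact: measurable_near_weight.
  - exact: near_weight_ge0.
  - by rewrite mulr_ge0// exprn_ge0// mulrn_wge0// invr_ge0 ltW.
  - exact: integral_sqr_near_weight.
  - exact: measurable_normc.
  - by move=> x; exact: normc_ge0.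
move: tot; rewrite -!EFinM -EFinD lee_fin.
have -> : (theta^-1 *+ 2) ^+ d = 2 ^+ d * V by rewrite -[theta^-1 *+ 2]mulr_natl exprMn.
have F0 := L2sq_ge0 f; have H0 := L2sq_ge0 defect.
have d0 : 0 <= 2 ^+ d * L2sq defect by rewrite mulr_ge0// exprn_ge0.
rewrite -(ler_pM2l (_ : 0 < 4 / V)) ?divr_gt0// => tot.
apply: (le_trans (le_trans _ tot)).
  by rewrite le_eqVlt; apply/orP; left; apply/eqP; field; exact: lt0r_neq0.
have -> : 4 / V * (2 * (2 ^+ d * V * L2sq defect) +
    2 * c0 ^+ 2 * (A1 ^+ 2 * (4 * (2 ^+ d * V)) * L2sq f)) =
    8 * (2 ^+ d * L2sq defect) + 32 * c0 ^+ 2 * 2 ^+ d * (A1 ^+ 2 * L2sq f).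
  by field; exact: lt0r_neq0.
rewrite [leRHS]mulrDr lerD2r.
have -> : 32 * c0 ^+ 2 * 2 ^+ d * L2sq defect = 32 * c0 ^+ 2 * (2 ^+ d * L2sq defect) by ring.
rewrite ler_wpM2r//.
have c3 : 3 <= c0 by rewrite lerDl mulrn_wge0.
have : 3 * 3 <= c0 * c0 by apply: ler_pM.
by rewrite expr2; lra.
Qed.

End localized_quasimodes.

(** * Comparison of the spectra *)

Section hausdorff_distance.
Variable R : realType.
Implicit Types S : set R[i].
Local Notation normc := Normc.normc.

Definition within_dist (r : R) S1 S2 :=
  (forall x, S1 x -> exists2 y, S2 y & normc (x - y) <= r) /\
  (forall y, S2 y -> exists2 x, S1 x & normc (x - y) <= r).

Lemma normc_subC (x y : R[i]) : normc (x - y) = normc (y - x).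
Proof. by rewrite -normcN opprB. Qed.

Lemma within_distC r S1 S2 : within_dist r S1 S2 -> within_dist r S2 S1.
Proof.
by move=> [h1 h2]; split=> x /[dup] Sx; [move/h2|move/h1]; move=> [y Sy xy];
  exists y => //; rewrite normc_subC.
Qed.

Lemma within_dist0 S : within_dist 0 S S.
Proof. by split=> x Sx; exists x => //; rewrite subrr Normc.normc0. Qed.

Lemma hausdorff_dist_le r S1 S2 : within_dist r S1 S2 ->
  (hausdorff_dist S1 S2 <= r%:E)%E.
Proof.
move=> [h1 h2]; rewrite /hausdorff_dist ge_max; apply/andP; split;
  apply: ge_ereal_sup => _ [x Sx <-].
- have [y Sy xy] := h1 x Sx; apply: (@le_trans _ _ (normc (x - y))%:E).
    by apply: ereal_inf_lbound; exists y.
  by rewrite lee_fin.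
- have [y Sy xy] := h2 x Sx; apply: (@le_trans _ _ (normc (y - x))%:E).
    by apply: ereal_inf_lbound; exists y.
  by rewrite lee_fin.
Qed.

Lemma hausdorff_dist_ge0 S1 S2 : S1 !=set0 -> (0 <= hausdorff_dist S1 S2)%E.
Proof.
move=> [x Sx]; rewrite /hausdorff_dist le_max; apply/orP; left.
apply: (@le_trans _ _ (ereal_inf [set (normc (x - y))%:E | y in S2])).
  by apply: le_ereal_inf_tmp => _ [y _ <-]; rewrite lee_fin normc_ge0.
by apply: ereal_sup_ubound; exists x.
Qed.

Lemma normc_triangle (x y z : R[i]) : normc (x - z) <= normc (x - y) + normc (y - z).
Proof. by rewrite -(subrKA y x) le_normcD. Qed.

Lemma hausdorff_dist_triangle r S1 S2 S : within_dist r S1 S2 ->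
  (hausdorff_dist S2 S <= hausdorff_dist S1 S + r%:E)%E.
Proof.
move=> [h1 h2]; rewrite {1}/hausdorff_dist ge_max; apply/andP; split;
  apply: ge_ereal_sup => _ [x Sx <-].
- have [w Sw wx] := h2 x Sx.
  apply: (@le_trans _ _ (ereal_inf [set (normc (w - y))%:E | y in S] + r%:E)%E); last first.
    rewrite leeD2r// /hausdorff_dist le_max; apply/orP; left.
    by apply: ereal_sup_ubound; exists w.
  rewrite -leeBlDr//; apply: le_ereal_inf_tmp => _ [y Sy <-].
  rewrite leeBlDr// -EFinD; apply: (@le_trans _ _ (normc (x - y))%:E).
    by apply: ereal_inf_lbound; exists y.
  rewrite lee_fin; apply: le_trans (normc_triangle x w y) _.
  by rewrite (normc_subC x) addrC lerD2l.
- apply: (@le_trans _ _ (ereal_inf [set (normc (w - x))%:E | w in S1] + r%:E)%E); last first.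
    rewrite leeD2r// /hausdorff_dist le_max; apply/orP; right.
    by apply: ereal_sup_ubound; exists x.
  rewrite -leeBlDr//; apply: le_ereal_inf_tmp => _ [w Sw <-].
  have [y Sy wy] := h1 w Sw.
  rewrite leeBlDr// -EFinD; apply: (@le_trans _ _ (normc (y - x))%:E).
    by apply: ereal_inf_lbound; exists y.
  rewrite lee_fin; apply: le_trans (normc_triangle y w x) _.
  by rewrite (normc_subC y) addrC lerD2l.
Qed.

Lemma fine_hausdorff_dist_le r S1 S2 S : within_dist r S1 S2 ->
  hausdorff_dist S1 S \is a fin_num -> hausdorff_dist S2 S \is a fin_num ->
  `|fine (hausdorff_dist S2 S) - fine (hausdorff_dist S1 S)| <= r.
Proof.
move=> h f1 f2; have := hausdorff_dist_triangle S h.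
have := hausdorff_dist_triangle S (within_distC h).
rewrite -(fineK f1) -(fineK f2) -!EFinD !lee_fin => ? ?.
by rewrite ler_norml; apply/andP; split; lra.
Qed.

End hausdorff_distance.

Section magnetic_spectra.
Variables (R : realType) (d : nat).
Local Notation E := 'rV[R]_d.
Local Notation leb := (lebesgue_rV R d).
Local Notation normc := Normc.normc.

Lemma spectrum_eqL2 (T T' : (E -> R[i]) -> E -> R[i]) :
  bounded_op T -> bounded_op T' -> (forall f, L2 f -> eqL2 (T f) (T' f)) ->
  spectrum T = spectrum T'.
Proof.
suff incl (U U' : (E -> R[i]) -> E -> R[i]) : bounded_op U -> bounded_op U' ->
    (forall f, L2 f -> eqL2 (U f) (U' f)) -> resolvent_set U `<=` resolvent_set U'.
  move=> bT bT' TT'; congr (~` _); apply/seteqP; split; apply: incl => // f fL.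
  by apply: eqL2_sym; exact: TT'.
move=> [UL _ _ _] [UL' _ _ _] UU' z [S [bS SU US]].
have [SL Se _ _] := bS; exists S; split => // f fL.
- apply: eqL2_trans (SU f fL); apply: Se.
  + by apply: L2B; [exact: UL'|exact: L2Z].
  + by apply: L2B; [exact: UL|exact: L2Z].
  + by apply: filterS (UU' f fL) => x ->.
- apply: eqL2_trans (US f fL).
  by apply: filterS (UU' _ (SL f fL)) => x ->.
Qed.

Variables (phi : E -> E -> R) (K : E -> E -> R[i]) (A : R).
Hypothesis d_gt0 : (0 < d)%N.
Hypothesis phi_continuous : continuous (fun p : E * E => phi p.1 p.2).
Hypothesis phiN : forall x y, phi x y = - phi y x.
Hypothesis phi_flux : forall x y x', `|phi x y + phi y x' - phi x x'|
  <= enorm (x - y) * enorm (y - x').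
Hypotheses (A0 : 0 < A) (KA : kernel_bound K A).
Hypothesis K_hermitian : forall x y, x != y -> K y x = conjc (K x y).

Local Notation Hb b := (integral_op (magnetic_kernel phi b K)).

Lemma bounded_magnetic b : bounded_op (Hb b).
Proof. exact: (bounded_integral_op A0 (magnetic_kernel_bound phi_continuous b KA)). Qed.

Lemma self_adjoint_magnetic b : self_adjoint (Hb b).
Proof.
apply: (self_adjoint_integral_op A0 (magnetic_kernel_bound phi_continuous b KA)) => //.
exact: magnetic_kernel_hermitian.
Qed.

Lemma spectrum_magnetic_neq0 b : spectrum (Hb b) !=set0.
Proof.
pose f (y : E) : R[i] := (\1_(cube 0 1) y)%:C%C.
have fL : L2 f by exact: L2_cube.
have f0 : 0 < L2sq f.
  rewrite -lte_fin L2sqE// (eq_integral (EFin \o \1_(cube 0 1))); last first.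
    by move=> y _; rewrite /f normc_real/= indicE; case: (_ \in _);
      rewrite ?normr1 ?normr0 ?expr1n ?expr0n.
  rewrite integral_indic//; last exact: measurable_cube.
  by rewrite setIT [X in (_ < X)%E]lebesgue_cube// lte_fin exprn_gt0.
have [_ Tf] := L2_integral_op A0 (magnetic_kernel_bound phi_continuous b KA) fL.
have [|mu _ smu] := spectrum_near (bounded_magnetic b) (self_adjoint_magnetic b)
    (l := 0) (ltW A0) fL f0.
  by under [X in L2sq X]eq_fun do rewrite mul0r subr0.
by exists mu%:C%C.
Qed.

Definition localization_constant : R := Num.sqrt (64 * (3 + d%:R *+ 2) ^+ 2 * 2 ^+ d).
Local Notation C1 := localization_constant.

Lemma localization_constant_gt0 : 0 < C1.
Proof.
have c0 : 0 < 3 + d%:R *+ 2 :> R by rewrite ltr_wpDr// mulrn_wge0.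
by rewrite sqrtr_gt0 mulr_gt0 ?exprn_gt0// mulr_gt0 ?exprn_gt0.
Qed.

Definition truncated_dist_bound (theta A1 : R) :=
  (forall x, (\int[leb]_y (normc (K x y) * truncated_dist theta x y)%:E <= A1%:E)%E) /\
  (forall y, (\int[leb]_x (normc (K x y) * truncated_dist theta x y)%:E <= A1%:E)%E).

Lemma spectrum_magnetic_near theta A1 b b' z : 0 < theta -> 0 < A1 ->
  truncated_dist_bound theta A1 -> `|b' - b| = theta ^+ 2 ->
  spectrum (Hb b) z -> exists2 w, spectrum (Hb b') w & normc (z - w) <= C1 * A1.
Proof.
move=> theta0 A10 [K1 K2] bb' zb.
have zE := spectrum_real (bounded_magnetic b) (self_adjoint_magnetic b) zb.
pose l := complex.Re z; rewrite -/l in zE; rewrite {}zE in zb *.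
pose eta := C1 * A1.
have eta0 : 0 <= eta by rewrite mulr_ge0 ?ltW// localization_constant_gt0.
apply: contrapT => hn.
have hg g : L2 g ->
    eta ^+ 2 * L2sq g <= L2sq (fun x => Hb b' g x - l%:C%C * g x).
  move=> gL; rewrite leNgt; apply/negP => gl.
  have [g0|gn0] := eqVneq (L2sq g) 0.
    by move: gl; rewrite g0 mulr0 ltNge L2sq_ge0.
  have gp : 0 < L2sq g by rewrite lt_neqAle eq_sym gn0 L2sq_ge0.
  have [mu mul smu] := spectrum_near (bounded_magnetic b') (self_adjoint_magnetic b')
    eta0 gL gp (ltW gl).
  apply: hn; exists mu%:C%C => //.
  by rewrite -(rmorphB (real_complex R)) normc_real distrC.
have := (spectrumP (bounded_magnetic b) (self_adjoint_magnetic b) l%:C%C).1 zb; apply.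
exists (A1 ^+ 2); first by rewrite exprn_gt0.
move=> f fL.
have bE : b' = b + (b' - b) by ring.
rewrite bE in hg.
have := quasimode_estimate theta0 phi_continuous phi_flux A0 KA A10 K1 K2 bb' fL
  (sqr_ge0 eta) hg.
rewrite /eta exprMn /localization_constant sqr_sqrtr; last first.
  by rewrite mulr_ge0 ?exprn_ge0// mulr_ge0 ?sqr_ge0.
rewrite /defect; set c := 3 + _.
have cp : 0 < 32 * c ^+ 2 * 2 ^+ d.
  have c0 : 0 < c by rewrite ltr_wpDr// mulrn_wge0.
  by rewrite mulr_gt0 ?exprn_gt0// mulr_gt0 ?exprn_gt0.
have -> : 64 * c ^+ 2 * 2 ^+ d * A1 ^+ 2 * L2sq f =
  32 * c ^+ 2 * 2 ^+ d * (2 * (A1 ^+ 2 * L2sq f)) by ring.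
by rewrite ler_pM2l// => h; lra.
Qed.

Lemma within_dist_magnetic theta A1 b b' : 0 < theta -> 0 < A1 ->
  truncated_dist_bound theta A1 -> `|b' - b| = theta ^+ 2 ->
  within_dist (C1 * A1) (spectrum (Hb b)) (spectrum (Hb b')).
Proof.
move=> theta0 A10 KA1 bb'; split=> z zb.
  exact: (spectrum_magnetic_near theta0 A10 KA1 bb' zb).
have b'b : `|b - b'| = theta ^+ 2 by rewrite distrC.
have [w wb zw] := spectrum_magnetic_near theta0 A10 KA1 b'b zb.
by exists w => //; rewrite normc_subC.
Qed.

Lemma within_dist_magnetic_bounded b b' :
  exists r, within_dist r (spectrum (Hb b)) (spectrum (Hb b')).
Proof.
have [->|bn] := eqVneq b b'; first by exists 0; exact: within_dist0.
exists (C1 * A); apply: (@within_dist_magnetic (Num.sqrt `|b' - b|)) => //.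
- by rewrite sqrtr_gt0 normr_gt0 subr_eq0 eq_sym.
- have [_ h1 h2] := KA; have t1 x y : truncated_dist (Num.sqrt `|b' - b|) x y <= 1.
    by rewrite /truncated_dist ge_min lexx.
  have t0 x y : 0 <= truncated_dist (Num.sqrt `|b' - b|) x y.
    by rewrite /truncated_dist le_min ler01 mulr_ge0 ?sqrtr_ge0 ?enorm_ge0.
  split=> x; [apply: le_trans (h1 x)|apply: le_trans (h2 x)];
    apply: ge0_le_integralT => y; rewrite lee_fin ?mulr_ge0 ?normc_ge0//;
    by rewrite ler_piMr ?normc_ge0.
- by rewrite sqr_sqrtr.
Qed.

Lemma truncated_dist_bound_alpha alpha N theta : 0 < alpha -> 0 < theta ->
  (kernel_norm alpha K <= N%:E)%E ->
  truncated_dist_bound theta (theta `^ (Num.min 1 alpha) * N).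
Proof.
move=> alpha0 theta0 /kernel_norm_le[h1 h2].
have [mK _ _] := KA.
have key x y : normc (K x y) * truncated_dist theta x y <=
    theta `^ (Num.min 1 alpha) * (normc (K x y) * japanese (x - y) `^ alpha).
  rewrite mulrCA ler_wpM2l ?normc_ge0//.
  set s := Num.min 1 alpha; set e := enorm (x - y).
  have s0 : 0 < s by rewrite lt_min ltr01.
  have s1 : s <= 1 by rewrite ge_min lexx.
  have e0 : 0 <= e by exact: enorm_ge0.
  apply: (@le_trans _ _ ((theta * e) `^ s)).
    rewrite /truncated_dist -/e; case: (lerP 1 (theta * e)) => h.
      by have := ler_powR h (ltW s0); rewrite powRr0.
    have [te0|te0] := eqVneq (theta * e) 0; first by rewrite te0 powR_ge0.
    have tep : 0 < theta * e by rewrite lt_neqAle eq_sym te0 mulr_ge0// ltW.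
    by apply: ger1_powR => //; rewrite tep ltW.
  rewrite powRM ?(ltW theta0)// ler_wpM2l ?powR_ge0//.
  apply: (@le_trans _ _ (japanese (x - y) `^ s)).
    rewrite ge0_ler_powR ?nnegrE ?(ltW s0)//; last exact: enorm_le_japanese.
    by apply: le_trans (japanese_ge1 _).
  by apply: ler_powR; [exact: japanese_ge1|rewrite /s ge_min lexx orbT].
have mkj : measurable_fun setT (fun p : E * E =>
    (normc (K p.1 p.2) * japanese (p.1 - p.2) `^ alpha)%:E).
  apply/measurable_EFinP; apply: measurable_funM; first exact: measurable_normc.
  apply: (@measurableT_comp _ _ _ _ _ _ (fun t : R => t `^ alpha)).
    exact: measurable_powR.
  exact: measurable_japaneseB.
have k0 x y : 0 <= normc (K x y) * truncated_dist theta x y.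
  by rewrite mulr_ge0 ?normc_ge0//; exact: truncated_dist_ge0.
have j0 x y : (0 <= (normc (K x y) * japanese (x - y) `^ alpha)%:E)%E.
  by rewrite lee_fin mulr_ge0 ?normc_ge0 ?powR_ge0.
split=> x.
  apply: (@le_trans _ _ (\int[leb]_y ((theta `^ (Num.min 1 alpha))%:E *
      (normc (K x y) * japanese (x - y) `^ alpha)%:E))%E).
    by apply: ge0_le_integralT => y; rewrite ?lee_fin// -EFinM lee_fin.
  rewrite ge0_integralZl_EFin ?powR_ge0//; last first.
    exact: (measurableT_comp mkj (pair1_measurable x)).
  by rewrite EFinM lee_wpmul2l// lee_fin powR_ge0.
apply: (@le_trans _ _ (\int[leb]_y ((theta `^ (Num.min 1 alpha))%:E *
    (normc (K y x) * japanese (y - x) `^ alpha)%:E))%E).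
  by apply: ge0_le_integralT => y; rewrite ?lee_fin// -EFinM lee_fin.
rewrite ge0_integralZl_EFin ?powR_ge0//; last first.
  exact: (measurableT_comp mkj (pair2_measurable x)).
by rewrite EFinM lee_wpmul2l// lee_fin powR_ge0.
Qed.

Lemma truncated_dist_bound_unif (M e theta : R) : 0 < M -> 0 < theta ->
  (kernel_norm 0 (fun x y => K x y - truncated_kernel M K x y)%R <= e%:E)%E ->
  truncated_dist_bound theta (e + theta * M * A).
Proof.
move=> M0 theta0 /kernel_norm_le[h1 h2].
have [mK k1 k2] := KA.
pose D x y := K x y - truncated_kernel M K x y.
have DE x y : D x y = if enorm (x - y) <= M then 0 else K x y.
  rewrite /D /truncated_kernel indicE.
  have -> : (enorm (x - y) / M \in (`[0, 1]%classic : set R)) = (enorm (x - y) <= M).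
    apply/idP/idP; rewrite inE/= in_itv/= ler_pdivrMr// mul1r ?divr_ge0 ?enorm_ge0 ?(ltW M0)//.
  by case: ifP => _; rewrite ?mul1r ?subrr// mul0r subr0.
have key x y : normc (K x y) * truncated_dist theta x y <=
    normc (D x y) * japanese (x - y) `^ 0 + theta * M * normc (K x y).
  rewrite powRr0 mulr1 DE; have n0 := normc_ge0 (K x y).
  have tM : 0 <= theta * M by rewrite mulr_ge0// ltW.
  case: ifP => h.
    rewrite Normc.normc0 add0r mulrC ler_wpM2r//.
    by rewrite /truncated_dist ge_min ler_wpM2l ?orbT// ltW.
  apply: (@le_trans _ _ (normc (K x y))); last by rewrite lerDl mulr_ge0.
  by rewrite ler_piMr// /truncated_dist ge_min lexx.
have k0 x y : 0 <= normc (K x y) * truncated_dist theta x y.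
  by rewrite mulr_ge0 ?normc_ge0//; exact: truncated_dist_ge0.
have mnK : measurable_fun setT (fun p : E * E => (normc (K p.1 p.2))%:E).
  by apply/measurable_EFinP; exact: measurable_normc.
have mD : measurable_fun setT (fun p : E * E =>
    (normc (D p.1 p.2) * japanese (p.1 - p.2) `^ 0)%:E).
  under eq_fun do rewrite powRr0 mulr1 DE.
  apply/measurable_EFinP; apply: measurable_normc; split.
    rewrite (_ : (fun _ => _) =
      (fun p : E * E =>
        if enorm (p.1 - p.2) <= M then 0 else complex.Re (K p.1 p.2))).
      apply: measurable_fun_ifT => //; last by case: mK.
      by apply: measurable_fun_ler => //; exact: measurable_enormB.
    by apply/funext => p; case: ifP.
  rewrite (_ : (fun _ => _) =
    (fun p : E * E =>
      if enorm (p.1 - p.2) <= M then 0 else complex.Im (K p.1 p.2))).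
    apply: measurable_fun_ifT => //; last by case: mK.
    by apply: measurable_fun_ler => //; exact: measurable_enormB.
  by apply/funext => p; case: ifP.
have D0 x y : (0 <= (normc (D x y) * japanese (x - y) `^ 0)%:E)%E.
  by rewrite lee_fin mulr_ge0 ?normc_ge0 ?powR_ge0.
have tM : 0 <= theta * M by rewrite mulr_ge0// ltW.
have nK0 x y : (0 <= (normc (K x y))%:E)%E by rewrite lee_fin normc_ge0.
split=> x.
  apply: (@le_trans _ _ (\int[leb]_y ((normc (D x y) * japanese (x - y) `^ 0)%:E +
      (theta * M)%:E * (normc (K x y))%:E))%E).
    by apply: ge0_le_integralT => y; rewrite ?lee_fin// -EFinM -EFinD lee_fin.
  have mKx : measurable_fun setT (fun y => (normc (K x y))%:E).
    exact: (measurableT_comp mnK (pair1_measurable x)).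
  rewrite ge0_integralD//; last 3 first.
  - exact: (measurableT_comp mD (pair1_measurable x)).
  - by move=> y _; rewrite mule_ge0.
  - exact: measurable_funeM.
  rewrite ge0_integralZl_EFin// EFinD [(theta * M * A)%:E]EFinM; apply: leeD; first exact: h1.
  by rewrite lee_wpmul2l ?lee_fin.
apply: (@le_trans _ _ (\int[leb]_y ((normc (D y x) * japanese (y - x) `^ 0)%:E +
    (theta * M)%:E * (normc (K y x))%:E))%E).
  by apply: ge0_le_integralT => y; rewrite ?lee_fin// -EFinM -EFinD lee_fin.
have mKx : measurable_fun setT (fun y => (normc (K y x))%:E).
  exact: (measurableT_comp mnK (pair2_measurable x)).
rewrite ge0_integralD//; last 3 first.
- exact: (measurableT_comp mD (pair2_measurable x)).
- by move=> y _; rewrite mule_ge0.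
- exact: measurable_funeM.
rewrite ge0_integralZl_EFin// EFinD [(theta * M * A)%:E]EFinM; apply: leeD; first exact: h2.
by rewrite lee_wpmul2l ?lee_fin.
Qed.

End magnetic_spectra.

Theorem theorem1p1 (R : realType) (d : nat) (phi : 'rV[R]_d -> 'rV[R]_d -> R)
    (H : ('rV[R]_d -> R[i]) -> 'rV[R]_d -> R[i])
    (K : 'rV[R]_d -> 'rV[R]_d -> R[i]) :
  (2 <= d)%N ->
  continuous (fun p : 'rV[R]_d * 'rV[R]_d => phi p.1 p.2) ->
  (forall x x', phi x x' = - phi x' x) ->
  (forall x y x', `|phi x y + phi y x' - phi x x'|
                    <= enorm (x - y) * enorm (y - x')) ->
  in_C1 0 H K ->
  self_adjoint H ->
  let Hb (b : R) := integral_op (magnetic_kernel phi b K) in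
  let dist (b : R) := hausdorff_dist (spectrum (Hb b)) (spectrum H) in
  [/\ forall b : R, (0 <= dist b < +oo)%E,
      in_Cunif H K -> continuous (fun b : R => fine (dist b)) &
      forall alpha : R, 0 < alpha -> in_C1 alpha H K ->
        let beta := Num.min (1 / 2) (alpha / 2) in
        forall b0 : R, exists2 C : R, 0 < C & forall delta : R,
          (hausdorff_dist (spectrum (Hb (b0 + delta)%R)) (spectrum (Hb b0))
             <= (C * `|delta| `^ beta)%:E)%E /\
          `|fine (dist (b0 + delta)) - fine (dist b0)|
             <= C * `|delta| `^ beta].
Proof.
move=> d2 phi_cont phiN phi_flux HC1 Hsa Hb dist.
have d0 : (0 < d)%N by exact: leq_trans d2.
have [A A0 KA] := in_C1_kernel_bound (lexx 0) HC1.
have K_herm := kernel_hermitian HC1 Hsa.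
have [Hbd HK _ _ _] := HC1.
have sH : spectrum H = spectrum (Hb 0).
  rewrite /Hb magnetic_kernel0; apply: spectrum_eqL2 => //.
  exact: bounded_integral_op A0 KA.
have near0 theta A1 b b' := @within_dist_magnetic R d phi K A d0 phi_cont phiN
  phi_flux A0 KA K_herm theta A1 b b'.
set C1 := localization_constant R d in near0.
have C10 : 0 < C1 by exact: localization_constant_gt0.
have near_bounded b b' : exists r, within_dist r (spectrum (Hb b)) (spectrum (Hb b')).
  exact: (within_dist_magnetic_bounded d0 phi_cont phiN phi_flux A0 KA K_herm).
have dist_fin b : (0 <= dist b < +oo)%E.
  rewrite /dist sH; apply/andP; split.
    apply: hausdorff_dist_ge0.
    exact: (spectrum_magnetic_neq0 d0 phi_cont phiN A0 KA K_herm).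
  have [r hr] := near_bounded b 0.
  by apply: le_lt_trans (hausdorff_dist_le hr) _; exact: ltry.
have dist_fin_num b : dist b \is a fin_num.
  by have /andP[? ?] := dist_fin b; rewrite ge0_fin_numE.
have fine_dist_le r b b' : within_dist r (spectrum (Hb b)) (spectrum (Hb b')) ->
    `|fine (dist b') - fine (dist b)| <= r.
  by move=> hr; apply: fine_hausdorff_dist_le => //; exact: dist_fin_num.
split => //.
- move=> [_ Kunif] b0; apply/cvgrPdist_le => e e0.
  pose e1 := e / (2 * C1).
  have e10 : 0 < e1 by rewrite divr_gt0// mulr_gt0.
  have [M M0 KM] : exists2 M, 0 < M &
      (kernel_norm 0 (fun x x' => (K x x' - truncated_kernel M K x x')%R) <= e1%:E)%E.
    have e1_gt0 : (0 < e1%:E)%E by rewrite lte_fin.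
    have [M M0 KM] := pinfty_ex_gt0 (Kunif _ (open_ereal_lt' e1_gt0)).
    by exists M => //; exact: ltW.
  pose t := e1 / (M * A).
  have t0 : 0 < t by rewrite divr_gt0// mulr_gt0.
  exists (t ^+ 2); first by rewrite /= exprn_gt0.
  move=> b /=; rewrite distrC => bt.
  have [->|bn] := eqVneq b b0; first by rewrite subrr normr0 ltW.
  pose theta := Num.sqrt `|b0 - b|.
  have theta0 : 0 < theta by rewrite sqrtr_gt0 normr_gt0 subr_eq0 eq_sym.
  have theta2 : `|b0 - b| = theta ^+ 2 by rewrite sqr_sqrtr.
  have theta_t : theta <= t.
    by rewrite -ler_sqr ?nnegrE ?(ltW t0) ?(ltW theta0)// -theta2 distrC ltW.
  have K1 := truncated_dist_bound_unif KA M0 theta0 KM.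
  have A10 : 0 < e1 + theta * M * A by rewrite addr_gt0// !mulr_gt0.
  apply: le_trans (fine_dist_le _ _ _ (near0 _ _ b b0 theta0 A10 K1 theta2)) _.
  have : theta * (M * A) <= t * (M * A) by rewrite ler_pM2r// mulr_gt0.
  rewrite /t divfK ?gt_eqF ?mulr_gt0// => h.
  have : C1 * (e1 + theta * M * A) <= C1 * (e1 + e1) by rewrite ler_pM2l//; lra.
  move/le_trans; apply; rewrite le_eqVlt; apply/orP; left; apply/eqP.
  by rewrite /e1; field; exact: lt0r_neq0.
- move=> alpha alpha0 KCa beta b0.
  have [N N0 KN] := in_C1_kernel_norm KCa.
  exists (C1 * N); first by rewrite mulr_gt0.
  move=> delta.
  have beta0 : 0 < beta by rewrite lt_min !divr_gt0.
  suff hw : within_dist (C1 * N * `|delta| `^ beta)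
      (spectrum (Hb b0)) (spectrum (Hb (b0 + delta))).
    by split; [exact/hausdorff_dist_le/within_distC|exact: fine_dist_le].
  have [->|dn] := eqVneq delta 0.
    by rewrite addr0 normr0 powR0 ?gt_eqF// mulr0; exact: within_dist0.
  have dp : 0 < `|delta| by rewrite normr_gt0.
  pose theta := Num.sqrt `|delta|.
  have theta0 : 0 < theta by rewrite sqrtr_gt0.
  have -> : C1 * N * `|delta| `^ beta = C1 * (theta `^ (Num.min 1 alpha) * N).
    rewrite /theta -powR12_sqrt ?(ltW dp)// -powRrM.
    have -> : 2^-1 * Num.min 1 alpha = beta by rewrite minr_pMr// mulrC [_ * alpha]mulrC.
    by rewrite mulrAC mulrA.
  apply: (near0 theta) => //.
  - by rewrite mulr_gt0// powR_gt0.
  - exact: (truncated_dist_bound_alpha KA alpha0 theta0 KN).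
  - by rewrite addrAC subrr add0r sqr_sqrtr.
Qed.
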